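(* Let $\Omega\subset\mathbb{R}^N$ be a smooth bounded domain and $0<\alpha<1$. Let $u_0$ and $u^0$ be a subsolution and a supersolution of the problem $$-\Delta u=\frac{1}{u^\alpha}\ \text{ in }\Omega,\qquad u=0\ \text{ on }\partial\Omega,$$ such that $u_0\le u^0$ and $0<c_1 d(x)\le u_0(x)\le u^0(x)\le c_2 d(x)$ in $\Omega$ for some constants $c_1,c_2$. Then the problem has a unique positive solution $u$ with $u_0\le u\le u^0$, and this solution is linearly asymptotically stable.
   Context: $d(x)=\mathrm{dist}(x,\partial\Omega)$. Functions $u_0,u^0\in H^1_0(\Omega)\cap L^\infty(\Omega)$ are called respectively a subsolution and a supersolution of the problem if $$\int_\Omega\nabla u_0\cdot\nabla v\,dx-\int_\Omega u_0^{-\alpha}v\,dx\le 0\le\int_\Omega\nabla u^0\cdot\nabla v\,dx-\int_\Omega (u^0)^{-\alpha}v\,dx\quad\text{for all }v\in H^1_0(\Omega),\ v\ge 0.$$ A (weak) solution $u$ with $u_0\le u\le u^0$ is a function $u\in H^1_0(\Omega)$ with $\int_\Omega\nabla u\cdot\nabla v\,dx=\int_\Omega u^{-\alpha}v\,dx$ for all $v\in H^1_0(\Omega)$. The solution $u$ is called linearly asymptotically stable if the linearized eigenvalue problem $$-\Delta w+\alpha\frac{w}{u^{1+\alpha}}=\mu w\ \text{ in }\Omega,\qquad w=0\ \text{ on }\partial\Omega$$ (in the weak sense: $w\in H^1_0(\Omega)\setminus\{0\}$ and $\int_\Omega\nabla w\cdot\nabla v\,dx+\alpha\int_\Omega\frac{wv}{u^{1+\alpha}}dx=\mu\int_\Omega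 wv\,dx$ for all $v\in H^1_0(\Omega)$) has a smallest eigenvalue $\mu_1$, and $\mu_1>0$. *)

(* Defs.v *)
From HB Require Import structures.
From mathcomp Require Import all_boot all_order all_algebra.
From mathcomp Require Import all_classical all_reals all_analysis.

Set Implicit Arguments.
Unset Strict Implicit.
Unset Printing Implicit Defensive.
Import Order.TTheory GRing.Theory Num.Theory.
Import numFieldNormedType.Exports.
Local Open Scope classical_set_scope.
Local Open Scope ring_scope.

Fact rV_display : measure_display. Proof. exact. Qed.

Section measurable_rV.
Context {R : realType} {n : nat}.

Let coors (i : 'I_n) (x : 'rV[R]_n) : measurableTypeR R := x ord0 i.

Let rV_set0 : g_sigma_preimage coors set0.
Proof. exact: sigma_algebra0. Qed.

Let rV_setC A : g_sigma_preimage coors A -> g_sigma_preimage coors (~` A).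
Proof. exact: sigma_algebraC. Qed.

Let rV_bigcup (F : _^nat) : (forall i, g_sigma_preimage coors (F i)) ->
  g_sigma_preimage coors (\bigcup_i (F i)).
Proof. exact: sigma_algebra_bigcup. Qed.

(* The sigma-algebra generated by the coordinates, i.e. the Borel sets. *)
HB.instance Definition _ := @isMeasurable.Build rV_display
  'rV[R]_n (g_sigma_preimage coors) rV_set0 rV_setC rV_bigcup.

End measurable_rV.

Section lebesgue_rV.
Context {R : realType}.

Lemma measurable_coord n (i : 'I_n) :
  measurable_fun [set: 'rV[R]_n] (fun x => x ord0 i : measurableTypeR R).
Proof.
move=> _ Y mY; rewrite setTI; apply: sub_sigma_algebra => /=.
rewrite -bigcup_seq/=; exists i => /=; first by rewrite mem_index_enum.
by exists Y => //; rewrite setTI.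
Qed.

Lemma measurable_fun_rV d (T : measurableType d) n (f : T -> 'rV[R]_n) :
  (forall i, measurable_fun [set: T] (fun x => f x ord0 i : measurableTypeR R)) ->
  measurable_fun [set: T] f.
Proof.
move=> mf _ A mA; rewrite setTI.
suff: preimage_set_system [set: T] f (g_sigma_preimage
    (fun (i : 'I_n) (x : 'rV[R]_n) => x ord0 i : measurableTypeR R))
    `<=` measurable.
  by apply; exists A => //; rewrite setTI.
rewrite -g_sigma_preimage_comp.
apply: smallest_sub; first exact: sigma_algebra_measurable.
case: n => [|n] in f mf {A mA} *; first by rewrite big_ord0.
rewrite -bigcup_mkord_ord; apply: bigcup_sub => i Ii.
by move=> A [B mB <-]; exact: mf.
Qed.

Definition rV_cons n (p : measurableTypeR R * 'rV[R]_n) : 'rV[R]_n.+1 :=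
  row_mx (\row_(_ < 1) p.1) p.2.

Definition rV_uncons n (x : 'rV[R]_n.+1) : measurableTypeR R * 'rV[R]_n :=
  (x ord0 ord0, @rsubmx _ 1 1 n x).

Lemma rV_consK n : cancel (@rV_cons n) (@rV_uncons n).
Proof.
move=> [a x]; rewrite /rV_cons /rV_uncons /=; congr pair; last exact: row_mxKr.
have -> : (ord0 : 'I_n.+1) = lshift n (ord0 : 'I_1) by exact: val_inj.
by rewrite (row_mxEl (\row_(_ < 1) a) x) mxE.
Qed.

Lemma measurable_rV_cons n : measurable_fun [set: _] (@rV_cons n).
Proof.
apply: measurable_fun_rV => i.
case: (split_ordP (i : 'I_(1 + n))) => j ->.
  rewrite (_ : (fun _ => _) = fst); first exact: measurable_fst.
  by apply/funext => p; rewrite /rV_cons (row_mxEl (\row_(_ < 1) p.1)) mxE.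
rewrite (_ : (fun _ => _) = (fun x : 'rV[R]_n => x ord0 j) \o snd).
  exact: (measurableT_comp (measurable_coord j) measurable_snd).
by apply/funext => p; rewrite /rV_cons (row_mxEr (\row_(_ < 1) p.1)).
Qed.

Lemma measurable_rV_uncons n : measurable_fun [set: _] (@rV_uncons n).
Proof.
apply/measurable_fun_pairP; split; first exact: measurable_coord.
apply: measurable_fun_rV => i.
rewrite (_ : (fun _ => _) = fun x : 'rV[R]_n.+1 => x ord0 (rshift 1 i)).
  exact: measurable_coord.
by apply/funext => x; rewrite /= mxE.
Qed.

Section step.
Context n (m : {sigma_finite_measure set 'rV[R]_n -> \bar R}).

Definition lebesgue_rV_step : set 'rV[R]_n.+1 -> \bar R :=
  pushforward (@lebesgue_measure R \x m)%E (@rV_cons n).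

Let mpre A : measurable A -> measurable (@rV_cons n @^-1` A).
Proof. by move=> mA; rewrite -[X in measurable X]setTI; exact: measurable_rV_cons. Qed.

Let step0 : lebesgue_rV_step set0 = 0%E.
Proof. by rewrite /lebesgue_rV_step /pushforward preimage_set0 measure0. Qed.

Let step_ge0 A : (0 <= lebesgue_rV_step A)%E.
Proof. by rewrite /lebesgue_rV_step /pushforward; exact: measure_ge0. Qed.

Let step_sigma_additive : semi_sigma_additive lebesgue_rV_step.
Proof.
move=> F mF tF mUF; rewrite /lebesgue_rV_step /pushforward preimage_bigcup.
apply: measure_semi_sigma_additive.
- by move=> k; exact: mpre.
- apply/trivIsetP => /= i j _ _ ij; rewrite -preimage_setI.
  by move/trivIsetP : tF => /(_ _ _ _ _ ij) ->//; rewrite preimage_set0.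
- by rewrite -preimage_bigcup; exact: mpre.
Qed.

HB.instance Definition _ := isMeasure.Build _ _ _ lebesgue_rV_step
  step0 step_ge0 step_sigma_additive.

Let step_sigma_finite : sigma_finite [set: _] lebesgue_rV_step.
Proof.
have /sigma_finiteP[F [TF ndF Foo]] := sigma_finiteT (@lebesgue_measure R).
have /sigma_finiteP[G [TG ndG Goo]] := sigma_finiteT m.
exists (fun k => @rV_uncons n @^-1` (F k `*` G k)).
  rewrite -preimage_bigcup (_ : \bigcup_i _ = setT) ?preimage_setT//.
  rewrite -setXTT TF TG predeqE => -[x y]; split.
    by move=> [k _ []/= ? ?]; split; exists k.
  move=> [/= [i _ Fnx] [j _ Gky]]; exists (maxn i j) => //; split.
  - by move: x Fnx; exact/subsetPset/ndF/leq_maxl.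
  - by move: y Gky; exact/subsetPset/ndG/leq_maxr.
move=> k; have [mF Fk] := Foo k; have [mG Gk] := Goo k; split.
  rewrite -[X in measurable X]setTI; apply: measurable_rV_uncons => //.
  exact: measurableX.
rewrite /lebesgue_rV_step /pushforward -comp_preimage.
rewrite (_ : _ \o _ = id); last by apply/funext => p; exact: rV_consK.
by rewrite preimage_id product_measure1E// lte_mul_pinfty// ge0_fin_numE.
Qed.

HB.instance Definition _ := Measure_isSigmaFinite.Build _ _ _
  lebesgue_rV_step step_sigma_finite.

End step.

(* Lebesgue measure on R^n, by iterated products: it is the pushforward of
   (Lebesgue measure on R) x (Lebesgue measure on R^(n-1)) under (t, y) |-> (t | y). *)
Fixpoint lebesgue_rV (n : nat) : {sigma_finite_measure set 'rV[R]_n -> \bar R} :=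
  match n with
  | 0 => dirac (0 : 'rV[R]_0)
  | n'.+1 => lebesgue_rV_step (lebesgue_rV n')
  end.

End lebesgue_rV.


Section euclidean.
Context {R : realType} {N : nat}.
Implicit Types (x y : 'rV[R]_N) (U : set 'rV[R]_N).

Definition dot x y : R := \sum_(i < N) x ord0 i * y ord0 i.

(* The library norm on 'rV[R]_N is the sup norm. *)
Definition enorm x : R := Num.sqrt (dot x x).

Definition boundary U : set 'rV[R]_N := closure U `\` U°.

Definition bdist U x : R := inf [set enorm (x - y) | y in boundary U].

Definition pderiv (i : 'I_N) (f : 'rV[R]_N -> R) : 'rV[R]_N -> R :=
  'D_(delta_mx ord0 i) f.

Fixpoint Ck (k : nat) (f : 'rV[R]_N -> R) : Prop :=
  match k with
  | 0 => continuous f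
  | k'.+1 => [/\ continuous f,
      forall i x, derivable f x (delta_mx ord0 i)
    & forall i, Ck k' (pderiv i f)]
  end.

Definition smooth (f : 'rV[R]_N -> R) : Prop := forall k, Ck k f.

End euclidean.

(* Near each boundary point, after relabelling the axes and possibly reversing
   one of them, U is the strict epigraph of a smooth function of the other
   N - 1 coordinates. *)
Definition smooth_boundary {R : realType} {N : nat} (U : set 'rV[R]_N) : Prop :=
  forall p, boundary U p ->
  exists (i : 'I_N) (s : bool) (g : 'rV[R]_N.-1 -> R), smooth g /\
    \forall x \near p, U x <-> g (col' i x) < (-1) ^+ s * x ord0 i.

Record smooth_bounded_domain {R : realType} {N : nat} (U : set 'rV[R]_N) : Prop :=
  SmoothBoundedDomain {
    domain_nonempty : U !=set0;
    domain_open : open U;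
    domain_connected : connected U;
    domain_bounded : bounded_set U;
    domain_smooth : smooth_boundary U }.

(* Sobolev functions are represented by Borel functions on the whole of R^N, of
   which only the values on U matter, and only up to null sets. *)
Section sobolev.
Context {R : realType} {N : nat}.
Variable U : set 'rV[R]_N.
Local Notation mu := (@lebesgue_rV R N).
Implicit Types (u v : 'rV[R]_N -> R) (G : 'rV[R]_N -> 'rV[R]_N).

Definition inLp (p : \bar R) u : Prop := (u \_ U) \in Lfun mu p.

Definition cvgL2 (u_ : nat -> 'rV[R]_N -> R) u : Prop :=
  Lnorm mu 2%:E (EFin \o ((u_ k \- u)%R \_ U)) @[k --> \oo] --> 0%E.

Definition test_function (phi : 'rV[R]_N -> R) : Prop :=
  smooth phi /\
  exists K, [/\ compact K, K `<=` U & forall x, ~ K x -> phi x = 0].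

Definition is_wgrad u G : Prop :=
  forall i : 'I_N, inLp 2%:E (fun x => G x ord0 i) /\
    forall phi, test_function phi ->
      (\int[mu]_(x in U) (u x * pderiv i phi x)%:E =
       - \int[mu]_(x in U) (G x ord0 i * phi x)%:E)%E.

Definition H1 : set ('rV[R]_N -> R) :=
  [set u | inLp 2%:E u /\ exists G, is_wgrad u G].

(* A weak gradient is unique up to null sets; [wgrad u] is a choice of one. *)
Definition wgrad u : 'rV[R]_N -> 'rV[R]_N := get (is_wgrad u).

(* The closure of the test functions in H1. *)
Definition H10 : set ('rV[R]_N -> R) :=
  [set u | H1 u /\ exists phi_ : nat -> 'rV[R]_N -> R,
    [/\ forall k, test_function (phi_ k),
        cvgL2 phi_ u
      & forall i, cvgL2 (fun k => pderiv i (phi_ k)) (fun x => wgrad u x ord0 i)]].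

Definition dirichlet u v : \bar R :=
  (\int[mu]_(x in U) (dot (wgrad u x) (wgrad v x))%:E)%E.

Definition ae_le u v : Prop := \forall x \ae mu, U x -> u x <= v x.

Definition ae_pos u : Prop := \forall x \ae mu, U x -> 0 < u x.

End sobolev.

(* The integrals below are extended-real, with [+oo - +oo = -oo]; so an equation
   between such an integral and a finite quantity contains the integrability of
   the integrand.  [u x `^ (- alpha)] has its usual meaning for [u x > 0]. *)
Section problem.
Context {R : realType} {N : nat}.
Variables (U : set 'rV[R]_N) (alpha : R).
Local Notation mu := (@lebesgue_rV R N).
Implicit Types (u v w : 'rV[R]_N -> R).

Definition singular u v : \bar R :=
  (\int[mu]_(x in U) (u x `^ (- alpha) * v x)%:E)%E.

Definition subsolution u : Prop :=
  [/\ H10 U u, inLp U +oo%E u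
    & forall v, H10 U v -> ae_le U (cst 0) v ->
        (dirichlet U u v - singular u v <= 0)%E].

Definition supersolution u : Prop :=
  [/\ H10 U u, inLp U +oo%E u
    & forall v, H10 U v -> ae_le U (cst 0) v ->
        (0 <= dirichlet U u v - singular u v)%E].

Definition weak_solution u : Prop :=
  H10 U u /\ forall v, H10 U v -> dirichlet U u v = singular u v.

Definition linearized_eigenvalue u (m : R) : Prop :=
  exists w, [/\ H10 U w, ~ (w = cst 0 %[ae mu in U])
    & forall v, H10 U v ->
        (dirichlet U w v +
         alpha%:E * \int[mu]_(x in U) (w x * v x / u x `^ (1 + alpha))%:E =
         m%:E * \int[mu]_(x in U) (w x * v x)%:E)%E].

Definition linearly_stable u : Prop :=
  exists m1 : R, [/\ linearized_eigenvalue u m1,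
    forall m, linearized_eigenvalue u m -> m1 <= m
  & 0 < m1].

End problem.

(* Main.v *)
Require Import Defs.
From mathcomp Require Import all_boot all_order all_algebra.
From mathcomp Require Import all_classical all_reals all_analysis.
From mathcomp Require Import measurable_realfun.
From mathcomp Require Import ring lra.

(** The proof is variational. As the distance to the boundary is positive in
    the domain, the bounds give [0 < usub <= usup <= K * usub] almost
    everywhere, for some constant [K]; this comparability is what makes the
    singular integrals finite.

    The singular term. Testing the inequality of the supersolution with an
    approximation of [|v|] gives [\int usup `^ (- alpha) * |v| <= C * |grad v|]
    ([hardy_weight_supersolution]); since [usup <= K * usub], the same holds
    with [usub] ([hardy_weight_subsolution]). So the singular integrals of
    every function above [usub] are finite, and continuous in [v].

    Existence. Freeze the nonlinearity below [usub]. It is then bounded by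
    [usub `^ (- alpha)] and decreasing, so that the associated energy is
    bounded below and strictly convex; by the parallelogram law its minimizing
    sequences converge ([truncated_minimizer]), and the minimizer [u] solves the
    truncated equation ([truncated_solution]). A weak maximum principle
    ([weak_maximum_principle]) puts [u] between [usub] and [usup], where the
    truncation is not active ([solution_between]). Uniqueness is the
    monotonicity of the nonlinearity ([solution_unique]).

    Stability. Testing the equation of [u] with [psi ^+ 2 / u] and using
    Young's inequality, as in Picone's identity, gives the Hardy inequality
    [\int psi ^+ 2 / u `^ (1 + alpha) <= 4 / 3 * \int |grad psi| ^+ 2]
    ([hardy]). The linearized operator thus has a form that is finite and
    equivalent to the Dirichlet form on [H10]. Its minimum on the unit sphere
    of the square integrable functions is attained by compactness of the
    embedding ([rellich]), is positive by the Poincare inequality, and is the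
    smallest eigenvalue ([first_eigenfunction]).

    The theory of [H10] rests on translations: the estimate [n2_shift] of the
    effect of a translation on a test function by its gradient gives both the
    Poincare inequality and, through averages on the cells of a grid, the
    compactness. Positive parts, absolute values and inverses are replaced
    throughout by smooth substitutes, so that the chain rule for smooth
    functions ([h10_comp]) is enough. *)

Set Implicit Arguments.
Unset Strict Implicit.
Unset Printing Implicit Defensive.
Import Order.TTheory GRing.Theory Num.Theory.
Import numFieldNormedType.Exports.
Local Open Scope classical_set_scope.
Local Open Scope ring_scope.

(** * Almost everywhere statements and real integrals *)

Section real_integral.
Context d (T : measurableType d) (R : realType).
Variables (mu : {measure set T -> \bar R}) (D : set T).
Hypothesis mD : measurable D.
Implicit Types (f g h : T -> R) (P Q : T -> Prop).

Definition aeD P : Prop := \forall x \ae mu, D x -> P x.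

Definition summable_fun f : Prop := mu.-integrable D (EFin \o f).

Lemma aeD_all P : (forall x, D x -> P x) -> aeD P.
Proof. by move=> h; rewrite /aeD; exact: aeW. Qed.

Lemma aeDW P Q : (forall x, D x -> P x -> Q x) -> aeD P -> aeD Q.
Proof. by move=> PQ; rewrite /aeD; apply: filterS => x Px Dx; exact: PQ (Px Dx). Qed.

Lemma aeD2 P Q S : (forall x, D x -> P x -> Q x -> S x) -> aeD P -> aeD Q -> aeD S.
Proof. by move=> PQ; rewrite /aeD; apply: filterS2 => x Px Qx Dx; exact: PQ (Px Dx) (Qx Dx). Qed.

Lemma aeD3 P Q S V : (forall x, D x -> P x -> Q x -> S x -> V x) ->
  aeD P -> aeD Q -> aeD S -> aeD V.
Proof.
move=> PQ; rewrite /aeD; apply: filterS3 => x Px Qx Sx Dx; exact: PQ (Px Dx) (Qx Dx) (Sx Dx).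
Qed.

Lemma aeD_forall (P : nat -> T -> Prop) :
  (forall n, aeD (P n)) -> aeD (fun x => forall n, P n x).
Proof.
move=> h; have := (ae_foralln (fun n => h n)).
by apply: filterS => x Px Dx n; exact: Px.
Qed.

Lemma summable_meas f : summable_fun f -> measurable_fun D f.
Proof. by move=> /integrableP[/measurable_EFinP]. Qed.

Lemma summable_le f g : measurable_fun D f -> aeD (fun x => `|f x| <= g x) ->
  summable_fun g -> summable_fun f.
Proof.
move=> mf fg /integrableP[mg goo]; apply/integrableP; split.
  exact/measurable_EFinP.
apply: le_lt_trans goo; apply: ae_ge0_le_integral => //.
- by apply: measurableT_comp => //; exact/measurable_EFinP.
- exact: measurableT_comp.
- by apply: aeDW fg => x Dx h; rewrite /= lee_fin (le_trans h)// ler_norm.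
Qed.

Lemma summableD f g : summable_fun f -> summable_fun g -> summable_fun (fun x => f x + g x).
Proof. by move=> hf hg; exact: (integrableD mD hf hg). Qed.

Lemma summableZ k f : summable_fun f -> summable_fun (fun x => k * f x).
Proof. by move=> hf; exact: (integrableZl mD k hf). Qed.

Lemma summableN f : summable_fun f -> summable_fun (fun x => - f x).
Proof.
by move=> hf; rewrite (_ : (fun x => - f x) = fun x => -1 * f x);
  [exact: summableZ|apply/funext => x; rewrite mulN1r].
Qed.

Lemma summableB f g : summable_fun f -> summable_fun g -> summable_fun (fun x => f x - g x).
Proof. by move=> hf hg; apply: summableD => //; exact: summableN. Qed.

Lemma summable0 : summable_fun (cst 0).
Proof. exact: integrable0. Qed.

Lemma summable_sum I (s : seq I) (f : I -> T -> R) :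
  (forall i, summable_fun (f i)) -> summable_fun (fun x => \sum_(i <- s) f i x).
Proof.
move=> hf; elim: s => [|i s ih].
  by under eq_fun do rewrite big_nil; exact: summable0.
by under eq_fun do rewrite big_cons; exact: summableD.
Qed.

Lemma summable_norm f : summable_fun f -> summable_fun (fun x => `|f x|).
Proof. by move=> hf; exact: integrable_norm. Qed.

Lemma summable_ae_eq f g : measurable_fun D g -> aeD (fun x => g x = f x) ->
  summable_fun f -> summable_fun g.
Proof.
move=> mg gf /summable_norm; apply: summable_le => //.
by apply: aeDW gf => x _ ->.
Qed.

Local Notation I f := (Rintegral mu D f).

Lemma RintegralE f : summable_fun f -> (I f)%:E = (\int[mu]_(x in D) (f x)%:E)%E.
Proof. by move=> hf; rewrite /Rintegral fineK//; exact: integrable_fin_num. Qed.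

Lemma Rintegral_add f g : summable_fun f -> summable_fun g ->
  I (fun x => f x + g x) = I f + I g.
Proof. by move=> hf hg; rewrite RintegralD. Qed.

Lemma Rintegral_scale k f : summable_fun f -> I (fun x => k * f x) = k * I f.
Proof. by move=> hf; rewrite RintegralZl. Qed.

Lemma Rintegral_opp f : summable_fun f -> I (fun x => - f x) = - I f.
Proof.
move=> hf; rewrite -mulN1r -Rintegral_scale//.
by congr Rintegral; apply/funext => x; rewrite mulN1r.
Qed.

Lemma Rintegral_sub f g : summable_fun f -> summable_fun g ->
  I (fun x => f x - g x) = I f - I g.
Proof. by move=> hf hg; rewrite RintegralB. Qed.

Lemma Rintegral_zero : I (cst 0) = 0.
Proof. by rewrite /Rintegral integral0. Qed.

Lemma Rintegral_sum J (s : seq J) (f : J -> T -> R) :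
  (forall i, summable_fun (f i)) ->
  I (fun x => \sum_(i <- s) f i x) = \sum_(i <- s) I (f i).
Proof.
move=> hf; elim: s => [|i s ih].
  by rewrite big_nil -[RHS]Rintegral_zero; congr Rintegral; apply/funext => x; rewrite big_nil.
rewrite big_cons -ih -Rintegral_add//; last exact: summable_sum.
by congr Rintegral; apply/funext => x; rewrite big_cons.
Qed.

Lemma Rintegral_ae_eq f g : measurable_fun D f -> measurable_fun D g ->
  aeD (fun x => f x = g x) -> I f = I g.
Proof.
move=> mf mg fg; rewrite /Rintegral; congr fine; apply: ae_eq_integral => //.
- exact/measurable_EFinP.
- exact/measurable_EFinP.
- by apply: aeDW fg => x Dx h; rewrite h.
Qed.

Lemma Rintegral_ae_ge0 f : measurable_fun D f -> aeD (fun x => 0 <= f x) -> 0 <= I f.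
Proof.
move=> mf f0; rewrite (_ : I f = I (fun x => `|f x|)).
  exact: Rintegral_ge0.
apply: Rintegral_ae_eq => //; first exact: measurableT_comp.
by apply: aeDW f0 => x _ f0; rewrite ger0_norm.
Qed.

Lemma Rintegral_ae_le f g : summable_fun f -> summable_fun g ->
  aeD (fun x => f x <= g x) -> I f <= I g.
Proof.
move=> hf hg fg; rewrite -subr_ge0 -Rintegral_sub//; apply: Rintegral_ae_ge0.
  by apply: measurable_funB; exact: summable_meas.
by apply: aeDW fg => x _; rewrite subr_ge0.
Qed.

Lemma Rintegral_eq0 f : summable_fun f -> aeD (fun x => 0 <= f x) -> I f <= 0 ->
  aeD (fun x => f x = 0).
Proof.
move=> hf f0 If; have mf := summable_meas hf.
have : (\int[mu]_(x in D) `|(f x)%:E| = 0)%E.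
  have e : I (fun x => `|f x|) = 0.
    apply/eqP; rewrite eq_le Rintegral_ge0// andbT; apply: le_trans If.
    rewrite le_eqVlt; apply/orP; left; apply/eqP; apply: Rintegral_ae_eq => //.
      exact: measurableT_comp.
    by apply: aeDW f0 => x _ f0; rewrite ger0_norm.
  by rewrite -[RHS]/(0%:E) -e RintegralE//; exact: summable_norm.
move/(ae_eq_integral_abs _ mD _).1 => /=.
have mE : measurable_fun D (EFin \o f) by exact/measurable_EFinP.
by move=> /(_ mE); apply: aeDW => x Dx [].
Qed.

Lemma Rintegral_dominated (f_ : nat -> T -> R) f g :
  (forall n, measurable_fun D (f_ n)) -> measurable_fun D f ->
  aeD (fun x => f_ n x @[n --> \oo] --> f x) -> summable_fun g ->
  (forall n, aeD (fun x => `|f_ n x| <= g x)) ->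
  summable_fun f /\ (I (f_ n) @[n --> \oo] --> I f).
Proof.
move=> mf_ mf ff hg fg.
have [] := @dominated_convergence _ _ _ mu D mD (fun n => EFin \o f_ n) (EFin \o f) (EFin \o g).
- by move=> n; exact/measurable_EFinP.
- exact/measurable_EFinP.
- by apply: aeDW ff => x Dx h; apply/fine_cvgP; split; [exact: nearW|exact: h].
- exact: hg.
- have := aeD_forall fg; rewrite /aeD; apply: filterS => x h n Dx; rewrite /= lee_fin; exact: h.
move=> hf _ cf; split=> //.
by apply: fine_cvg => /=; rewrite RintegralE.
Qed.

(** Fatou's lemma for functions with values in [R]: the bound on the integrals
    also makes the limit summable, which is how the improper integrals of the
    singular terms are shown to exist. *)
Lemma Rintegral_fatou (f_ : nat -> T -> R) f C :
  (forall n, summable_fun (f_ n)) -> (forall n, aeD (fun x => 0 <= f_ n x)) ->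
  measurable_fun D f -> aeD (fun x => f_ n x @[n --> \oo] --> f x) ->
  (forall n, I (f_ n) <= C) ->
  [/\ summable_fun f, aeD (fun x => 0 <= f x) & I f <= C].
Proof.
move=> hf_ f0 mf ff fC.
have mf_ n : measurable_fun D (f_ n) by exact: summable_meas.
have f0' : aeD (fun x => 0 <= f x).
  apply: aeD2 (aeD_forall f0) ff => x Dx h0 hc.
  rewrite -(cvg_lim _ hc)//; apply: limr_ge; first by apply/cvg_ex; exists (f x).
  exact: nearW.
have le : (\int[mu]_(x in D) `|(f x)%:E| <= C%:E)%E.
  have -> : (\int[mu]_(x in D) `|(f x)%:E| =
      \int[mu]_(x in D) limn_einf (fun n => (`|f_ n x|)%:E))%E.
    apply: ae_eq_integral => //.
    - by apply: measurableT_comp => //; exact/measurable_EFinP.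
    - rewrite (_ : (fun x => _) = fun x => - limn_esup (fun n => - (`|f_ n x|)%:E))%E.
        apply: measurableT_comp => //; apply: measurable_fun_limn_esup => n.
        apply: measurableT_comp => //; apply/measurable_EFinP.
        exact: measurableT_comp.
      by apply/funext => x; rewrite -[LHS]oppeK -limn_esupN.
    apply: aeDW ff => x _ h; rewrite is_cvg_limn_einfE.
      symmetry; apply/cvg_lim => //; apply/fine_cvgP; split; first exact: nearW.
      exact: cvg_norm h.
    apply/cvg_ex; exists (`|f x|)%:E; apply/fine_cvgP; split; first exact: nearW.
    exact: cvg_norm h.
  apply: (le_trans (fatou _ _ _ _)) => //.
    by move=> n; apply/measurable_EFinP; exact: measurableT_comp.
  rewrite limn_einf_lim; apply: lime_le; first exact: is_cvg_einfs.
  apply: nearW => n; apply: (@le_trans _ _ (\int[mu]_(x in D) (`|f_ n x|)%:E)%E).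
    by apply: ereal_inf_lbound; exists n => //=.
  rewrite -RintegralE; last exact: summable_norm.
  rewrite lee_fin; apply: le_trans (fC n).
  rewrite le_eqVlt; apply/orP; left; apply/eqP; apply: Rintegral_ae_eq => //.
    exact: measurableT_comp.
  by apply: aeDW (f0 n) => x _ h; rewrite ger0_norm.
have hf : summable_fun f.
  apply/integrableP; split; first exact/measurable_EFinP.
  exact: le_lt_trans le (ltry _).
split => //; rewrite -lee_fin; apply: le_trans le.
rewrite (RintegralE hf); apply: le_integral => //.
- by apply: (integrable_abse hf).
- by move=> x _; rewrite /= lee_fin ler_norm.
Qed.

(** The sum of the series of the [h n] has a finite integral, hence is finite
    almost everywhere, and the terms of a convergent series tend to zero. *)
Lemma ae_cvg0_of_summable_series (h : nat -> T -> R) :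
  (forall n, summable_fun (h n)) -> (forall n x, D x -> 0 <= h n x) ->
  (forall n, I (h n) <= 2^-1 ^+ n) ->
  aeD (fun x => h n x @[n --> \oo] --> 0).
Proof.
move=> hh h0 Ih.
have mh n : measurable_fun D (EFin \o h n) by exact/measurable_EFinP/summable_meas.
pose s x := (\sum_(n <oo) (h n x)%:E)%E.
have hs : mu.-integrable D s.
  apply/integrableP; split.
    apply: (@ge0_emeasurable_sum _ _ _ D (fun n x => (h n x)%:E) xpredT).
      by move=> k x Dx _; rewrite lee_fin h0.
    by move=> k _; exact: mh.
  rewrite (eq_integral s); last first.
    move=> x /set_mem Dx; rewrite gee0_abs//; apply: nneseries_ge0 => n _ _.
    by rewrite lee_fin h0.
  rewrite /s integral_nneseries//.
  apply: (@le_lt_trans _ _ (\sum_(n <oo) ((2^-1 : R) ^+ n)%:E)%E).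
    apply: lee_nneseries => n.
      by move=> _ _; apply: integral_ge0 => x Dx; rewrite lee_fin h0.
    move=> _.
    by rewrite -RintegralE// lee_fin.
  rewrite (_ : (\sum_(n <oo) _)%E = (limn (series (geometric 1 (2^-1 : R))))%:E).
    exact: ltry.
  rewrite -EFin_lim; last by apply: is_cvg_geometric_series; rewrite ger0_norm ?invr_ge0// invf_lt1// ltr1n.
  congr (limn _); apply/funext => n; rewrite /series/= sumEFin; congr EFin.
  by apply: eq_bigr => i _; rewrite /geometric/= mul1r.
apply: aeDW (integrable_ae mD hs) => x Dx h_.
have : cvgn (series (fun n => h n x)).
  have : (s x < +oo)%E.
    rewrite -ge0_fin_numE//; apply: nneseries_ge0 => n _ _; by rewrite lee_fin h0.
  move=> sx.
  apply: nnseries_is_cvg => //.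
  by move=> n; exact: h0.
exact: cvg_series_cvg_0.
Qed.

End real_integral.

(** * Square-integrable functions *)

Section sequences_and_quadratics.
Context (R : realType).

Lemma sqr_normr (x : R) : `|x| ^+ 2 = x ^+ 2.
Proof. by rewrite real_normK// num_real. Qed.

Lemma norm_le_of_sqr (x e : R) : 0 < e -> x ^+ 2 <= e ^+ 2 -> `|x| <= e.
Proof.
move=> e0; rewrite -sqr_normr; have := normr_ge0 x => x0 h.
by rewrite leNgt; apply/negP => ex; nra.
Qed.

Lemma cvg0_epsP (a : nat -> R) : (forall n, 0 <= a n) ->
  (a n @[n --> \oo] --> 0) <->
  (forall e, 0 < e -> exists N, forall n, (N <= n)%N -> a n <= e).
Proof.
move=> a0; split.
  move=> /cvgrPdist_le h e e0; have [N _ HN] := h e e0; exists N => n Nn.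
  by have := HN n Nn; rewrite sub0r normrN ger0_norm.
move=> h; apply/cvgrPdist_le => e e0; have [N HN] := h e e0.
by exists N => // n Nn; rewrite /= sub0r normrN ger0_norm//; exact: HN.
Qed.

Lemma invS_le_eps (e : R) : 0 < e -> exists N, forall n, (N <= n)%N -> n.+1%:R^-1 <= e.
Proof.
move=> e0; apply: (cvg0_epsP (a := fun n => n.+1%:R^-1) _).1 => //.
exact: cvg_harmonic.
Qed.

Lemma cvg0_squeeze (a b : nat -> R) : (forall n, 0 <= a n <= b n) ->
  b n @[n --> \oo] --> 0 -> a n @[n --> \oo] --> 0.
Proof.
move=> ab b0; apply: (@squeeze_cvgr _ _ _ _ (cst 0) b) => //.
  by apply: nearW => n; rewrite /cst.
exact: cvg_cst.
Qed.

(** A nonnegative quadratic polynomial has a nonpositive discriminant; this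
    gives the Cauchy-Schwarz inequality of every form used below, and the
    Euler-Lagrange equation of the eigenfunction. *)
Lemma quadratic_ge0_le (a b c : R) : 0 <= c ->
  (forall t, 0 <= a + 2 * t * b + t ^+ 2 * c) -> b ^+ 2 <= a * c.
Proof.
move=> c0 h; have a0 : 0 <= a by have := h 0; rewrite expr0n/= mulr0 !mul0r !addr0.
have [c0'|c0'] := eqVneq c 0.
  rewrite c0' mulr0; have [->|b0] := eqVneq b 0; first by rewrite expr0n.
  have := h (- (a + 1) / (2 * b)); rewrite c0' mulr0 addr0.
  have -> : a + 2 * (- (a + 1) / (2 * b)) * b = -1 by field.
  by rewrite ler0N1.
have {}c0 : 0 < c by rewrite lt_def c0' c0.
have := h (- b / c).
have -> : a + 2 * (- b / c) * b + (- b / c) ^+ 2 * c = (a * c - b ^+ 2) / c by field.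
by rewrite pmulr_lge0 ?invr_gt0// subr_ge0.
Qed.

(** The difference of the two sides is half of [\sum_i \sum_j (a i - a j) ^+ 2]. *)
Lemma sqr_sum_le n (a : 'I_n -> R) :
  (\sum_(i < n) a i) ^+ 2 <= n%:R * \sum_(i < n) a i ^+ 2.
Proof.
have h : 0 <= \sum_(i < n) \sum_(j < n) (a i - a j) ^+ 2.
  by apply: sumr_ge0 => i _; apply: sumr_ge0 => j _; exact: sqr_ge0.
have e : \sum_(i < n) \sum_(j < n) (a i - a j) ^+ 2 =
    2 * (n%:R * \sum_(i < n) a i ^+ 2 - (\sum_(i < n) a i) ^+ 2).
  set S := \sum_(i < n) a i; set S2 := \sum_(i < n) a i ^+ 2.
  have inner i : \sum_(j < n) (a i - a j) ^+ 2 = n%:R * a i ^+ 2 - 2 * a i * S + S2.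
    rewrite (eq_bigr (fun j => a i ^+ 2 + (- (2 * a i)) * a j + a j ^+ 2)); last by move=> j _; ring.
    rewrite 2!big_split/= sumr_const card_ord -(mulr_sumr _ _ _ (- (2 * a i))) -/S -/S2.
    by rewrite -(mulr_natl (a i ^+ 2)); ring.
  rewrite (eq_bigr _ (fun i _ => inner i)) big_split/= sumr_const card_ord.
  rewrite (eq_bigr (fun i => n%:R * a i ^+ 2 + (- (2 * S)) * a i)); last by move=> i _; ring.
  rewrite big_split/= -!mulr_sumr -/S -/S2. rewrite -(mulr_natl S2); ring.
move: h; rewrite e; nra.
Qed.

End sequences_and_quadratics.

Section L2.
Context d (T : measurableType d) (R : realType).
Variables (mu : {measure set T -> \bar R}) (D : set T).
Hypothesis mD : measurable D.
Implicit Types (f g h : T -> R).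

Local Notation I f := (Rintegral mu D f).
Local Notation summ f := (summable_fun mu D f).

Definition L2 f : Prop := measurable_fun D f /\ summ (fun x => f x ^+ 2).
Definition ip f g : R := I (fun x => f x * g x).
Definition n2 f : R := I (fun x => f x ^+ 2).
Definition cvg2 (f_ : nat -> T -> R) f : Prop :=
  n2 (fun x => f_ n x - f x) @[n --> \oo] --> 0.

Lemma L2_meas f : L2 f -> measurable_fun D f. Proof. by case. Qed.

Lemma L2_le f g : measurable_fun D f -> aeD mu D (fun x => `|f x| <= `|g x|) ->
  L2 g -> L2 f.
Proof.
move=> mf fg [mg sg]; split=> //; apply: (summable_le mD _ _ sg).
  exact: measurable_funX.
by apply: aeDW fg => x _ h; rewrite normrX -(sqr_normr (g x)) lerXn2r// nnegrE.
Qed.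

Lemma L2_mul f g : L2 f -> L2 g -> summ (fun x => f x * g x).
Proof.
move=> [mf sf] [mg sg].
apply: (summable_le mD _ _ (summableD mD sf sg)); first exact: measurable_funM.
apply: aeD_all => x _; rewrite normrM -(sqr_normr (f x)) -(sqr_normr (g x)).
have := normr_ge0 (f x); have := normr_ge0 (g x); nra.
Qed.

Lemma L2_add f g : L2 f -> L2 g -> L2 (fun x => f x + g x).
Proof.
move=> hf hg; split; first by apply: measurable_funD; exact: L2_meas.
rewrite (_ : (fun x => _) = fun x => f x ^+ 2 + 2 * (f x * g x) + g x ^+ 2); last first.
  by apply/funext => x; ring.
apply: summableD => //; last exact: hg.2.
apply: summableD => //; first exact: hf.2.
by apply: summableZ => //; exact: L2_mul.
Qed.

Lemma L2_scale k f : L2 f -> L2 (fun x => k * f x).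
Proof.
move=> [mf sf]; split; first exact: measurable_funM.
rewrite (_ : (fun x => _) = fun x => k ^+ 2 * f x ^+ 2); first exact: summableZ.
by apply/funext => x; rewrite exprMn.
Qed.

Lemma L2_opp f : L2 f -> L2 (fun x => - f x).
Proof.
move=> hf; rewrite (_ : (fun x => - f x) = fun x => -1 * f x); first exact: L2_scale.
by apply/funext => x; rewrite mulN1r.
Qed.

Lemma L2_sub f g : L2 f -> L2 g -> L2 (fun x => f x - g x).
Proof. by move=> hf hg; apply: L2_add => //; exact: L2_opp. Qed.

Lemma L2_zero : L2 (cst 0).
Proof.
split; first exact: measurable_cst.
by rewrite (_ : (fun x => _) = cst 0); [exact: summable0|apply/funext => x; rewrite expr0n].
Qed.

Lemma L2_sum J (s : seq J) (f : J -> T -> R) :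
  (forall i, L2 (f i)) -> L2 (fun x => \sum_(i <- s) f i x).
Proof.
move=> hf; elim: s => [|i s ih].
  by under eq_fun do rewrite big_nil; exact: L2_zero.
by under eq_fun do rewrite big_cons; exact: L2_add.
Qed.

Lemma ipC f g : ip f g = ip g f.
Proof. by congr Rintegral; apply/funext => x; rewrite mulrC. Qed.

Lemma n2E f : n2 f = ip f f.
Proof. by congr Rintegral; apply/funext => x; rewrite expr2. Qed.

Lemma ipDl f g h : L2 f -> L2 g -> L2 h -> ip (fun x => f x + g x) h = ip f h + ip g h.
Proof.
move=> hf hg hh; rewrite /ip -Rintegral_add//; try exact: L2_mul.
by congr Rintegral; apply/funext => x; rewrite mulrDl.
Qed.

Lemma ipZl k f g : L2 f -> L2 g -> ip (fun x => k * f x) g = k * ip f g.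
Proof.
move=> hf hg; rewrite /ip -Rintegral_scale//; try exact: L2_mul.
by congr Rintegral; apply/funext => x; rewrite mulrA.
Qed.

Lemma ipNl f g : L2 f -> L2 g -> ip (fun x => - f x) g = - ip f g.
Proof.
move=> hf hg; rewrite -mulN1r -ipZl//.
by congr ip; apply/funext => x; rewrite mulN1r.
Qed.

Lemma ipBl f g h : L2 f -> L2 g -> L2 h -> ip (fun x => f x - g x) h = ip f h - ip g h.
Proof. by move=> hf hg hh; rewrite ipDl ?ipNl//; exact: L2_opp. Qed.

Lemma ipDr f g h : L2 f -> L2 g -> L2 h -> ip h (fun x => f x + g x) = ip h f + ip h g.
Proof. by move=> hf hg hh; rewrite ipC ipDl// ![ip h _]ipC. Qed.

Lemma ipZr k f g : L2 f -> L2 g -> ip g (fun x => k * f x) = k * ip g f.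
Proof. by move=> hf hg; rewrite ipC ipZl// ipC. Qed.

Lemma ipBr f g h : L2 f -> L2 g -> L2 h -> ip h (fun x => f x - g x) = ip h f - ip h g.
Proof. by move=> hf hg hh; rewrite ipC ipBl// ![ip h _]ipC. Qed.

Lemma n2_ge0 f : 0 <= n2 f.
Proof. by apply: Rintegral_ge0 => x _; exact: sqr_ge0. Qed.

Lemma n2D f g : L2 f -> L2 g -> n2 (fun x => f x + g x) = n2 f + 2 * ip f g + n2 g.
Proof.
move=> hf hg; rewrite !n2E ipDl ?ipDr//; last by apply: L2_add.
by rewrite (ipC g f); ring.
Qed.

Lemma n2Z k f : L2 f -> n2 (fun x => k * f x) = k ^+ 2 * n2 f.
Proof.
move=> hf; rewrite !n2E ipZl ?ipZr//; last exact: L2_scale.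
by ring.
Qed.

Lemma n2B f g : L2 f -> L2 g -> n2 (fun x => f x - g x) = n2 f - 2 * ip f g + n2 g.
Proof.
move=> hf hg; have := n2D hf (L2_scale (-1) hg).
rewrite n2Z// ipZr// => e; rewrite -[RHS]/(_ - 2 * _ + _).
rewrite (_ : (fun x => f x - g x) = fun x => f x + -1 * g x) ?e; first by ring.
by apply/funext => x; rewrite mulN1r.
Qed.

Lemma n2_sym f g : n2 (fun x => f x - g x) = n2 (fun x => g x - f x).
Proof. by congr Rintegral; apply/funext => x; ring. Qed.

Lemma cauchy_schwarz f g : L2 f -> L2 g -> ip f g ^+ 2 <= n2 f * n2 g.
Proof.
move=> hf hg; apply: quadratic_ge0_le; first exact: n2_ge0.
move=> t; have := n2_ge0 (fun x => f x + t * g x).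
by rewrite n2D ?n2Z ?ipZr//; [rewrite mulrA|exact: L2_scale].
Qed.

Lemma n2D_le f g : L2 f -> L2 g -> n2 (fun x => f x + g x) <= 2 * n2 f + 2 * n2 g.
Proof.
move=> hf hg; have := n2_ge0 (fun x => f x - g x).
rewrite n2B// n2D//; lra.
Qed.

Lemma n2B_le f g h : L2 f -> L2 g -> L2 h ->
  n2 (fun x => f x - g x) <= 2 * n2 (fun x => f x - h x) + 2 * n2 (fun x => h x - g x).
Proof.
move=> hf hg hh; have := n2D_le (L2_sub hf hh) (L2_sub hh hg).
by rewrite (_ : (fun x => _) = fun x => f x - g x)//; apply/funext => x; ring.
Qed.

Lemma n2_ae_eq f g : measurable_fun D f -> measurable_fun D g ->
  aeD mu D (fun x => f x = g x) -> n2 f = n2 g.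
Proof.
move=> mf mg fg; apply: Rintegral_ae_eq => //; try exact: measurable_funX.
by apply: aeDW fg => x _ ->.
Qed.

Lemma n2_le f g : measurable_fun D f -> L2 g -> aeD mu D (fun x => `|f x| <= `|g x|) ->
  n2 f <= n2 g.
Proof.
move=> mf hg fg; apply: Rintegral_ae_le => //.
- exact: (L2_le mf fg hg).2.
- exact: hg.2.
- by apply: aeDW fg => x _ h; rewrite -sqr_normr -(sqr_normr (g x)) lerXn2r// nnegrE.
Qed.

Lemma n2_eq0 f : L2 f -> n2 f <= 0 -> aeD mu D (fun x => f x = 0).
Proof.
move=> [mf sf] f0.
have : aeD mu D (fun x => f x ^+ 2 = 0).
  by apply: Rintegral_eq0 => //; apply: aeD_all => x _; exact: sqr_ge0.
by apply: aeDW => x _ /eqP; rewrite sqrf_eq0 => /eqP.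
Qed.

Lemma n2_sum_le n (f : 'I_n -> T -> R) : (forall i, L2 (f i)) ->
  n2 (fun x => \sum_(i < n) f i x) <= n%:R * \sum_(i < n) n2 (f i).
Proof.
move=> hf; rewrite /n2 -Rintegral_sum//; last by move=> i; exact: (hf i).2.
rewrite -Rintegral_scale//; last by apply: summable_sum => // i; exact: (hf i).2.
apply: Rintegral_ae_le => //.
- exact: (L2_sum (index_enum 'I_n) hf).2.
- by apply: summableZ => //; apply: summable_sum => // i; exact: (hf i).2.
- by apply: aeD_all => x _; exact: sqr_sum_le.
Qed.

Lemma cvg2_epsP (f_ : nat -> T -> R) f : cvg2 f_ f <->
  forall e, 0 < e -> exists N, forall n, (N <= n)%N -> n2 (fun x => f_ n x - f x) <= e.
Proof. by apply: cvg0_epsP => n; exact: n2_ge0. Qed.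

Lemma cvg2_cst f : cvg2 (fun=> f) f.
Proof.
rewrite /cvg2 (_ : (fun n => _) = fun=> 0); first exact: cvg_cst.
apply/funext => n; rewrite /n2 (_ : (fun x => _) = cst 0) ?Rintegral_zero//.
by apply/funext => x; rewrite subrr expr0n.
Qed.

Lemma cvg2D (f_ g_ : nat -> T -> R) f g : (forall n, L2 (f_ n)) -> L2 f ->
  (forall n, L2 (g_ n)) -> L2 g -> cvg2 f_ f -> cvg2 g_ g ->
  cvg2 (fun n x => f_ n x + g_ n x) (fun x => f x + g x).
Proof.
move=> hf_ hf hg_ hg ff gg.
apply: (@cvg0_squeeze _ _ (fun n => 2 * n2 (fun x => f_ n x - f x) + 2 * n2 (fun x => g_ n x - g x))).
  move=> n; rewrite n2_ge0/=.
  have := n2D_le (L2_sub (hf_ n) hf) (L2_sub (hg_ n) hg).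
  by rewrite (_ : (fun x => _) = fun x => f_ n x + g_ n x - (f x + g x))//;
    apply/funext => x; ring.
rewrite -[0 in X in _ --> X](_ : 2 * 0 + 2 * 0 = 0 :> R); last by rewrite mulr0 addr0.
by apply: cvgD; apply: cvgM => //; exact: cvg_cst.
Qed.

Lemma cvg2Z k (f_ : nat -> T -> R) f : (forall n, L2 (f_ n)) -> L2 f ->
  cvg2 f_ f -> cvg2 (fun n x => k * f_ n x) (fun x => k * f x).
Proof.
move=> hf_ hf ff; rewrite /cvg2.
rewrite (_ : (fun n => _) = fun n => k ^+ 2 * n2 (fun x => f_ n x - f x)); last first.
  apply/funext => n; rewrite -n2Z; last exact: L2_sub.
  by congr n2; apply/funext => x; ring.
by rewrite -[0 in X in _ --> X](mulr0 (k ^+ 2)); apply: cvgM => //; exact: cvg_cst.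
Qed.

Lemma cvg2_sub (s : nat -> nat) (f_ : nat -> T -> R) f : (forall k, (k <= s k)%N) ->
  cvg2 f_ f -> cvg2 (fun k => f_ (s k)) f.
Proof.
move=> ks /cvg2_epsP ff; apply/cvg2_epsP => e e0; have [N HN] := ff e e0.
by exists N => n Nn; apply: HN; rewrite (leq_trans Nn).
Qed.

Lemma cvg2_ip (f_ g_ : nat -> T -> R) f g : (forall n, L2 (f_ n)) -> L2 f ->
  (forall n, L2 (g_ n)) -> L2 g -> cvg2 f_ f -> cvg2 g_ g ->
  ip (f_ n) (g_ n) @[n --> \oo] --> ip f g.
Proof.
move=> hf_ hf hg_ hg ff gg.
pose u n := n2 (fun x => f_ n x - f x); pose v n := n2 (fun x => g_ n x - g x).
have cs0 (a : nat -> R) (b : nat -> R) (c : nat -> R) : (forall n, a n ^+ 2 <= b n * c n) ->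
    (b n * c n @[n --> \oo] --> 0) -> (a n @[n --> \oo] --> 0).
  move=> abc bc.
  have a2 : a n ^+ 2 @[n --> \oo] --> 0.
    by apply: (@cvg0_squeeze _ _ _ _ bc) => n; rewrite sqr_ge0 abc.
  have := (cvg0_epsP (fun n => sqr_ge0 (a n))).1 a2 => h.
  apply/cvgrPdist_le => e e0; have [N HN] := h _ (exprn_gt0 2 e0).
  exists N => // n Nn; rewrite /= sub0r normrN.
  by apply: norm_le_of_sqr => //; exact: HN.
have z (a : nat -> R) k : (a n @[n --> \oo] --> 0) -> (a n * k @[n --> \oo] --> 0).
  by move=> h; rewrite -(mul0r k); apply: cvgM => //; exact: cvg_cst.
have e n : ip (f_ n) (g_ n) = ip f g + (ip (fun x => f_ n x - f x) (fun x => g_ n x - g x) +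
    ip (fun x => f_ n x - f x) g + ip (fun x => g_ n x - g x) f).
  rewrite ipBr//; last exact: L2_sub.
  by rewrite ![ip (fun x => _ - _) _]ipBl// (ipC (g_ n) f) (ipC g f); ring.
rewrite (funext e).
suff : ip f g + (ip (fun x => f_ n x - f x) (fun x => g_ n x - g x) +
    ip (fun x => f_ n x - f x) g + ip (fun x => g_ n x - g x) f) @[n --> \oo]
    --> ip f g + (0 + 0 + 0) by rewrite !addr0.
apply: (@cvgD _ _ _ _ _ (fun=> ip f g)); first exact: cvg_cst.
apply: cvgD; [apply: cvgD|].
- apply: (cs0 _ u v) => [n|]; first by apply: cauchy_schwarz; exact: L2_sub.
  by rewrite -(mulr0 0); apply: cvgM.
- apply: (cs0 _ u (fun=> n2 g)) => [n|]; last exact: z.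
  by apply: cauchy_schwarz => //; exact: L2_sub.
- apply: (cs0 _ v (fun=> n2 f)) => [n|]; last exact: z.
  by apply: cauchy_schwarz => //; exact: L2_sub.
Qed.

Lemma cvg2_n2 (f_ : nat -> T -> R) f : (forall n, L2 (f_ n)) -> L2 f ->
  cvg2 f_ f -> n2 (f_ n) @[n --> \oo] --> n2 f.
Proof. by move=> hf_ hf ff; under eq_fun do rewrite n2E; rewrite n2E; exact: cvg2_ip. Qed.

(** Along a subsequence with squared errors at most [2 ^- k], these errors form a
    summable series. *)
Lemma cvg2_ae_subseq (f_ : nat -> T -> R) f : (forall n, L2 (f_ n)) -> L2 f ->
  cvg2 f_ f -> exists s : nat -> nat, (forall k, (k <= s k)%N) /\
    aeD mu D (fun x => f_ (s k) x @[k --> \oo] --> f x).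
Proof.
move=> hf_ hf /cvg2_epsP ff.
have h2 k : exists n, (k <= n)%N /\ n2 (fun x => f_ n x - f x) <= 2^-1 ^+ k.
  have [|N HN] := ff (2^-1 ^+ k); first by rewrite exprn_gt0.
  by exists (maxn k N); rewrite leq_maxl HN// leq_maxr.
have [s Hs] := choice h2; exists s; split=> [k|]; first exact: (Hs k).1.
have := @ae_cvg0_of_summable_series _ _ _ mu D mD (fun k x => (f_ (s k) x - f x) ^+ 2).
have A k : summ (fun x => (f_ (s k) x - f x) ^+ 2) by have [] := L2_sub (hf_ (s k)) hf.
move=> /(_ A (fun n x _ => sqr_ge0 _) (fun k => (Hs k).2)).
apply: aeDW => x _ /(cvg0_epsP (fun n => sqr_ge0 (f_ (s n) x - f x))) h.
apply/cvgrPdist_le => e e0; have [N HN] := h _ (exprn_gt0 2 e0).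
exists N => // n Nn; rewrite /= distrC.
by apply: norm_le_of_sqr => //; exact: HN.
Qed.

End L2.

Section L2_complete.
Context d (T : measurableType d) (R : realType).
Variables (mu : {measure set T -> \bar R}) (D : set T).
Hypothesis mD : measurable D.

(** The hypothesis makes the steps [O(2 ^- n)]. *)
Lemma cvg_of_geometric_steps (a : nat -> R) :
  (4 ^+ n * (a n.+1 - a n) ^+ 2 @[n --> \oo] --> 0) ->
  exists l : R, a n @[n --> \oo] --> l.
Proof.
move=> h0.
have [M [_ HM]] : bounded_fun (fun n => 4 ^+ n * (a n.+1 - a n) ^+ 2).
  by apply: cvg_seq_bounded; exact: (cvgP 0 h0).
have {}HM n : `|a n.+1 - a n| <= geometric (`|M| + 2) 2^-1 n.
  have := HM (`|M| + 1) (le_lt_trans (ler_norm M) _) n Logic.I.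
  rewrite ltrDl ltr01 => /(_ isT) /=.
  rewrite ger0_norm; last by rewrite mulr_ge0 ?sqr_ge0// exprn_ge0.
  set x := `|a n.+1 - a n|; rewrite -sqr_normr -/x => hx.
  have x0 : 0 <= x by exact: normr_ge0.
  have e : (4 : R) ^+ n = (2 ^+ n) ^+ 2 by rewrite -exprM mulnC exprM; congr (_ ^+ n); rewrite -natrX.
  have p : 0 < (2 : R) ^+ n by rewrite exprn_gt0.
  rewrite exprVn ler_pdivlMr//.
  move: hx; rewrite e -exprMn [x * _]mulrC; set y := _ * x.
  have : 0 <= y by rewrite mulr_ge0// ltW.
  by have := normr_ge0 M; nra.
have : cvgn (series (fun n => a n.+1 - a n)).
  apply: normed_cvg.
  apply: (@series_le_cvg _ (fun n => `|a n.+1 - a n|) _ _ _ HM).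
  - by move=> n; exact: normr_ge0.
  - by move=> n; rewrite /geometric/= mulr_ge0 ?addr_ge0// exprn_ge0// invr_ge0.
  - by apply: is_cvg_geometric_series; rewrite ger0_norm ?invr_ge0// invf_lt1// ltr1n.
move=> /cvg_ex[l hl]; exists (l + a 0%N).
have e : (fun n => series (fun n => a n.+1 - a n) n + a 0%N) = a.
  apply/funext => n; have := congr1 (fun u => u n) (telescopeK a) => /= ->.
  by rewrite subrK.
suff : (fun n => series (fun n => a n.+1 - a n) n + a 0%N) @ \oo --> l + a 0%N.
  by rewrite e.
by apply: cvgD => //; exact: cvg_cst.
Qed.

(** The upper limit is measurable everywhere and equals the limit where there is
    one. *)
Lemma measurable_ae_limit (g : nat -> T -> R) : (forall k, measurable_fun D (g k)) ->
  aeD mu D (fun x => exists l : R, g k x @[k --> \oo] --> l) ->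
  exists f : T -> R, measurable_fun D f /\ aeD mu D (fun x => g k x @[k --> \oo] --> f x).
Proof.
move=> mg gl; exists (fun x => fine (limn_esup (fun k => (g k x)%:E))); split.
  apply: measurableT_comp => //; apply: measurable_fun_limn_esup => k.
  exact/measurable_EFinP.
apply: aeDW gl => x _ [l hl].
have : (fun k => (g k x)%:E) @ \oo --> l%:E.
  by apply/fine_cvgP; split; [exact: nearW|exact: hl].
by move/cvg_limn_einf_sup => [_ ->].
Qed.

(** Riesz-Fischer: a subsequence with squared steps at most [8 ^- k] converges almost
    everywhere, and Fatou identifies its limit as the limit in the mean. *)
Lemma L2_complete (f_ : nat -> T -> R) : (forall n, L2 mu D (f_ n)) ->
  (forall e, 0 < e -> exists N, forall m n, (N <= m)%N -> (N <= n)%N ->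
     n2 mu D (fun x => f_ m x - f_ n x) <= e) ->
  exists f, L2 mu D f /\ cvg2 mu D f_ f.
Proof.
move=> hf_ cau.
have e8 : 0 < 8^-1 :> R by rewrite invr_gt0.
have [N HN] := choice (fun k => cau (8^-1 ^+ k) (exprn_gt0 k e8)).
pose s k := (\sum_(j < k.+1) (N j).+1)%N.
have sN k : (N k <= s k)%N.
  by rewrite /s big_ord_recr/= (leq_trans (leqnSn _))// leq_addl.
have sS k : (s k < s k.+1)%N by rewrite /s [ltnRHS]big_ord_recr/= addnS ltnS leq_addr.
have ks k : (k <= s k)%N by elim: k => // k ih; exact: leq_ltn_trans ih (sS k).
pose g k := f_ (s k).
have [f [mf gf]] : exists f : T -> R, measurable_fun D f /\
    aeD mu D (fun x => g k x @[k --> \oo] --> f x).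
  apply: measurable_ae_limit; first by move=> k; exact: (L2_meas (hf_ _)).
  have hs k : L2 mu D (fun x => g k.+1 x - g k x).
    exact: (L2_sub mD (hf_ _) (hf_ _)).
  have := @ae_cvg0_of_summable_series _ _ _ mu D mD
    (fun k x => 4 ^+ k * (g k.+1 x - g k x) ^+ 2).
  have A k : summable_fun mu D (fun x => 4 ^+ k * (g k.+1 x - g k x) ^+ 2).
    by apply: summableZ => //; exact: (hs k).2.
  move=> /(_ A); have B n x : D x -> 0 <= 4 ^+ n * (g n.+1 x - g n x) ^+ 2.
    by move=> _; rewrite mulr_ge0 ?sqr_ge0 ?exprn_ge0.
  move=> /(_ B); have C n : Rintegral mu D (fun x => 4 ^+ n * (g n.+1 x - g n x) ^+ 2) <= 2^-1 ^+ n.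
    rewrite Rintegral_scale//; last exact: (hs n).2.
    rewrite (_ : 2^-1 ^+ n = 4 ^+ n * 8^-1 ^+ n); last by rewrite -exprMn; congr (_ ^+ n); field.
    rewrite ler_pM2l ?exprn_gt0//; apply: HN => //.
    exact: leq_trans (sN n) (ltnW (sS n)).
  move=> /(_ C); apply: aeDW => x _; exact: cvg_of_geometric_steps.
have key e : 0 < e -> exists M, forall n, (M <= n)%N ->
    L2 mu D (fun x => f x - f_ n x) /\ n2 mu D (fun x => f x - f_ n x) <= e.
  move=> e0; have [M HM] := cau e e0; exists M => n Mn.
  have mfn : measurable_fun D (fun x => f x - f_ n x).
    by apply: measurable_funB => //; exact: L2_meas (hf_ n).
  have [] := @Rintegral_fatou _ _ _ mu D mD
    (fun j x => (g (M + j)%N x - f_ n x) ^+ 2) (fun x => (f x - f_ n x) ^+ 2) e.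
  - by move=> j; exact: (L2_sub mD (hf_ _) (hf_ n)).2.
  - by move=> j; apply: aeD_all => x _; exact: sqr_ge0.
  - exact: measurable_funX.
  - apply: aeDW gf => x _ h.
    have h' : g (M + j)%N x @[j --> \oo] --> f x.
      by move: h; rewrite -(cvg_shiftn M); under eq_fun do rewrite addnC.
    rewrite expr2; under eq_fun do rewrite expr2.
    by apply: cvgM; apply: cvgB => //; exact: cvg_cst.
  - by move=> j; apply: HM => //; rewrite (leq_trans _ (ks _))// leq_addr.
  by move=> sf _ le; split => //; split.
have [M0 HM0] := key 1 ltr01; have hf : L2 mu D f.
  have := L2_add mD (HM0 M0 (leqnn _)).1 (hf_ M0).
  by rewrite (_ : (fun x => _) = f)//; apply/funext => x; rewrite subrK.
exists f; split => //; apply/cvg2_epsP => e e0; have [M HM] := key e e0.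
by exists M => n Mn; rewrite n2_sym; exact: (HM n Mn).2.
Qed.

End L2_complete.

(** * Lebesgue measure on row vectors *)

Section rV_borel.
Context (R : realType) (n : nat).
Implicit Types (x y z : 'rV[R]_n) (U : set 'rV[R]_n).

Lemma coord_ball x y e : 0 < e ->
  ball x e y <-> forall i, `|x ord0 i - y ord0 i| < e.
Proof.
move=> e0; split; first by move=> [_ h] i; exact: h.
by move=> h; split=> // i j; rewrite !ord1; exact: h.
Qed.

Lemma measurable_forall_coord (P : 'I_n -> set R) : (forall i, measurable (P i)) ->
  measurable [set x : 'rV[R]_n | forall i, P i (x ord0 i)].
Proof.
move=> mP; rewrite (_ : mkset _ =
    \bigcap_(i in [set` finset.setT]) (fun x : 'rV[R]_n => x ord0 i) @^-1` P i).
  apply: fin_bigcap_measurable => // i _.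
  by rewrite -[X in measurable X]setTI; exact: (measurable_coord i measurableT (mP i)).
apply/seteqP; split => [x h i _|x h i]; first exact: h.
by apply: h; rewrite /= inE.
Qed.

(** An open set is the countable union of the rational cubes it contains. *)
Lemma rV_open_measurable U : open U -> measurable U.
Proof.
move=> oU.
pose B (p : 'rV[rat]_n * nat) : set 'rV[R]_n :=
  [set y | forall i, `|ratr (p.1 ord0 i) - y ord0 i| < p.2.+1%:R^-1].
pose F p := if `[< B p `<=` U >] then B p else set0.
have -> : U = \bigcup_p F p.
  apply/seteqP; split => [x Ux|x [p _]]; last first.
    by rewrite /F; case: asboolP => // h /h.
  have /nbhs_ballP[e /= e0 eU] : nbhs x U by exact: open_nbhs_nbhs.
  have [k hk] : exists k : nat, k.+1%:R^-1 <= e / 2.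
    have [|k hk] := @invS_le_eps R (e / 2); first by rewrite divr_gt0.
    by exists k; exact: hk.
  have hq i : exists q : rat, `|ratr q - x ord0 i| < k.+1%:R^-1.
    have k0 : 0 < k.+1%:R^-1 :> R by rewrite invr_gt0.
    have [|q] := @rat_in_itvoo R (x ord0 i - k.+1%:R^-1) (x ord0 i + k.+1%:R^-1).
      by rewrite ltrD2l (lt_trans _ k0)// oppr_lt0.
    by rewrite in_itv/= => /andP[q1 q2]; exists q; rewrite ltr_norml; rewrite ltrBrDr [X in X < _]addrC q1/= ltrBlDr addrC.
  have [q Hq] := choice hq.
  exists (\row_i q i, k) => //; rewrite /F; case: asboolP => [_ i|[]].
    by rewrite mxE; exact: Hq.
  move=> y hy; apply: eU; apply/coord_ball => // i.
  rewrite (splitr e) (le_lt_trans (ler_distD (ratr (q i)) _ _))// ltrD//.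
    by rewrite distrC (lt_le_trans (Hq i)).
  by have := hy i; rewrite mxE => /lt_le_trans; apply.
apply: countable_bigcupT_measurable => [|p]; first exact: countableP.
rewrite /F; case: asboolP => // _; apply: measurable_forall_coord (fun i r => `|ratr (p.1 ord0 i) - r| < _) _ => i.
apply: open_measurable; set c : R := ratr _.
rewrite (_ : (fun r => _) = ball c p.2.+1%:R^-1); first exact: ball_open.
by rewrite -ball_normE.
Qed.

Lemma rV_continuous_measurable (f : 'rV[R]_n -> R) (D : set 'rV[R]_n) :
  continuous f -> measurable_fun D f.
Proof.
move=> cf; apply: measurable_funTS.
apply: (measurability _ (RGenOpens.measurableE R)).
move=> _ [_ [a [b ->] <-]]; rewrite setTI.
by apply: rV_open_measurable; apply: open_comp => // x _; exact: cf.
Qed.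

Lemma measurable_rV_translation z : measurable_fun [set: 'rV[R]_n] (fun x => x + z).
Proof.
apply: measurable_fun_rV => i; under eq_fun do rewrite mxE.
by apply: measurable_funD; [exact: measurable_coord|exact: measurable_cst].
Qed.

Lemma measurable_rV_add :
  measurable_fun [set: 'rV[R]_n * 'rV[R]_n] (fun p => p.1 + p.2).
Proof.
apply: measurable_fun_rV => i; under eq_fun do rewrite mxE.
apply: measurable_funD.
  exact: (measurableT_comp (measurable_coord i) measurable_fst).
exact: (measurableT_comp (measurable_coord i) measurable_snd).
Qed.

End rV_borel.

Section lebesgue_translation.
Context (R : realType).
Local Open Scope ereal_scope.

Lemma lebesgue_measure_translation (t : R) (A : set (measurableTypeR R)) : measurable A ->
  lebesgue_measure ((fun x : measurableTypeR R => (x + t)%R) @^-1` A) = lebesgue_measure A.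
Proof.
move=> mA.
have mt : measurable_fun setT (fun x : measurableTypeR R => (x + t)%R : measurableTypeR R).
  by apply: measurable_funD => //; exact: measurable_cst.
pose m_ : {measure set (measurableTypeR R) -> \bar R} :=
  pushforward lebesgue_measure (fun x : measurableTypeR R => (x + t)%R : measurableTypeR R).
pose m := m_ mt.
rewrite -[LHS]/(m A); apply/esym/lebesgue_measure_unique => //= _ [[a b]] _ <-.
rewrite /m /m_ /= /pushforward.
rewrite (_ : _ @^-1` _ = `](a - t)%R, (b - t)%R]%classic).
  rewrite !lebesgue_measure_itv/= !lte_fin ltrD2r; case: ifPn => // _.
  by rewrite -!EFinB; congr EFin; ring.
by apply/seteqP; split => x /=; rewrite !in_itv/= ltrBlDr lerBrDr.
Qed.

Lemma rV_cons_head n (p : measurableTypeR R * 'rV[R]_n) : rV_cons p ord0 ord0 = p.1.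
Proof.
have -> : (ord0 : 'I_n.+1) = lshift n (ord0 : 'I_1) by exact: val_inj.
by rewrite /rV_cons (row_mxEl (\row_(_ < 1) p.1)) mxE.
Qed.

Lemma rV_cons_tail n (p : measurableTypeR R * 'rV[R]_n) j :
  rV_cons p ord0 (rshift 1 j) = p.2 ord0 j.
Proof. by rewrite /rV_cons (row_mxEr (\row_(_ < 1) p.1)). Qed.

Lemma rV_consD n (p z : measurableTypeR R * 'rV[R]_n) :
  rV_cons (p.1 + z.1, p.2 + z.2)%R = (rV_cons p + rV_cons z)%R.
Proof.
apply/rowP => i; rewrite [RHS]mxE /rV_cons /=.
by case: (split_ordP (i : 'I_(1 + n))) => j ->; rewrite ?(row_mxEl (\row_(_ < 1) _)) ?(row_mxEr (\row_(_ < 1) _)) !mxE.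
Qed.

Lemma rV_unconsK n : cancel (@rV_uncons R n) (@rV_cons R n).
Proof.
move=> x; rewrite /rV_cons /rV_uncons /=; apply/rowP => i.
case: (split_ordP (i : 'I_(1 + n))) => j ->.
  by rewrite (row_mxEl (\row_(_ < 1) _)) mxE; congr (x _ _); apply: val_inj; rewrite /= ord1.
by rewrite (row_mxEr (\row_(_ < 1) _)) mxE.
Qed.

(** By induction on the dimension: the translate of the measure agrees with the
    product measure on rectangles. *)
Lemma lebesgue_rV_translation n (z : 'rV[R]_n) (A : set 'rV[R]_n) : measurable A ->
  lebesgue_rV n ((fun x => (x + z)%R) @^-1` A) = lebesgue_rV n A.
Proof.
elim: n z A => [|n ih] z A mA.
  by congr (lebesgue_rV 0 _); apply/seteqP; split => x /=; rewrite !thinmx0.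
rewrite /= /lebesgue_rV_step /pushforward.
have mB : measurable (@rV_cons R n @^-1` A).
  by rewrite -[X in measurable X]setTI; exact: measurable_rV_cons.
set B := _ @^-1` A in mB *.
pose s := rV_uncons z.
pose f (p : measurableTypeR R * 'rV[R]_n) : measurableTypeR R * 'rV[R]_n :=
  (p.1 + s.1, p.2 + s.2)%R.
have mf : measurable_fun setT f.
  apply/measurable_fun_pairP; split.
    by apply: measurable_funD; [exact: measurable_fst|exact: measurable_cst].
  exact: (measurableT_comp (measurable_rV_translation s.2) measurable_snd).
pose m_ : {measure set (measurableTypeR R * 'rV[R]_n) -> \bar R} :=
  pushforward (@lebesgue_measure R \x lebesgue_rV n) f.
pose m := m_ mf.
have fE p : rV_cons (f p) = (rV_cons p + z)%R by rewrite (rV_consD p s) rV_unconsK.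
rewrite (_ : @rV_cons R n @^-1` _ = f @^-1` B); last first.
  by rewrite /B /preimage; apply/funext => p; rewrite /mkset fE.
rewrite -[LHS]/(m B); apply/esym/product_measure_unique => //= C D mC mD.
rewrite /m /m_ /= /pushforward.
rewrite (_ : f @^-1` _ = ((fun x : measurableTypeR R => (x + s.1)%R) @^-1` C) `*`
    ((fun x => (x + s.2)%R) @^-1` D)); last by apply/seteqP; split => p /=.
rewrite product_measure1E//.
- by congr (_ * _); [exact: lebesgue_measure_translation|exact: ih].
- rewrite -[X in measurable X]setTI.
  have mt : measurable_fun setT (fun x : measurableTypeR R => (x + s.1)%R : measurableTypeR R).
    by apply: measurable_funD => //; exact: measurable_cst.
  exact: (mt measurableT _ mC).
- by rewrite -[X in measurable X]setTI; exact: measurable_rV_translation.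
Qed.

Definition cube n (a : 'rV[R]_n) (h : R) : set 'rV[R]_n :=
  [set x | forall i, (a ord0 i <= x ord0 i < a ord0 i + h)%R].

Lemma measurable_cube n (a : 'rV[R]_n) h : measurable (cube a h).
Proof.
apply: (measurable_forall_coord (P := fun i r => (a ord0 i <= r < a ord0 i + h)%R)) => i.
rewrite (_ : (fun r => _) = `[a ord0 i, (a ord0 i + h)%R[%classic); first exact: measurable_itv.
by apply/seteqP; split => x /=; rewrite in_itv.
Qed.

Lemma lebesgue_rV_cube n (a : 'rV[R]_n) h : (0 <= h)%R ->
  lebesgue_rV n (cube a h) = (h ^+ n)%:E.
Proof.
move=> h0; elim: n a => [|n ih] a.
  rewrite /= diracE expr0 mem_set//=; by case.
rewrite /= /lebesgue_rV_step /pushforward.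
rewrite (_ : _ @^-1` _ = `[a ord0 ord0, (a ord0 ord0 + h)%R[%classic `*`
    cube (@rsubmx _ 1 1 n a) h).
  rewrite product_measure1E//; last exact: measurable_cube.
  rewrite ih [X in X * _]lebesgue_measure_itv/= lte_fin ltrDl.
  move: h0; rewrite le_eqVlt => /predU1P[<-|h0].
    by rewrite ltxx mul0e expr0n.
  by rewrite h0 -EFinB -EFinM addrAC subrr add0r exprS.
apply/seteqP; split => [p /= H|p /= [H1 H2] i].
  split; first by have := H ord0; rewrite rV_cons_head in_itv.
  by move=> i; have := H (rshift 1 i); rewrite rV_cons_tail mxE.
case: (split_ordP (i : 'I_(1 + n))) => j ->; last first.
  by have := H2 j; rewrite rV_cons_tail mxE.
rewrite (_ : lshift n j = ord0) ?rV_cons_head; last by apply: val_inj; rewrite /= ord1.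
by move: H1; rewrite in_itv.
Qed.

Lemma integral_rV_translation n (z : 'rV[R]_n) (f : 'rV[R]_n -> \bar R) :
  measurable_fun setT f -> (forall x, 0 <= f x) ->
  \int[lebesgue_rV n]_x f (x + z)%R = \int[lebesgue_rV n]_x f x.
Proof.
move=> mf f0.
have mt := measurable_rV_translation z.
pose m_ : {measure set 'rV[R]_n -> \bar R} :=
  pushforward (lebesgue_rV n) (fun x => x + z)%R.
pose m := m_ mt.
transitivity (\int[m]_x f x).
  by rewrite /m /m_ /= ge0_integral_pushforward// preimage_setT.
by apply: eq_measure_integral => A mA _; exact: lebesgue_rV_translation.
Qed.

End lebesgue_translation.

(** * Smooth functions *)

Section smooth1.
Context (R : realType).
Implicit Types (f g h : R -> R) (k : nat).

Fixpoint Dk k h : Prop := match k with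
  | 0 => True
  | k'.+1 => exists h', (forall x : R, is_derive x 1 h (h' x)) /\ Dk k' h'
  end.

Definition smooth1 h : Prop := forall k, Dk k h.

Lemma DkW k h : Dk k.+1 h -> Dk k h.
Proof.
elim: k h => // k ih h [h' [hh' Dh']]; exists h'; split => //; exact: ih.
Qed.

(** A class of functions stable under differentiation consists of smooth
    functions. *)
Lemma Dk_closed (C : set (R -> R)) :
  (forall f, C f -> exists f', C f' /\ forall x : R, is_derive x 1 f (f' x)) ->
  forall f, C f -> smooth1 f.
Proof.
move=> hC f Cf k; elim: k f Cf => // k ih f /hC[f' [Cf' ff']].
by exists f'; split => //; exact: ih.
Qed.

Lemma Dk_cst k (c : R) : Dk k (cst c).
Proof.
apply: (@Dk_closed [set f | exists c, f = cst c]); last by exists c.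
move=> _ [d ->]; exists (cst 0); split; first by exists 0.
by move=> x; exact: is_derive_cst.
Qed.

Lemma Dk_add k f g : Dk k f -> Dk k g -> Dk k (fun x => f x + g x).
Proof.
elim: k f g => // k ih f g [f' [ff' Df']] [g' [gg' Dg']].
by exists (fun x => f' x + g' x); split; [move=> x; exact: is_deriveD|exact: ih].
Qed.

Lemma Dk_mul k f g : Dk k f -> Dk k g -> Dk k (fun x => f x * g x).
Proof.
elim: k f g => // k ih f g Df Dg; have Df0 := DkW Df; have Dg0 := DkW Dg.
move: Df Dg => [f' [ff' Df']] [g' [gg' Dg']].
exists (fun x => f x * g' x + f' x * g x); split.
  move=> x; apply: is_derive_eq (is_deriveM (ff' x) (gg' x)) _.
  by rewrite /GRing.scale/= [g x * _]mulrC.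
by apply: Dk_add; exact: ih.
Qed.

Lemma Dk_comp k f g : Dk k f -> Dk k g -> Dk k (fun x => g (f x)).
Proof.
elim: k f g => // k ih f g Df [g' [gg' Dg']]; have Df0 := DkW Df.
move: Df => [f' [ff' Df']].
exists (fun x => g' (f x) * f' x); split.
  by move=> x; exact: (@is_derive1_comp _ g f x _ _ (gg' _) (ff' x)).
by apply: Dk_mul => //; exact: ih.
Qed.

Lemma Dk_inv k f : (forall x, f x != 0) -> Dk k f -> Dk k (fun x => (f x)^-1).
Proof.
move=> f0; elim: k => // k ih Df; have Df0 := DkW Df.
move: Df => [f' [ff' Df']].
exists (fun x => (-1 * f' x) * ((f x)^-1 * (f x)^-1)); split.
  move=> x; apply: is_derive_eq (is_deriveV (f0 x) (ff' x)) _.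
  rewrite /GRing.scale/= -exprVn; ring.
apply: Dk_mul; first by apply: Dk_mul => //; exact: Dk_cst.
by apply: Dk_mul; exact: ih.
Qed.

Lemma Dk_id k : Dk k (fun x : R => x).
Proof.
by case: k => // k; exists (cst 1); split; [move=> x; exact: is_derive_id|exact: Dk_cst].
Qed.

Lemma is_derive1_continuous f (x d : R) : is_derive x 1 f d -> {for x, continuous f}.
Proof.
move=> [df _]; apply: differentiable_continuous; exact/derivable1_diffP.
Qed.

End smooth1.

Section flat.
Context (R : realType).
Implicit Types (p : {poly R}) (t s : R).

(** The derivatives of [exp (- 1 / t)], extended by zero, all have this form. *)
Definition flat p t : R := if 0 < t then p.[t^-1] * expR (- t^-1) else 0.

(** From the Taylor lower bound of [expR s], at order [n]. *)
Lemma expR_dominates n s : 0 <= s -> s ^+ n * expR (- s) <= n`!%:R.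
Proof.
move=> s0; rewrite expRN ler_pdivrMr ?expR_gt0//.
case: n => [|n]; first by rewrite expr0 fact0 mul1r (le_trans _ (expR_ge1Dx s))// lerDl.
have := expR_ge1Dxn n s0; rewrite -lerBrDl => h.
have f0 : 0 < n.+1`!%:R :> R by rewrite ltr0n fact_gt0.
rewrite mulrC -ler_pdivrMr//; apply: le_trans h _; lra.
Qed.

(** Quadratic smallness at the origin, which makes the derivative there vanish. *)
Lemma flat_bound p : exists M, forall t, `|flat p t| <= M * t ^+ 2.
Proof.
exists (\sum_(i < size p) `|p`_i| * (i + 2)`!%:R) => t; rewrite /flat.
have M0 : 0 <= \sum_(i < size p) `|p`_i| * (i + 2)`!%:R.
  by apply: sumr_ge0 => i _; rewrite mulr_ge0.
case: ifPn => t0; last by rewrite normr0 mulr_ge0// sqr_ge0.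
set s := t^-1; have s0 : 0 < s by rewrite invr_gt0.
have -> : t ^+ 2 = (s ^+ 2)^-1 by rewrite /s exprVn invrK.
rewrite ler_pdivlMr ?exprn_gt0// horner_coef normrM (ger0_norm (expR_ge0 _)).
apply: (@le_trans _ _ ((\sum_(i < size p) `|p`_i| * s ^+ i) * expR (- s) * s ^+ 2)).
  rewrite ler_pM2r ?exprn_gt0// ler_pM2r ?expR_gt0//.
  apply: le_trans (ler_norm_sum _ _ _) _; apply: ler_sum => i _.
  by rewrite normrM (ger0_norm (exprn_ge0 _ (ltW s0))).
rewrite -mulrA mulr_suml; apply: ler_sum => i _; rewrite -mulrA ler_wpM2l//.
by rewrite [expR _ * _]mulrC mulrA -exprD; apply: expR_dominates; exact: ltW.
Qed.

Lemma is_derive_flat p t : is_derive t 1 (flat p) (flat ('X^2 * (p^`() - p) * (-1)%:P) t).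
Proof.
have [t0|t0|t0] := ltrgtP t 0.
- have -> : flat ('X^2 * (p^`() - p) * (-1)%:P) t = 0 by rewrite /flat ltNge ltW.
  apply: (near_eq_is_derive _ (is_derive_cst (0 : R^o) t 1)).
  near=> u; rewrite /flat /cst ifF//; apply/negbTE; rewrite -leNgt ltW//.
  by near: u; exact: lt_nbhsl.
- pose q u := p.[u^-1] * expR (- u^-1).
  apply: (@near_eq_is_derive _ _ _ q).
    near=> u; rewrite /flat /q ifT//; by near: u; exact: lt_nbhsr.
  have dinv : is_derive t 1 (fun u : R => u^-1) (- (t ^- 2)).
    apply: is_derive_eq (is_deriveV (lt0r_neq0 t0 : id t != 0) (is_derive_id t 1)) _.
    by rewrite /GRing.scale/= mulr1.
  have dp : is_derive t 1 (fun u => p.[u^-1]) (p^`().[t^-1] * - (t ^- 2)).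
    exact: (@is_derive1_comp _ (horner p) (fun u => u^-1) t _ _ (is_derive_poly p _) dinv).
  have de : is_derive t 1 (fun u => expR (- u^-1)) (expR (- t^-1) * t ^- 2).
    have dn : is_derive t 1 (fun u : R => - u^-1) (t ^- 2).
      by apply: is_derive_eq (is_deriveN dinv) _; rewrite opprK.
    exact: (@is_derive1_comp _ expR (fun u => - u^-1) t _ _ (is_derive_expR _) dn).
  apply: is_derive_eq (is_deriveM dp de) _.
  rewrite /flat t0 !hornerE /GRing.scale/=. by rewrite exprVn; ring.
- rewrite t0 {t0}; have -> : flat ('X^2 * (p^`() - p) * (-1)%:P) 0 = 0 by rewrite /flat ltxx.
  have [M HM] := flat_bound p.
  have f0 : flat p 0 = 0 by rewrite /flat ltxx.
  have cv : (fun h : R => h^-1 *: ((flat p \o shift 0) (h *: 1) - flat p 0)) @ 0^' --> (0 : R).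
    apply/cvgrPdist_le => e e0; near=> h.
    rewrite sub0r normrN /= addr0 f0 subr0 /GRing.scale/= mulr1 normrM.
    have h0 : h != 0 by near: h; exact: nbhs_dnbhs_neq.
    apply: le_trans (ler_wpM2l (normr_ge0 _) (HM h)) _.
    rewrite normrV ?unitfE// -(sqr_normr h) mulrCA expr2 mulKf ?normr_eq0//.
    apply: (@le_trans _ _ ((`|M| + 1) * `|h|)).
      by rewrite ler_wpM2r// (le_trans (ler_norm _))// lerDl.
    rewrite mulrC -ler_pdivlMr; last by rewrite ltr_wpDl.
    rewrite ltW//; near: h; apply: dnbhs0_lt; by rewrite divr_gt0// ltr_wpDl.
  by apply: DeriveDef; [exact: cvgP cv|exact/cvg_lim].
Unshelve. all: by end_near. Qed.

Lemma smooth1_flat p : smooth1 (flat p).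
Proof.
apply: (@Dk_closed _ [set f | exists p, f = flat p]); last by exists p.
move=> _ [q ->]; exists (flat ('X^2 * (q^`() - q) * (-1)%:P)); split; first by eexists.
exact: is_derive_flat.
Qed.

End flat.

(** * Smooth functions of several variables and test functions *)

Section Ck_calculus.
Context (R : realType) (N : nat).
Implicit Types (f g : 'rV[R]_N -> R) (x v : 'rV[R]_N) (i : 'I_N) (k : nat).

Definition basis_vec i : 'rV[R]_N := delta_mx ord0 i.

Lemma is_derive_line f x v (t d : R) :
  is_derive (t *: v + x) v f d <-> is_derive t 1 (fun s : R => f (s *: v + x)) d.
Proof.
have e : (fun h : R => h^-1 *: ((f \o shift (t *: v + x)) (h *: v) - f (t *: v + x))) =
    (fun h : R => h^-1 *: (((fun s : R => f (s *: v + x)) \o shift t) (h *: 1) - f (t *: v + x))).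
  apply/funext => h /=; congr (_ *: (f _ - _)).
  by rewrite addrA -scalerDl /GRing.scale/= mulr1.
split => -[h1 h2]; apply: DeriveDef.
- by rewrite /derivable -e.
- by rewrite /derive -e.
- by rewrite /derivable e.
- by rewrite /derive e.
Qed.

Lemma is_derive_comp f (h : R -> R) x v (a b : R) :
  is_derive x v f a -> is_derive (f x) 1 h b -> is_derive x v (fun y => h (f y)) (b * a).
Proof.
rewrite -{1 3}[x](add0r x) -{1 2}(scale0r v) => /is_derive_line fa hb.
apply/is_derive_line; apply: (@is_derive1_comp _ h (fun s : R => f (s *: v + x))) => //.
by rewrite scale0r add0r.
Qed.

Lemma Ck_continuous k f : Ck k f -> continuous f.
Proof. by case: k => [|k] //= []. Qed.

Lemma Ck_derivable k f i x : Ck k.+1 f -> is_derive x (basis_vec i) f (pderiv i f x).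
Proof. by move=> [_ h _]; apply: derivableP; exact: h. Qed.

Lemma CkW k f : Ck k.+1 f -> Ck k f.
Proof.
elim: k f => [|k ih] f [cf df h]; first exact: cf.
by split => // i; exact: (ih _ (h i)).
Qed.

Lemma CkS k f (f' : 'I_N -> 'rV[R]_N -> R) : continuous f ->
  (forall i x, is_derive x (basis_vec i) f (f' i x)) -> (forall i, Ck k (f' i)) -> Ck k.+1 f.
Proof.
move=> cf df hf; split; [exact: cf|by move=> i x; have [] := df i x|].
move=> i; suff -> : pderiv i f = f' i by exact: hf.
by apply/funext => x; have [] := df i x.
Qed.

Lemma Ck_cst k (c : R) : Ck k (cst c : 'rV[R]_N -> R).
Proof.
elim: k c => [|k ih] c; first exact: cst_continuous.
apply: (@CkS k (cst c) (fun _ => cst 0)).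
- exact: cst_continuous.
- by move=> i; exact: (ih 0).
Qed.

Lemma is_derive_coord x v j : is_derive x v (fun y : 'rV[R]_N => y ord0 j) (v ord0 j).
Proof.
rewrite -{1}[x](add0r x) -{1}(scale0r v); apply/is_derive_line.
rewrite (_ : (fun s : R => _) = fun s => s * v ord0 j + x ord0 j); last first.
  by apply/funext => s; rewrite !mxE.
have d1 : is_derive (0 : R) 1 (fun s : R => s * v ord0 j) (v ord0 j).
  apply: is_derive_eq (is_deriveM (is_derive_id (0 : R) 1) (is_derive_cst (v ord0 j) (0 : R) 1)) _.
  by rewrite scaler0 add0r /GRing.scale/= mulr1.
apply: is_derive_eq (is_deriveD d1 (is_derive_cst (x ord0 j) (0 : R) 1)) _.
by rewrite addr0.
Qed.

Lemma Ck_coord k j : Ck k (fun y : 'rV[R]_N => y ord0 j).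
Proof.
case: k => [|k]; first exact: coord_continuous.
apply: (@CkS k _ (fun i => cst (basis_vec i ord0 j))); first exact: coord_continuous.
  by move=> i x; exact: is_derive_coord.
by move=> i; exact: Ck_cst.
Qed.

Lemma continuous_add f g : continuous f -> continuous g -> continuous (fun x => f x + g x).
Proof. by move=> cf cg x; exact: cvgD (cf x) (cg x). Qed.

Lemma continuous_mul f g : continuous f -> continuous g -> continuous (fun x => f x * g x).
Proof. by move=> cf cg x; exact: cvgM (cf x) (cg x). Qed.

Lemma Ck_add k f g : Ck k f -> Ck k g -> Ck k (fun x => f x + g x).
Proof.
elim: k f g => [|k ih] f g hf hg; first exact: continuous_add.
apply: (@CkS k _ (fun i x => pderiv i f x + pderiv i g x)).
- exact: continuous_add (Ck_continuous hf) (Ck_continuous hg).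
- by move=> i x; exact: (is_deriveD (Ck_derivable i x hf) (Ck_derivable i x hg)).
- by case: hf hg => _ _ hf [_ _ hg] i; exact: (ih _ _ (hf i) (hg i)).
Qed.

Lemma Ck_mul k f g : Ck k f -> Ck k g -> Ck k (fun x => f x * g x).
Proof.
elim: k f g => [|k ih] f g hf hg; first exact: continuous_mul.
apply: (@CkS k _ (fun i x => f x * pderiv i g x + g x * pderiv i f x)).
- exact: continuous_mul (Ck_continuous hf) (Ck_continuous hg).
- by move=> i x; exact: (is_deriveM (Ck_derivable i x hf) (Ck_derivable i x hg)).
- have [_ _ hf'] := hf; have [_ _ hg'] := hg; move=> i; apply: Ck_add.
    exact: (ih _ _ (CkW hf) (hg' i)).
  exact: (ih _ _ (CkW hg) (hf' i)).
Qed.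

Lemma continuous_comp1 (h h' : R -> R) f : (forall t : R, is_derive t 1 h (h' t)) ->
  continuous f -> continuous (fun x => h (f x)).
Proof.
by move=> hh cf x; exact: (continuous_comp (cf x) (is_derive1_continuous (hh (f x)))).
Qed.

Lemma Ck_comp k (h : R -> R) f : Dk k.+1 h -> Ck k f -> Ck k (fun x => h (f x)).
Proof.
elim: k h f => [|k ih] h f [h' [hh' Dh']] hf; first exact: (continuous_comp1 hh' hf).
apply: (@CkS k _ (fun i x => h' (f x) * pderiv i f x)).
- exact: (continuous_comp1 hh' (Ck_continuous hf)).
- by move=> i x; exact: (is_derive_comp (Ck_derivable i x hf) (hh' _)).
- have [_ _ hf'] := hf; move=> i; apply: Ck_mul; last exact: (hf' i).
  exact: (ih _ _ Dh' (CkW hf)).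
Qed.

Lemma smooth_pderiv f i : smooth f -> smooth (pderiv i f).
Proof. by move=> h k; case: (h k.+1) => _ _; exact. Qed.

Lemma smooth_is_derive f i x : smooth f -> is_derive x (basis_vec i) f (pderiv i f x).
Proof. by move=> h; exact: (Ck_derivable i x (h 1%N)). Qed.

Lemma pderivD f g i : smooth f -> smooth g ->
  pderiv i (fun x => f x + g x) = (fun x => pderiv i f x + pderiv i g x).
Proof.
move=> hf hg; apply/funext => x.
by have [] := is_deriveD (smooth_is_derive i x hf) (smooth_is_derive i x hg).
Qed.

Lemma pderivM f g i : smooth f -> smooth g ->
  pderiv i (fun x => f x * g x) = (fun x => f x * pderiv i g x + g x * pderiv i f x).
Proof.
move=> hf hg; apply/funext => x.
by have [] := is_deriveM (smooth_is_derive i x hf) (smooth_is_derive i x hg).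
Qed.

Lemma pderiv_cst (c : R) i : pderiv i (cst c : 'rV[R]_N -> R) = cst 0.
Proof. by apply/funext => x; have [] := is_derive_cst c x (basis_vec i). Qed.

Lemma pderiv_comp f (h h' : R -> R) i : smooth f ->
  (forall t : R, is_derive t 1 h (h' t)) ->
  pderiv i (fun x => h (f x)) = (fun x => h' (f x) * pderiv i f x).
Proof.
move=> hf hh; apply/funext => x.
by have [] := is_derive_comp (smooth_is_derive i x hf) (hh _).
Qed.

End Ck_calculus.

Section test_functions.
Context (R : realType) (N : nat) (U : set 'rV[R]_N).
Implicit Types (f g phi psi : 'rV[R]_N -> R) (x : 'rV[R]_N) (i : 'I_N).

Lemma test_smooth phi : test_function U phi -> smooth phi.
Proof. by case. Qed.

Lemma test_out phi x : test_function U phi -> ~ U x -> phi x = 0.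
Proof. by move=> [_ [K [_ KU h]]] Ux; apply: h => /KU. Qed.

Lemma test_add phi psi : test_function U phi -> test_function U psi ->
  test_function U (fun x => phi x + psi x).
Proof.
move=> [sp [K [cK KU hK]]] [sq [L [cL LU hL]]]; split=> [k|]; first exact: Ck_add.
exists (K `|` L); split; first exact: compactU.
  by move=> x [/KU|/LU].
by move=> x /not_orP[nK nL]; rewrite hK// hL// addr0.
Qed.

Lemma test_mul phi f : test_function U phi -> smooth f ->
  test_function U (fun x => phi x * f x).
Proof.
move=> [sp [K [cK KU hK]]] sf; split=> [k|]; first exact: Ck_mul.
by exists K; split=> // x nK; rewrite hK// mul0r.
Qed.

Lemma test_scale (c : R) phi : test_function U phi -> test_function U (fun x => c * phi x).
Proof.
move=> tp; have := test_mul tp (fun k => Ck_cst N k c).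
by rewrite (_ : (fun x => _) = fun x => c * phi x)//; apply/funext => x; rewrite mulrC.
Qed.

Lemma test_comp phi (h : R -> R) : test_function U phi -> smooth1 h -> h 0 = 0 ->
  test_function U (fun x => h (phi x)).
Proof.
move=> [sp [K [cK KU hK]]] sh h0; split=> [k|]; first exact: Ck_comp.
by exists K; split=> // x nK; rewrite hK.
Qed.

Lemma test_pderiv phi i : test_function U phi -> test_function U (pderiv i phi).
Proof.
move=> [sp [K [cK KU hK]]]; split; first exact: smooth_pderiv.
exists K; split=> // x nK.
have cl : closed K by apply: compact_closed => //; exact: norm_hausdorff.
have nx : \forall y \near x, (cst 0 : 'rV[R]_N -> R) y = phi y.
  have : open (~` K) by exact: closed_openC.
  by rewrite openE => /(_ x nK); apply: filterS => y /hK ->.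
by have [] : is_derive x (basis_vec R i) phi 0
  := near_eq_is_derive nx (is_derive_cst (0 : R) x (basis_vec R i)).
Qed.

Lemma test_bounded phi : test_function U phi ->
  exists M, 0 <= M /\ forall x, `|phi x| <= M.
Proof.
move=> [sp [K [cK _ hK]]].
have cp : compact (phi @` K).
  apply: continuous_compact => //; apply: continuous_subspaceT => x.
  exact: (Ck_continuous (sp 0%N)).
have [M [_ HM]] := compact_bounded cp.
exists (`|M| + 1); split; first exact: addr_ge0.
move=> x; have [Kx|nK] := pselect (K x); last by rewrite hK// normr0 addr_ge0.
apply: (HM (`|M| + 1)); last by exists x.
by rewrite (le_lt_trans (ler_norm M))// ltrDl.
Qed.

Lemma test_measurable phi (D : set 'rV[R]_N) : test_function U phi -> measurable_fun D phi.
Proof. by move=> [sp _]; apply: rV_continuous_measurable; exact: (Ck_continuous (sp 0%N)). Qed.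

End test_functions.

(** * Bump functions and the fundamental lemma of the calculus of variations *)

Section boxes.
Context (R : realType) (N : nat).
Implicit Types (a b x : 'rV[R]_N).

Definition obox a b : set 'rV[R]_N := [set x | forall i, a ord0 i < x ord0 i < b ord0 i].
Definition cbox a b : set 'rV[R]_N := [set x | forall i, a ord0 i <= x ord0 i <= b ord0 i].

Lemma measurable_obox a b : measurable (obox a b).
Proof.
apply: (measurable_forall_coord (P := fun i r => (a ord0 i < r < b ord0 i))) => i.
rewrite (_ : (fun r => _) = `]a ord0 i, b ord0 i[%classic); first exact: measurable_itv.
by apply/seteqP; split => x /=; rewrite in_itv.
Qed.

Lemma cbox_compact a b : compact (cbox a b).
Proof.
have := @rV_compact R^o N (fun i => `[a ord0 i, b ord0 i]%classic).
rewrite (_ : [set v | _] = cbox a b); first by apply => i; exact: segment_compact.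
by apply/seteqP; split => x /= h i; have := h i; rewrite in_itv.
Qed.

Lemma oboxI a b a' b' : obox a b `&` obox a' b' =
  obox (\row_i Num.max (a ord0 i) (a' ord0 i)) (\row_i Num.min (b ord0 i) (b' ord0 i)).
Proof.
apply/seteqP; split => [x [h h'] i|x h].
  by rewrite !mxE gt_max lt_min; have /andP[-> ->] := h i; have /andP[-> ->] := h' i.
by split => i; have := h i; rewrite !mxE gt_max lt_min =>
  /andP[/andP[h1 h2] /andP[h3 h4]]; rewrite ?h1 ?h2 ?h3 ?h4.
Qed.

(** Open boxes are stable under intersection, so that an integral vanishing on
    all of them vanishes on all measurable sets. *)
Lemma measurable_rV_gen : @measurable _ 'rV[R]_N = <<s [set A | exists a b, A = obox a b] >>.
Proof.
set G := mkset _; apply/seteqP; split => [A mA|A]; last first.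
  apply: smallest_sub; first exact: sigma_algebra_measurable.
  by move=> _ [a [b ->]]; exact: measurable_obox.
have : measurable_fun setT (fun x : g_sigma_algebraType G => x : 'rV[R]_N).
  apply: measurable_fun_rV => i.
  apply: (measurability _ (RGenOpens.measurableE R)).
  move=> _ [_ [s [t ->]] <-]; rewrite setTI.
  pose c n : set (g_sigma_algebraType G) := obox (\row_j if j == i then s else - n%:R) (\row_j if j == i then t else n%:R).
  rewrite (_ : _ @^-1` _ = \bigcup_n c n).
    by apply: bigcupT_measurable => n; apply: sub_sigma_algebra; eexists; eexists.
  apply/seteqP; split => [x|x [n _ h]] /=; last first.
    by have := h i; rewrite !mxE eqxx in_itv.
  rewrite in_itv/= => /andP[sx xt].
  pose M := \sum_j `|x ord0 j|.
  exists (Num.trunc M).+1 => // j; rewrite !mxE; case: eqP => [->|_]; first by rewrite sx.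
  rewrite -ltr_norml; apply: le_lt_trans (_ : M < _).
    by rewrite /M (bigD1 j)//= lerDl; apply: sumr_ge0.
  by rewrite truncnS_gt.
by move=> /(_ measurableT A mA); rewrite setTI.
Qed.

End boxes.

Section bumps.
Context (R : realType) (N : nat).
Implicit Types (a b x : 'rV[R]_N).

Definition flat0 : R -> R := flat 1.

Lemma flat0E t : flat0 t = if 0 < t then expR (- t^-1) else 0.
Proof. by rewrite /flat0 /flat hornerC mul1r. Qed.

Lemma flat0_ge0 t : 0 <= flat0 t.
Proof. by rewrite flat0E; case: ifP => // _; exact: expR_ge0. Qed.

Lemma flat0_le1 t : flat0 t <= 1.
Proof.
rewrite flat0E; case: ifP => // t0.
by rewrite -[leRHS]expR0 ler_expR oppr_le0 invr_ge0 ltW.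
Qed.

Lemma flat0_gt0 t : 0 < t -> 0 < flat0 t.
Proof. by move=> t0; rewrite flat0E t0 expR_gt0. Qed.

Lemma flat0_le0 t : t <= 0 -> flat0 t = 0.
Proof. by move=> t0; rewrite flat0E ltNge t0. Qed.

(** [flat0 (n t)] tends to one at a rate [1 / n]. *)
Lemma flat0_ge t : 0 < t -> 1 - t^-1 <= flat0 t.
Proof. by move=> t0; rewrite flat0E t0; exact: expR_ge1Dx. Qed.

Lemma smooth1_flat0 : smooth1 flat0.
Proof. exact: smooth1_flat. Qed.

Lemma Ck_prod k (I : Type) (s : seq I) (f : I -> 'rV[R]_N -> R) :
  (forall i, Ck k (f i)) -> Ck k (fun x => \prod_(i <- s) f i x).
Proof.
move=> hf; elim: s => [|i s ih].
  by under eq_fun do rewrite big_nil; exact: Ck_cst.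
by under eq_fun do rewrite big_cons; exact: Ck_mul.
Qed.

Definition bump (n : nat) a b x : R :=
  \prod_i (flat0 (n.+1%:R * (x ord0 i - a ord0 i)) * flat0 (n.+1%:R * (b ord0 i - x ord0 i))).

Lemma smooth_bump n a b : smooth (bump n a b).
Proof.
move=> k; apply: Ck_prod => i.
apply: Ck_mul; apply: (Ck_comp (smooth1_flat0 k.+1)).
  apply: Ck_mul; first exact: Ck_cst.
  by apply: Ck_add; [exact: Ck_coord|exact: Ck_cst].
apply: Ck_mul; first exact: Ck_cst.
apply: Ck_add; first exact: Ck_cst.
rewrite (_ : (fun x => _) = fun x : 'rV[R]_N => -1 * x ord0 i).
  by apply: Ck_mul; [exact: Ck_cst|exact: Ck_coord].
by apply/funext => x; rewrite mulN1r.
Qed.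

Lemma bump_out n a b x : ~ obox a b x -> bump n a b x = 0.
Proof.
move=> /existsNP[i /negP]; rewrite negb_and -!leNgt => h; rewrite /bump (bigD1 i)//=.
have n0 : 0 <= n.+1%:R :> R by [].
case/orP: h => h; first rewrite flat0_le0 ?mul0r// mulr_ge0_le0// subr_le0//.
by rewrite [X in _ * X * _]flat0_le0 ?mulr0 ?mul0r// mulr_ge0_le0// subr_le0.
Qed.

Lemma bump_ge0 n a b x : 0 <= bump n a b x.
Proof. by apply: prodr_ge0 => i _; rewrite mulr_ge0// flat0_ge0. Qed.

Lemma bump_le1 n a b x : bump n a b x <= 1.
Proof.
apply: prodr_ile1 => i _; rewrite mulr_ge0 ?flat0_ge0//=.
by rewrite mulr_ile1 ?flat0_ge0 ?flat0_le1.
Qed.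

Lemma test_bump (U : set 'rV[R]_N) n a b : cbox a b `<=` U -> test_function U (bump n a b).
Proof.
move=> abU; split; first exact: smooth_bump.
exists (cbox a b); split => //; first exact: cbox_compact.
move=> x nx; apply: bump_out => h; apply: nx => i.
by have /andP[h1 h2] := h i; rewrite !ltW.
Qed.

Lemma cvg_prod1 (I : Type) (s : seq I) (f : I -> nat -> R) :
  (forall i, f i n @[n --> \oo] --> (1 : R)) ->
  (\prod_(i <- s) f i n) @[n --> \oo] --> (1 : R).
Proof.
move=> hf; elim: s => [|i s ih].
  by under eq_fun do rewrite big_nil; exact: cvg_cst.
rewrite (_ : (fun n => _) = fun n => f i n * \prod_(j <- s) f j n); last first.
  by apply/funext => n; rewrite big_cons.
by have := cvgM (hf i) ih; rewrite mulr1; apply.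
Qed.

Lemma flat0_cvg t : 0 < t -> flat0 (n.+1%:R * t) @[n --> \oo] --> (1 : R).
Proof.
move=> t0; apply/cvgrPdist_le => e e0.
have [K HK] := invS_le_eps (mulr_gt0 e0 t0); exists K => // n /HK h /=.
have nt : 0 < n.+1%:R * t by rewrite mulr_gt0.
rewrite ger0_norm ?subr_ge0 ?flat0_le1//.
rewrite lerBlDl -lerBlDr (le_trans _ (flat0_ge nt))// lerD2l lerN2 invfM.
by rewrite ler_pdivrMr.
Qed.

(** The factors [flat0 (n t)] tend to one for positive [t] and vanish otherwise. *)
Lemma bump_cvg a b x : bump n a b x @[n --> \oo] --> (\1_(obox a b) x : R).
Proof.
rewrite indicE; case: (boolP (x \in _)) => [/set_mem h|/negP h]; last first.
  rewrite (_ : (fun n => _) = fun=> 0); first exact: cvg_cst.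
  by apply/funext => n; apply: bump_out => hx; apply: h; exact: mem_set.
apply: cvg_prod1 => i; have /andP[h1 h2] := h i.
rewrite -subr_gt0 in h1; rewrite -subr_gt0 in h2.
by have := cvgM (flat0_cvg h1) (flat0_cvg h2); rewrite mulr1; apply.
Qed.

End bumps.

Section density.
Context (R : realType) (N : nat) (U : set 'rV[R]_N).
Hypothesis oU : open U.
Local Notation mu := (@lebesgue_rV R N).
Local Notation mU := (rV_open_measurable oU).

(** The boxes are indexed by a rational center and the inverse of a half-width;
    those that do not fit into [U] are discarded by the Boolean sequence. *)
Lemma open_rational_boxes : exists (c : nat -> bool) (a b : nat -> 'rV[R]_N),
  (forall n, c n -> cbox (a n) (b n) `<=` U) /\ U `<=` \bigcup_(n in [set n | c n]) obox (a n) (b n).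
Proof.
pose lo (p : 'rV[rat]_N * nat) : 'rV[R]_N := \row_i (ratr (p.1 ord0 i) - p.2.+1%:R^-1).
pose hi (p : 'rV[rat]_N * nat) : 'rV[R]_N := \row_i (ratr (p.1 ord0 i) + p.2.+1%:R^-1).
pose ok p := `[< cbox (lo p) (hi p) `<=` U >].
have key x : U x -> exists p, ok p /\ obox (lo p) (hi p) x.
  move=> Ux; have /nbhs_ballP[e /= e0 eU] : nbhs x U by exact: open_nbhs_nbhs.
  have [k hk] : exists k : nat, k.+1%:R^-1 <= e / 3.
    have [|k hk] := @invS_le_eps R (e / 3); first by rewrite divr_gt0.
    by exists k; exact: hk.
  have k0 : 0 < k.+1%:R^-1 :> R by rewrite invr_gt0.
  have hq i : exists q : rat, `|ratr q - x ord0 i| < k.+1%:R^-1.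
    have [|q] := @rat_in_itvoo R (x ord0 i - k.+1%:R^-1) (x ord0 i + k.+1%:R^-1).
      by rewrite ltrD2l (lt_trans _ k0)// oppr_lt0.
    rewrite in_itv/= => /andP[q1 q2]; exists q; rewrite ltr_norml.
    by rewrite ltrBrDr [X in X < _]addrC q1/= ltrBlDr addrC.
  have [q Hq] := choice hq; exists (\row_i q i, k); split.
    apply/asboolP => y hy; apply: eU; apply/coord_ball => // i.
    have := hy i; have := Hq i; rewrite !mxE !ltr_norml => /andP[h1 h2] /andP[h3 h4].
    by move: hk h1 h2 h3 h4; move: (k.+1%:R^-1) => r hk h1 h2 h3 h4; apply/andP; split; lra.
  move=> i; have := Hq i; rewrite !mxE ltr_norml => /andP[].
  by move: (k.+1%:R^-1) => r h1 h2; apply/andP; split; lra.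
pose c n := if unpickle n is Some p then ok p else false.
pose d n : 'rV[rat]_N * nat := odflt (0, 0%N) (unpickle n).
exists c, (fun n => lo (d n)), (fun n => hi (d n)); split.
  by move=> n; rewrite /c /d; case: unpickle => //= p /asboolP.
move=> x /key[p [okp hp]]; exists (pickle p); first by rewrite /c /= pickleK.
by rewrite /d pickleK.
Qed.

(** The fundamental lemma: bump functions converge to the indicators of boxes,
    and the boxes form a pi-system that generates the measurable sets. *)
Lemma test_dense (w : 'rV[R]_N -> R) : summable_fun mu U w ->
  (forall phi, test_function U phi -> Rintegral mu U (fun x => w x * phi x) = 0) ->
  aeD mu U (fun x => w x = 0).
Proof.
move=> sw hw.
have mw := summable_meas sw.
have step1 a b : cbox a b `<=` U -> Rintegral mu U (fun x => w x * \1_(obox a b) x) = 0.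
  move=> abU; have [] := @Rintegral_dominated _ _ _ mu U mU
    (fun n x => w x * bump n a b x) (fun x => w x * \1_(obox a b) x) (fun x => `|w x|).
  - move=> n; apply: measurable_funM => //.
    by apply: rV_continuous_measurable; exact: (Ck_continuous (smooth_bump n a b 0)).
  - by apply: measurable_funM => //; apply: measurable_indic; exact: measurable_obox.
  - apply: aeD_all => x _; apply: cvgM; [exact: cvg_cst|exact: bump_cvg].
  - exact: summable_norm.
  - move=> n; apply: aeD_all => x _; rewrite normrM ler_piMr//.
    by rewrite ger0_norm ?bump_ge0// bump_le1.
  have e : (fun n => Rintegral mu U (fun x => w x * bump n a b x)) = fun=> 0.
    by apply/funext => n; apply: hw; exact: test_bump.
  by move=> _; rewrite e => h; rewrite -(cvg_lim _ h)// lim_cst.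
have step2 a b : cbox a b `<=` U -> aeD mu (obox a b) (fun x => w x = 0).
  move=> abU; have mO := measurable_obox a b.
  have OU : obox a b `<=` U.
    by move=> x h; apply: abU => i; have /andP[h1 h2] := h i; rewrite !ltW.
  have iO : mu.-integrable (obox a b) (EFin \o w) by exact: (integrableS mU mO OU sw).
  have iA A : measurable A -> mu.-integrable (obox a b `&` A) (EFin \o w).
    by move=> mA; apply: (integrableS mO _ _ iO) => //; exact: measurableI.
  pose P A := (\int[mu]_(x in obox a b `&` A) (w x)%:E = 0)%E.
  have PO c d : cbox c d `<=` U -> (\int[mu]_(x in obox c d) (w x)%:E = 0)%E.
    move=> cdU; have cdU' : obox c d `<=` U.
      by move=> x h; apply: cdU => i; have /andP[h1 h2] := h i; rewrite !ltW.
    have icd : summable_fun mu (obox c d) w.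
      exact: (integrableS mU (measurable_obox _ _) cdU' sw).
    rewrite -RintegralE//; last exact: measurable_obox.
    rewrite -(setIidr cdU') (Rintegral_mkcondr mu U (obox c d) w) -[RHS]/(0%:E) -(step1 c d cdU).
    congr ((Rintegral _ _ _)%:E); apply/funext => x; rewrite patchE indicE.
    by case: ifP; rewrite ?mulr1 ?mulr0.
  have allP A : measurable A -> P A.
    rewrite [in X in X -> _]measurable_rV_gen.
    apply: (dynkin_induction (G := [set A | exists a b, A = obox a b])).
    - exact: measurable_rV_gen.
    - by move=> _ _ [a1 [b1 ->]] [a2 [b2 ->]]; rewrite oboxI; eexists; eexists.
    - by rewrite /P setIT; exact: PO.
    - move=> _ [a1 [b1 ->]]; rewrite /P oboxI; apply: PO => x h; apply: abU => i.
      by have := h i; rewrite !mxE ge_max le_min => /andP[/andP[-> _] /andP[-> _]].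
    - move=> S mS hS; have := PO a b abU.
      rewrite -{1}(setIT (obox a b)) -(setUv S) setIUr integral_setU_EFin//.
      + by rewrite hS add0e.
      + exact: measurableI.
      + by apply: measurableI => //; exact: measurableC.
      + by rewrite -setIUr setUv setIT; exact: (measurable_funS mU OU mw).
      + by apply/disj_setPS => x [[_ Sx] [_ /(_ Sx)]].
    - move=> F mF tF hF; rewrite /P setI_bigcupr integral_bigcup//.
      + by rewrite eseries0// => n _ _; exact: hF.
      + exact: trivIset_setIl.
      + by move=> k; exact: measurableI.
      + by rewrite -setI_bigcupr; apply: iA; exact: bigcupT_measurable.
  have := @integral_ae_eq _ _ _ mu (obox a b) mO (cst 0%E) (EFin \o w) iO (measurable_cst _).
  move=> H; have {}H : ae_eq mu (obox a b) (EFin \o w) (cst 0%E).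
    apply: H => E EO mE; rewrite integral0.
    by have := allP E mE; rewrite /P setIidr.
  by apply: aeDW H => x _ [].
have [c [a [b [cU Uc]]]] := open_rational_boxes.
have H n : aeD mu setT (fun x => c n -> obox (a n) (b n) x -> w x = 0).
  case: (boolP (c n)) => cn; last by apply: aeD_all.
  by have := step2 _ _ (cU n cn); rewrite /aeD; apply: filterS => x h _ _ hx; exact: h.
have := aeD_forall H; rewrite /aeD; apply: filterS => x h /Uc[n /= cn hx].
exact: (h Logic.I n).
Qed.

End density.

(** * Translations of test functions *)

Section translations.
Context (R : realType) (N : nat).
Local Notation mu := (@lebesgue_rV R N).
Implicit Types (f phi : 'rV[R]_N -> R) (x z : 'rV[R]_N) (i : 'I_N) (b s t : R).

Definition centered_cube b : set 'rV[R]_N := cube (const_mx (- b)) (2 * b).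

Lemma centered_cubeP b x : centered_cube b x <-> forall i, - b <= x ord0 i < b.
Proof.
by split => h i; have := h i; rewrite !mxE => /andP[h1 h2]; apply/andP; split; lra.
Qed.

Lemma measurable_centered_cube b : measurable (centered_cube b).
Proof. exact: measurable_cube. Qed.

Lemma centered_cube_fin b : 0 <= b -> (mu (centered_cube b) < +oo)%E.
Proof. by move=> b0; rewrite /centered_cube lebesgue_rV_cube ?ltry// mulr_ge0. Qed.

Lemma bounded_sub_centered_cube (A : set 'rV[R]_N) : bounded_set A -> exists b, 0 < b /\ A `<=` centered_cube b.
Proof.
move=> [M [_ HM]]; exists (`|M| + 2); split; first by rewrite ltr_wpDl.
move=> x Ax; apply/centered_cubeP => i.
have xM : `|x| <= `|M| + 1 by apply: HM => //; rewrite (le_lt_trans (ler_norm M))// ltrDl.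
have e0 : 0 < `|M| + 2 by rewrite ltr_wpDl.
have : ball (0 : 'rV[R]_N) (`|M| + 2) x.
  by rewrite -ball_normE /ball_/= sub0r normrN (le_lt_trans xM)// ltrD2l ltr1n.
move=> /(coord_ball _ _ e0)/(_ i); rewrite mxE sub0r normrN ltr_norml => /andP[h1 h2].
by rewrite ltW.
Qed.

Lemma test_support (U : set 'rV[R]_N) phi : test_function U phi ->
  exists b, 0 < b /\ forall x, ~ centered_cube b x -> phi x = 0.
Proof.
move=> [_ [K [cK _ hK]]].
have [b [b0 Kb]] := bounded_sub_centered_cube (compact_bounded cK).
by exists b; split=> // x nx; apply: hK => /Kb.
Qed.

Lemma summable_bounded_support f b M : measurable_fun setT f -> 0 <= b ->
  (forall x, `|f x| <= M) -> (forall x, ~ centered_cube b x -> f x = 0) ->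
  summable_fun mu setT f.
Proof.
move=> mf b0 fM f0.
have h : summable_fun mu (centered_cube b) f.
  apply: measurable_bounded_integrable; [exact: measurable_centered_cube|exact: centered_cube_fin| |].
    exact: measurable_funTS.
  by exists M; split => [|M' MM' x _]; [exact: num_real|exact: le_trans (fM x) (ltW MM')].
have := (integrable_mkcond (EFin \o f) (measurable_centered_cube b)).1 h.
rewrite (_ : _ \_ _ = EFin \o f)//; apply/funext => x; rewrite patchE/=.
by case: ifPn => // /negP nx; rewrite f0// => hx; apply: nx; exact: mem_set.
Qed.

Lemma L2_bounded_support f b M : measurable_fun setT f -> 0 <= b ->
  (forall x, `|f x| <= M) -> (forall x, ~ centered_cube b x -> f x = 0) -> L2 mu setT f.
Proof.
move=> mf b0 fM f0; split=> //.
apply: (@summable_bounded_support _ b (M ^+ 2)) => //.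
- exact: measurable_funX.
- by move=> x; rewrite normrX lerXn2r// nnegrE//; exact: le_trans (fM x).
- by move=> x /f0 ->; rewrite expr0n.
Qed.

Lemma L2_test (U : set 'rV[R]_N) phi : test_function U phi -> L2 mu setT phi.
Proof.
move=> tp; have [b [b0 hb]] := test_support tp; have [M [_ hM]] := test_bounded tp.
by apply: (@L2_bounded_support _ b M) => //; [exact: test_measurable tp|exact: ltW].
Qed.

Lemma summable_test (U : set 'rV[R]_N) phi : test_function U phi -> summable_fun mu setT phi.
Proof.
move=> tp; have [b [b0 hb]] := test_support tp; have [M [_ hM]] := test_bounded tp.
by apply: (@summable_bounded_support _ b M) => //; [exact: test_measurable tp|exact: ltW].
Qed.

Lemma measurable_translate f z : measurable_fun setT f -> measurable_fun setT (fun x => f (x + z)).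
Proof. by move=> mf; exact: (measurableT_comp mf (measurable_rV_translation z)). Qed.

Lemma n2_translate f z : measurable_fun setT f ->
  n2 mu setT (fun x => f (x + z)) = n2 mu setT f.
Proof.
move=> mf; rewrite /n2 /Rintegral; congr fine.
apply: (integral_rV_translation z (f := fun x => (f x ^+ 2)%:E)).
  by apply/measurable_EFinP; exact: measurable_funX.
by move=> x; rewrite lee_fin sqr_ge0.
Qed.

Lemma summable_translate f z : summable_fun mu setT f -> summable_fun mu setT (fun x => f (x + z)).
Proof.
move=> sf; have mf := summable_meas sf; move: sf => /integrableP[_ sf].
apply/integrableP; split; first by apply/measurable_EFinP; exact: measurable_translate.
rewrite (integral_rV_translation z (f := fun x => (`|(f x)%:E|)%E))//.
by apply: measurableT_comp => //; exact/measurable_EFinP.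
Qed.

Lemma L2_translate f z : L2 mu setT f -> L2 mu setT (fun x => f (x + z)).
Proof.
move=> [mf sf]; split; first exact: measurable_translate.
exact: (summable_translate z sf).
Qed.

Lemma Rintegral_translate f z : summable_fun mu setT f ->
  Rintegral mu setT (fun x => f (x + z)) = Rintegral mu setT f.
Proof.
move=> sf; have mf := summable_meas sf.
rewrite /Rintegral; congr fine.
have mt := measurable_rV_translation z.
pose m_ : {measure set 'rV[R]_N -> \bar R} := pushforward mu (fun x => x + z).
pose m := m_ mt.
transitivity (\int[m]_x (f x)%:E)%E; last first.
  by apply: eq_measure_integral => A mA _; exact: lebesgue_rV_translation.
rewrite /m /m_ integral_pushforward//.
  exact/measurable_EFinP.
by rewrite preimage_setT; exact: (summable_translate z sf).
Qed.

Lemma norm_basis_coord s i (j : 'I_N) : `|(s *: basis_vec R i) ord0 j| <= `|s|.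
Proof.
rewrite /basis_vec !mxE eqxx /=; case: eqP => _; first by rewrite mulr1.
by rewrite mulr0 normr0.
Qed.

Definition diffq phi i s x : R := s^-1 * (phi (x + s *: basis_vec R i) - phi x).

Lemma measurable_diffq phi i s : measurable_fun setT phi -> measurable_fun setT (diffq phi i s).
Proof.
move=> mp; apply: measurable_funM; first exact: measurable_cst.
by apply: measurable_funB => //; exact: measurable_translate.
Qed.

Section one_test.
Variables (U : set 'rV[R]_N) (phi : 'rV[R]_N -> R) (i : 'I_N).
Hypothesis tp : test_function U phi.

(** The mean value theorem, along the line through [x]. *)
Lemma diffq_bound : exists L, 0 <= L /\ forall s x, `|diffq phi i s x| <= L.
Proof.
have [L [L0 HL]] := test_bounded (test_pderiv i tp); exists L; split=> // s x.
have key (r : R) (y : 'rV[R]_N) : 0 <= r -> `|phi (y + r *: basis_vec R i) - phi y| <= L * r.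
  move=> r0; pose g u := phi (u *: basis_vec R i + y).
  have dg (u : R) : is_derive u 1 g (pderiv i phi (u *: basis_vec R i + y)).
    by apply/is_derive_line; exact: smooth_is_derive (test_smooth tp).
  have [|c _] := @MVT_segment _ g (fun u => pderiv i phi (u *: basis_vec R i + y)) 0 r r0.
    by apply: continuous_subspaceT => u; exact: is_derive1_continuous (dg u).
  rewrite /g scale0r add0r [_ *: _ + y]addrC => ->.
  by rewrite subr0 normrM (ger0_norm r0) ler_wpM2r.
rewrite /diffq; have [->|s0] := eqVneq s 0; first by rewrite invr0 mul0r normr0.
rewrite normrM normfV mulrC ler_pdivrMr ?normr_gt0//.
have [sp|sn] := leP 0 s; first by rewrite (ger0_norm sp); exact: key.
have := key (- s) (x + s *: basis_vec R i).
rewrite scaleNr addrK oppr_ge0 (ltW sn) => /(_ isT).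
by rewrite distrC (ltr0_norm sn).
Qed.

Lemma diffq_support : exists b, 0 < b /\ forall r s x, `|s| <= r -> ~ centered_cube (b + r) x ->
  diffq phi i s x = 0 /\ pderiv i phi x = 0.
Proof.
have [b [b0 hb]] := test_support tp; have [b' [b'0 hb']] := test_support (test_pderiv i tp).
exists (b + b'); split; first exact: addr_gt0.
move=> r s x sr nx; have r0 : 0 <= r by exact: le_trans sr.
rewrite hb'; last first.
  move=> /centered_cubeP h; apply: nx; apply/centered_cubeP => j; have /andP[h1 h2] := h j.
  by apply/andP; split; lra.
split => //; rewrite /diffq !hb ?subrr ?mulr0//.
  move=> /centered_cubeP h; apply: nx; apply/centered_cubeP => j; have /andP[h1 h2] := h j.
  by apply/andP; split; lra.
move=> /centered_cubeP h; apply: nx; apply/centered_cubeP => j; have := h j; rewrite [(x + _) _ _]mxE.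
have := norm_basis_coord s i j; move: (_ ord0 j) => c /le_trans/(_ sr).
by rewrite ler_norml => /andP[h1 h2] /andP[h3 h4]; apply/andP; split; lra.
Qed.

Lemma diffq_cvg t x : t != 0 ->
  diffq phi i (t / n.+1%:R) x @[n --> \oo] --> pderiv i phi x.
Proof.
move=> t0; have [dp _] := smooth_is_derive i x (test_smooth tp).
have {}dp : (fun h => h^-1 *: ((phi \o shift x) (h *: basis_vec R i) - phi x)) @ 0^' -->
  pderiv i phi x := dp.
apply/cvgrPdist_le => e e0.
move/cvgrPdist_le : dp => /(_ e e0).
move=> /nbhs_ballP[d /= d0 hd].
have t0' : 0 < `|t| by rewrite normr_gt0.
have [|K HK] := @invS_le_eps R (d / (2 * `|t|)).
  by rewrite divr_gt0// mulr_gt0.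
exists K => // n /HK hn /=.
have s0 : t / n.+1%:R != 0 by rewrite mulf_neq0// invr_neq0// pnatr_eq0.
have := hd (t / n.+1%:R) _ s0; rewrite /= [_ + x]addrC; apply.
rewrite -ball_normE /ball_/= sub0r normrN normrM normfV (ger0_norm (ler0n _ _)).
rewrite mulrC -ltr_pdivlMr//; apply: le_lt_trans hn _.
by rewrite invfM mulrA ltr_pM2r ?invr_gt0// ltr_pdivrMr// mulrDr mulr1 ltrDl.
Qed.

End one_test.
End translations.

Section translation_estimates.
Context (R : realType) (N : nat) (U : set 'rV[R]_N).
Local Notation mu := (@lebesgue_rV R N).
Implicit Types (phi psi : 'rV[R]_N -> R) (x z : 'rV[R]_N) (i : 'I_N).
Let mT : measurable [set: 'rV[R]_N] := measurableT.

(** Difference quotients of a test function are bounded and supported in a common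
    cube, so that dominated convergence applies. *)
Lemma diffq_limits phi i (t : R) : test_function U phi -> t != 0 ->
  (Rintegral mu setT (diffq phi i (t / n.+1%:R)) @[n --> \oo] -->
     Rintegral mu setT (pderiv i phi)) /\
  (n2 mu setT (diffq phi i (t / n.+1%:R)) @[n --> \oo] --> n2 mu setT (pderiv i phi)).
Proof.
move=> tp t0; have [L [L0 HL]] := diffq_bound i tp.
have [b [b0 hb]] := diffq_support i tp.
have c0 : 0 <= b + `|t| by rewrite addr_ge0// ltW.
have mphi : measurable_fun setT phi by exact: test_measurable tp.
have md n : measurable_fun setT (diffq phi i (t / n.+1%:R)) by exact: measurable_diffq.
have mp : measurable_fun setT (pderiv i phi) by exact: test_measurable (test_pderiv i tp).
have tn n : `|t / n.+1%:R| <= `|t|.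
  by rewrite normrM normfV (ger0_norm (ler0n _ _)) ler_pdivrMr// ler_peMr// ler1n.
have sI (M : R) : summable_fun mu setT (fun x => M * \1_(centered_cube (b + `|t|)) x).
  apply: (@summable_bounded_support _ _ _ (b + `|t|) `|M|) => //.
  - apply: measurable_funM; first exact: measurable_cst.
    by apply: measurable_indic; exact: measurable_centered_cube.
  - move=> x; rewrite normrM ler_piMr// indicE.
    by case: (_ \in _); rewrite ?normr1 ?normr0.
  - by move=> x nx; rewrite indicE memNset ?mulr0.
have dom (n : nat) x (M : R) (F : R -> R) : F 0 = 0 -> (forall y, `|y| <= L -> `|F y| <= M) ->
    `|F (diffq phi i (t / n.+1%:R) x)| <= M * \1_(centered_cube (b + `|t|)) x.
  move=> F0 FM; rewrite indicE; case: (boolP (x \in _)) => [_|/negP nx].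
    by rewrite mulr1; apply: FM; exact: HL.
  have nx' : ~ centered_cube (b + `|t|) x by move=> h; apply: nx; exact: mem_set.
  by rewrite mulr0 (hb _ _ _ (tn n) nx').1 F0 normr0.
split.
  have [] := @Rintegral_dominated _ _ _ mu setT mT
    (fun n => diffq phi i (t / n.+1%:R)) (pderiv i phi)
    (fun x => L * \1_(centered_cube (b + `|t|)) x) md mp _ (sI L) => //.
    by apply: aeD_all => x _; exact: (@diffq_cvg _ _ U _ i tp).
  by move=> n; apply: aeD_all => x _; exact: (dom n x L id).
have [] := @Rintegral_dominated _ _ _ mu setT mT
    (fun n x => diffq phi i (t / n.+1%:R) x ^+ 2) (fun x => pderiv i phi x ^+ 2)
    (fun x => L ^+ 2 * \1_(centered_cube (b + `|t|)) x) _ _ _ (sI _) => //.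
- by move=> n; exact: measurable_funX.
- exact: measurable_funX.
- apply: aeD_all => x _; rewrite expr2; under eq_fun do rewrite expr2.
  by apply: cvgM; exact: (@diffq_cvg _ _ U _ i tp).
- move=> n; apply: aeD_all => x _; apply: (dom n x (L ^+ 2) (fun y => y ^+ 2)).
    by rewrite expr0n.
  by move=> y yL; rewrite normrX lerXn2r// nnegrE.
Qed.

(** By translation invariance the difference quotients have integral zero. *)
Lemma Rintegral_pderiv phi i : test_function U phi ->
  Rintegral mu setT (pderiv i phi) = 0.
Proof.
move=> tp; have [h _] := diffq_limits i tp (oner_neq0 R).
have sp := summable_test tp.
have e : (fun n => Rintegral mu setT (diffq phi i (1 / n.+1%:R))) = fun=> 0.
  apply/funext => n; rewrite Rintegral_scale//; last first.
    by apply: summableB => //; exact: summable_translate.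
  by rewrite Rintegral_sub ?Rintegral_translate// ?subrr ?mulr0//; exact: summable_translate.
by rewrite e in h; rewrite -(cvg_lim _ h)// lim_cst.
Qed.

(** Cutting the shift into [n + 1] equal steps bounds its norm by the norm of a
    difference quotient with a step as small as desired; this avoids integrating
    the derivative along the segment. *)
Lemma n2_shift_coord phi i (t : R) : test_function U phi ->
  n2 mu setT (fun x => phi (x + t *: basis_vec R i) - phi x) <=
  t ^+ 2 * n2 mu setT (pderiv i phi).
Proof.
move=> tp; have Lp := L2_test tp; have mp := L2_meas Lp.
have [->|t0] := eqVneq t 0.
  rewrite expr0n mul0r (_ : (fun x => _) = cst 0).
    by rewrite /n2 (_ : (fun x => _) = cst 0) ?Rintegral_zero//; apply/funext => x; rewrite expr0n.
  by apply/funext => x; rewrite scale0r addr0 subrr.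
have [_ h] := diffq_limits i tp t0.
have h2 : t ^+ 2 * n2 mu setT (diffq phi i (t / n.+1%:R)) @[n --> \oo] -->
    t ^+ 2 * n2 mu setT (pderiv i phi) by apply: cvgM => //; exact: cvg_cst.
rewrite -(cvg_lim _ h2)//; apply: limr_ge; first by apply/cvg_ex; eexists; exact: h2.
apply: nearW => n; set s := t / n.+1%:R.
pose w k := (k%:R * s) *: basis_vec R i.
pose D x := phi (x + s *: basis_vec R i) - phi x.
have LD : L2 mu setT D by apply: L2_sub => //; exact: L2_translate.
have s0 : s != 0 by rewrite mulf_neq0// invr_neq0// pnatr_eq0.
have n0 : n.+1%:R != 0 :> R by rewrite pnatr_eq0.
have eD : n2 mu setT (diffq phi i s) = (s^-1) ^+ 2 * n2 mu setT D by exact: (n2Z mT _ LD).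
have e : (fun x => phi (x + t *: basis_vec R i) - phi x) =
    fun x => \sum_(k < n.+1) D (x + w k).
  apply/funext => x; rewrite /D.
  rewrite (eq_bigr (fun k : 'I_n.+1 => phi (x + w k.+1) - phi (x + w k))); last first.
    move=> k _; congr (phi _ - _); rewrite -addrA -scalerDl; congr (_ + _ *: _).
    by rewrite -natr1 mulrDl mul1r addrC.
  rewrite -(big_mkord xpredT (fun k => phi (x + w k.+1) - phi (x + w k))) telescope_sumr//.
  congr (phi _ - phi _); first by rewrite /w /s mulrC divfK.
  by rewrite /w mul0r scale0r addr0.
rewrite e; apply: le_trans (n2_sum_le mT _) _; first by move=> k; exact: L2_translate.
rewrite (eq_bigr (fun _ => n2 mu setT D)); last first.
  by move=> k _; rewrite n2_translate//; exact: L2_meas LD.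
have key : t ^+ 2 * s^-1 ^+ 2 = n.+1%:R ^+ 2.
  by rewrite -exprMn /s invfM invrK mulrA divff// mul1r.
by rewrite sumr_const card_ord eD mulrA key -(mulr_natl (n2 mu setT D)) mulrA expr2.
Qed.

Definition dir2 phi : R := \sum_i n2 mu setT (pderiv i phi).

Lemma dir2_ge0 phi : 0 <= dir2 phi.
Proof. by apply: sumr_ge0 => i _; exact: n2_ge0. Qed.

(** Move one coordinate after the other. *)
Lemma n2_shift phi z (h : R) : test_function U phi -> (forall i, `|z ord0 i| <= h) ->
  n2 mu setT (fun x => phi (x + z) - phi x) <= N%:R * h ^+ 2 * dir2 phi.
Proof.
move=> tp zh; have Lp := L2_test tp; have mp := L2_meas Lp.
pose w (k : nat) : 'rV[R]_N := \row_j if (j < k)%N then z ord0 j else 0.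
pose D (i : 'I_N) x := phi (x + z ord0 i *: basis_vec R i) - phi x.
have LD i : L2 mu setT (D i) by apply: L2_sub => //; exact: L2_translate.
have e : (fun x => phi (x + z) - phi x) = fun x => \sum_(i < N) D i (x + w i).
  apply/funext => x; rewrite /D.
  rewrite (eq_bigr (fun k : 'I_N => phi (x + w k.+1) - phi (x + w k))); last first.
    move=> k _; congr (phi _ - _); rewrite -addrA; congr (_ + _).
    apply/rowP => j; rewrite !mxE eqxx /= ltnS (leq_eqVlt j).
    have [->|jk] := eqVneq j k.
      by rewrite ltnn eqxx mulr1 add0r.
    by rewrite -val_eqE /= in jk; rewrite (negbTE jk) mulr0 addr0.
  rewrite -(big_mkord xpredT (fun k => phi (x + w k.+1) - phi (x + w k))) telescope_sumr//.
  congr (phi _ - phi _).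
    by congr (_ + _); apply/rowP => j; rewrite mxE ltn_ord.
  by rewrite -[LHS]addr0; congr (_ + _); apply/rowP => j; rewrite !mxE.
rewrite e; apply: le_trans (n2_sum_le mT _) _; first by move=> k; exact: L2_translate.
rewrite -mulrA ler_wpM2l// /dir2 mulr_sumr; apply: ler_sum => i _.
rewrite n2_translate; last exact: L2_meas (LD i).
apply: le_trans (n2_shift_coord i _ tp) _.
rewrite ler_wpM2r ?n2_ge0// -sqr_normr lerXn2r ?nnegrE//.
exact: le_trans (zh i).
Qed.

Lemma n2_restrict phi : (forall x, ~ U x -> phi x = 0) -> n2 mu U phi = n2 mu setT phi.
Proof.
move=> h; rewrite /n2 Rintegral_mkcond; congr Rintegral; apply/funext => x.
rewrite patchE; case: ifPn => // /negP nx; rewrite h ?expr0n// => Ux.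
by apply: nx; exact: mem_set.
Qed.

Lemma Rintegral_restrict phi : (forall x, ~ U x -> phi x = 0) ->
  Rintegral mu U phi = Rintegral mu setT phi.
Proof.
move=> h; rewrite Rintegral_mkcond; congr Rintegral; apply/funext => x.
rewrite patchE; case: ifPn => // /negP nx; rewrite h// => Ux.
by apply: nx; exact: mem_set.
Qed.

Lemma integration_by_parts phi psi i : test_function U phi -> test_function U psi ->
  Rintegral mu U (fun x => phi x * pderiv i psi x) =
  - Rintegral mu U (fun x => pderiv i phi x * psi x).
Proof.
move=> tp tq; have := Rintegral_pderiv i (test_mul tp (test_smooth tq)).
rewrite (pderivM i (test_smooth tp) (test_smooth tq)).
have tdp := test_pderiv i tp; have tdq := test_pderiv i tq.
rewrite Rintegral_add//; last 2 first.
- by apply: L2_mul => //; [exact: L2_test tp|exact: L2_test tdq].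
- by apply: L2_mul => //; [exact: L2_test tq|exact: L2_test tdp].
move=> /eqP; rewrite addr_eq0 => /eqP e.
rewrite (Rintegral_restrict (phi := fun x => phi x * pderiv i psi x)); last first.
  by move=> x nx; rewrite (test_out tp nx) mul0r.
rewrite (Rintegral_restrict (phi := fun x => pderiv i phi x * psi x)); last first.
  by move=> x nx; rewrite (test_out tdp nx) mul0r.
by rewrite e; congr (- Rintegral _ _ _); apply/funext => x; rewrite mulrC.
Qed.

End translation_estimates.

(** * The Sobolev space of functions vanishing on the boundary *)

Section Lnorm_bridge.
Context (R : realType) (N : nat) (U : set 'rV[R]_N).
Hypothesis mU : measurable U.
Local Notation mu := (@lebesgue_rV R N).
Implicit Types (u v : 'rV[R]_N -> R).

Lemma Lnorm2_restrict u : L2 mu U u ->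
  Lnorm mu 2%:E (EFin \o (u \_ U)) = (Num.sqrt (n2 mu U u))%:E.
Proof.
move=> [mf sf]; rewrite unlock /=.
rewrite (_ : (\int[mu]_x _)%E = (n2 mu U u)%:E); first by rewrite poweR_EFin powR12_sqrt// n2_ge0.
rewrite RintegralE// integral_mkcond; apply: eq_integral => x _.
rewrite !patchE; case: ifP => _ /=; first by rewrite powR_mulrn// sqr_normr.
by rewrite normr0 powR_mulrn// expr0n.
Qed.

Lemma inLp2P u : inLp U 2%:E u <-> L2 mu U u.
Proof.
split => [h|[mf sf]]; last first.
  rewrite /inLp inE; apply/andP; split; rewrite inE/=.
    exact: (measurable_restrictT _ mU).1.
  by rewrite /finite_norm Lnorm2_restrict ?ltry.
have mf : measurable_fun U u.
  by apply/(measurable_restrictT _ mU); move: h; rewrite /inLp inE => /andP[]; rewrite inE.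
split=> //; have := Lfun2_integrable_sqr h.
move=> hs; apply/(integrable_mkcond _ mU); move: hs.
by rewrite (_ : EFin \o _ = (EFin \o (fun x => u x ^+ 2)) \_ U)//; apply/funext => x /=;
  rewrite !patchE; case: ifP => //= _; rewrite expr0n.
Qed.

Lemma cvgL2P (u_ : nat -> 'rV[R]_N -> R) u : (forall n, L2 mu U (u_ n)) -> L2 mu U u ->
  cvgL2 U u_ u <-> cvg2 mu U u_ u.
Proof.
move=> hu_ hu; rewrite /cvgL2 /cvg2.
have e k : Lnorm mu 2%:E (EFin \o ((u_ k \- u) \_ U)) =
    (Num.sqrt (n2 mu U (fun x => u_ k x - u x)))%:E.
  by rewrite Lnorm2_restrict//; exact: L2_sub.
rewrite (funext e); split => h.
  have {}h : Num.sqrt (n2 mu U (fun x => u_ k x - u x)) @[k --> \oo] --> 0 by exact: fine_cvg h.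
  have e2 : (fun k => n2 mu U (fun x => u_ k x - u x)) =
      (fun k => Num.sqrt (n2 mu U (fun x => u_ k x - u x)) *
                Num.sqrt (n2 mu U (fun x => u_ k x - u x))).
    by apply/funext => k; rewrite -expr2 sqr_sqrtr// n2_ge0.
  by rewrite e2 -(mulr0 0); apply: cvgM.
apply/fine_cvgP; split; first exact: nearW.
apply/(cvg0_epsP (fun n => sqrtr_ge0 _)) => r r0 /=.
have [K HK] := (cvg0_epsP (fun n => n2_ge0 _ _ _)).1 h _ (exprn_gt0 2 r0).
exists K => n /HK hn; rewrite -(ger0_norm (ltW r0)) -sqrtr_sqr.
exact: ler_wsqrtr.
Qed.

End Lnorm_bridge.

Section sobolev_space.
Context (R : realType) (N : nat) (U : set 'rV[R]_N).
Hypotheses (oU : open U) (bU : bounded_set U).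
Local Notation mu := (@lebesgue_rV R N).
Implicit Types (u v w : 'rV[R]_N -> R) (G : 'rV[R]_N -> 'rV[R]_N) (i : 'I_N).

Lemma domain_measurable : measurable U. Proof. exact: rV_open_measurable. Qed.
Let mU := domain_measurable.

Lemma domain_fin : (mu U < +oo)%E.
Proof.
have [b [b0 Ub]] := bounded_sub_centered_cube bU.
apply: le_lt_trans (centered_cube_fin N (ltW b0)); apply: le_measure => //; rewrite inE//.
exact: measurable_centered_cube.
Qed.

Lemma L2_cst c : L2 mu U (cst c).
Proof.
split; first exact: measurable_cst.
apply: measurable_bounded_integrable; [exact: mU|exact: domain_fin| |].
  by apply: measurable_funX; exact: measurable_cst.
by exists `|c ^+ 2|; split=> [|M hM x _]; [exact: num_real|exact: ltW].
Qed.

Lemma L2_summable u : L2 mu U u -> summable_fun mu U u.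
Proof.
move=> hu; have := L2_mul mU hu (L2_cst 1).
by rewrite (_ : (fun x => _) = u)//; apply/funext => x; rewrite mulr1.
Qed.

Lemma test_L2 phi : test_function U phi -> L2 mu U phi.
Proof.
move=> tp; have [mp sp] := L2_test tp; split; first exact: measurable_funTS.
exact: (integrableS measurableT mU (@subsetT _ _) sp).
Qed.

Lemma is_wgradP u G : L2 mu U u -> (forall i, L2 mu U (fun x => G x ord0 i)) ->
  is_wgrad U u G <-> forall i phi, test_function U phi ->
    ip mu U u (pderiv i phi) = - ip mu U (fun x => G x ord0 i) phi.
Proof.
move=> hu hG; split => h.
  move=> i phi tp; have [_ /(_ phi tp)] := h i.
  rewrite -!RintegralE//; last 2 first.
  - by apply: L2_mul => //; exact: test_L2.
  - by apply: L2_mul => //; apply: test_L2; exact: test_pderiv.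
  by rewrite -EFinN => -[].
move=> i; split; first exact/inLp2P.
move=> phi tp; rewrite -!RintegralE//; last 2 first.
- by apply: L2_mul => //; exact: test_L2.
- by apply: L2_mul => //; apply: test_L2; exact: test_pderiv.
by rewrite -EFinN; congr EFin; exact: h.
Qed.

Lemma is_wgrad_L2 u G i : is_wgrad U u G -> L2 mu U (fun x => G x ord0 i).
Proof. by move=> h; apply/(inLp2P mU); exact: (h i).1. Qed.

(** Two weak gradients pair equally with all test functions. *)
Lemma wgrad_unique u G G' i : L2 mu U u -> is_wgrad U u G -> is_wgrad U u G' ->
  aeD mu U (fun x => G x ord0 i = G' x ord0 i).
Proof.
move=> hu hG hG'; have LG j := is_wgrad_L2 j hG; have LG' j := is_wgrad_L2 j hG'.
have LD : L2 mu U (fun x => G x ord0 i - G' x ord0 i) by exact: L2_sub.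
have := @test_dense _ _ _ oU _ (L2_summable LD).
move=> H; have : aeD mu U (fun x => G x ord0 i - G' x ord0 i = 0).
  apply: H => phi tp; have Lp := test_L2 tp.
  rewrite -[LHS]/(ip mu U _ _) ipBl//; apply/eqP; rewrite subr_eq0; apply/eqP.
  have := (is_wgradP hu LG).1 hG i phi tp; have := (is_wgradP hu LG').1 hG' i phi tp.
  by move=> -> /eqP; rewrite eqr_opp => /eqP.
by apply: aeDW => x _ /eqP; rewrite subr_eq0 => /eqP.
Qed.

(** Membership in the closure of the test functions, with an explicit
    gradient in place of the one chosen by [wgrad]. *)
Definition h10 u G : Prop := [/\ L2 mu U u, forall i, L2 mu U (fun x => G x ord0 i)
  & exists phi_ : nat -> 'rV[R]_N -> R, [/\ forall k, test_function U (phi_ k),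
     cvg2 mu U phi_ u & forall i, cvg2 mu U (fun k => pderiv i (phi_ k)) (fun x => G x ord0 i)]].

Lemma h10_is_wgrad u G : h10 u G -> is_wgrad U u G.
Proof.
move=> [hu hG [phi_ [tp cu cG]]]; apply/is_wgradP => // i psi tq.
have Lp k := test_L2 (tp k); have Ldp k := test_L2 (test_pderiv i (tp k)).
have Lq := test_L2 tq; have Ldq := test_L2 (test_pderiv i tq).
have h1 := cvg2_ip mU Lp hu (fun=> Ldq) Ldq cu (cvg2_cst _ _ _).
have h2 := cvg2_ip mU Ldp (hG i) (fun=> Lq) Lq (cG i) (cvg2_cst _ _ _).
have e : (fun n => ip mu U (phi_ n) (pderiv i psi)) = (fun n => - ip mu U (pderiv i (phi_ n)) psi).
  by apply/funext => n; exact: integration_by_parts.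
rewrite e in h1.
have h3 : - ip mu U (pderiv i (phi_ n)) psi @[n --> \oo] --> - ip mu U (fun x => G x ord0 i) psi.
  exact: cvgN h2.
by rewrite -(cvg_lim _ h1)// -(cvg_lim _ h3).
Qed.

Definition gr u i : 'rV[R]_N -> R := fun x => wgrad U u x ord0 i.

Lemma H10_L2 u : H10 U u -> L2 mu U u.
Proof. by move=> [[h _] _]; exact/inLp2P. Qed.

Lemma H10_is_wgrad u : H10 U u -> is_wgrad U u (wgrad U u).
Proof. by move=> [[_ [G hG]] _]; rewrite /wgrad; apply: getPex; exists G. Qed.

Lemma gr_L2 u i : H10 U u -> L2 mu U (gr u i).
Proof. by move=> h; exact: is_wgrad_L2 (H10_is_wgrad h). Qed.

Lemma H10_h10 u : H10 U u -> h10 u (wgrad U u).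
Proof.
move=> h; have Lu := H10_L2 h; have Lg i := gr_L2 i h.
split=> //; have [_ [phi_ [tp cu cG]]] := h; exists phi_; split=> //.
  by apply/(cvgL2P mU) => // n; exact: test_L2.
move=> i; apply/(cvgL2P mU) => //; first by move=> n; apply: test_L2; exact: test_pderiv.
exact: Lg.
Qed.

(** Every approximable pair carries a weak gradient, and weak gradients are unique, so
    that the one chosen by [wgrad] may be replaced by the explicit one. *)
Lemma h10_H10 u G : h10 u G -> H10 U u /\ forall i, aeD mu U (fun x => gr u i x = G x ord0 i).
Proof.
move=> h; have hw := h10_is_wgrad h; have [hu hG [phi_ [tp cu cG]]] := h.
have H1u : H1 U u by split; [exact/inLp2P|exists G].
have hw' : is_wgrad U u (wgrad U u) by rewrite /wgrad; apply: getPex; exists G.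
have ae i : aeD mu U (fun x => gr u i x = G x ord0 i) by exact: wgrad_unique hu hw' hw.
split=> //; split=> //; exists phi_; split=> //.
  by apply/(cvgL2P mU) => // n; exact: test_L2.
have Lw i := is_wgrad_L2 i hw'.
have Ld i n : L2 mu U (pderiv i (phi_ n)) by apply: test_L2; exact: test_pderiv.
move=> i; apply/(cvgL2P mU) => //.
rewrite /cvg2 (_ : (fun n => _) = fun n => n2 mu U (fun x => pderiv i (phi_ n) x - G x ord0 i)).
  exact: cG.
apply/funext => n; apply: n2_ae_eq => //.
- exact: L2_meas (L2_sub mU (Ld i n) (Lw i)).
- exact: L2_meas (L2_sub mU (Ld i n) (hG i)).
- by apply: aeDW (ae i) => x _; rewrite /gr => ->.
Qed.

Lemma h10_add u v G G' : h10 u G -> h10 v G' -> h10 (fun x => u x + v x) (fun x => G x + G' x).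
Proof.
move=> [hu hG [p [tp pu pG]]] [hv hG' [q [tq qv qG]]]; split.
- exact: L2_add.
- by move=> i; under eq_fun do rewrite mxE; exact: L2_add.
exists (fun k x => p k x + q k x); split.
- by move=> k; exact: test_add.
- by apply: cvg2D => // n; exact: test_L2.
move=> i; under [X in cvg2 _ _ _ X]eq_fun do rewrite mxE.
under eq_fun do rewrite (pderivD i (test_smooth (tp _)) (test_smooth (tq _))).
by apply: cvg2D => // n; apply: test_L2; exact: test_pderiv.
Qed.

Lemma h10_scale c u G : h10 u G -> h10 (fun x => c * u x) (fun x => c *: G x).
Proof.
move=> [hu hG [p [tp pu pG]]]; split.
- exact: L2_scale.
- by move=> i; under eq_fun do rewrite mxE; exact: L2_scale.
exists (fun k x => c * p k x); split.
- by move=> k; exact: test_scale.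
- by apply: cvg2Z => // n; exact: test_L2.
move=> i; under [X in cvg2 _ _ _ X]eq_fun do rewrite mxE.
have e k : pderiv i (fun x => c * p k x) = fun x => c * pderiv i (p k) x.
  rewrite (pderivM i (fun k => Ck_cst N k c) (test_smooth (tp k))) pderiv_cst.
  by apply/funext => x; rewrite mulr0 addr0.
under eq_fun do rewrite e.
by apply: cvg2Z => // n; apply: test_L2; exact: test_pderiv.
Qed.

Lemma h10_test phi : test_function U phi -> h10 phi (fun x => \row_i pderiv i phi x).
Proof.
move=> tp; split; first exact: test_L2.
  by move=> i; under eq_fun do rewrite mxE; apply: test_L2; exact: test_pderiv.
exists (fun=> phi); split=> //; first exact: cvg2_cst.
by move=> i; under [X in cvg2 _ _ _ X]eq_fun do rewrite mxE; exact: cvg2_cst.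
Qed.

End sobolev_space.

(** * Chain rule, products, limits and the Poincare inequality *)

Lemma lipschitz_of_derivative (R : realType) (h h' : R -> R) (C : R) :
  (forall t : R, is_derive t 1 h (h' t)) -> (forall t, `|h' t| <= C) ->
  forall a b, `|h a - h b| <= C * `|a - b|.
Proof.
move=> dh hC; have key a b : b <= a -> `|h a - h b| <= C * `|a - b|.
  move=> ba; have [|c _ ->] := @MVT_segment _ h h' b a ba (fun x _ => dh x).
    by apply: continuous_subspaceT => u; exact: is_derive1_continuous (dh u).
  by rewrite normrM ler_wpM2r.
move=> a b; have [ab|ba] := leP b a; first exact: key.
by rewrite distrC [X in _ * X]distrC; exact: key (ltW ba).
Qed.

Lemma cvg_ord_sum (R : realType) n (a : 'I_n -> nat -> R) (l : 'I_n -> R) :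
  (forall i, a i k @[k --> \oo] --> l i) ->
  \sum_i a i k @[k --> \oo] --> \sum_i l i.
Proof.
move=> h; elim: (index_enum 'I_n) => [|i s ih].
  rewrite big_nil (_ : (fun k => _) = fun=> 0); first exact: cvg_cst.
  by apply/funext => k; rewrite big_nil.
rewrite big_cons (_ : (fun k => _) = fun k => a i k + \sum_(j <- s) a j k); last first.
  by apply/funext => k; rewrite big_cons.
by apply: cvgD.
Qed.

Lemma cvg_add0 (R : realType) n (a : nat -> R) (b : 'I_n -> nat -> R) :
  a k @[k --> \oo] --> 0 -> (forall i, b i k @[k --> \oo] --> 0) ->
  a k + \sum_i b i k @[k --> \oo] --> 0.
Proof.
move=> ha hb; suff : a k + \sum_i b i k @[k --> \oo] --> (0 : R) + \sum_(i < n) 0.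
  by rewrite big1_eq addr0.
by apply: cvgD => //; exact: cvg_ord_sum.
Qed.

Section sobolev_calculus.
Context (R : realType) (N : nat) (U : set 'rV[R]_N).
Hypotheses (oU : open U) (bU : bounded_set U).
Local Notation mu := (@lebesgue_rV R N).
Implicit Types (u v w : 'rV[R]_N -> R) (G : 'rV[R]_N -> 'rV[R]_N) (i : 'I_N).
Let mU := domain_measurable oU.
Let tL2 phi := @test_L2 R N U oU phi.

Lemma L2_mul_bounded (b f : 'rV[R]_N -> R) M : measurable_fun U b ->
  (forall x, `|b x| <= M) -> L2 mu U f -> L2 mu U (fun x => b x * f x).
Proof.
move=> mb bM hf; apply: (L2_le mU _ _ (L2_scale mU M hf)).
  by apply: measurable_funM => //; exact: L2_meas hf.
apply: aeD_all => x _; rewrite !normrM ler_wpM2r//.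
by rewrite (le_trans (bM x))// ler_norm.
Qed.

Lemma n2_mul_bounded (b f : 'rV[R]_N -> R) M : measurable_fun U b ->
  (forall x, `|b x| <= M) -> L2 mu U f -> n2 mu U (fun x => b x * f x) <= M ^+ 2 * n2 mu U f.
Proof.
move=> mb bM hf; rewrite -n2Z//; apply: n2_le => //.
- by apply: measurable_funM => //; exact: L2_meas hf.
- exact: L2_scale.
- apply: aeD_all => x _; rewrite !normrM ler_wpM2r//.
  by rewrite (le_trans (bM x))// ler_norm.
Qed.

Lemma h10_approx u G e : h10 U u G -> 0 < e -> exists phi, [/\ test_function U phi,
  n2 mu U (fun x => phi x - u x) <= e &
  forall i, n2 mu U (fun x => pderiv i phi x - G x ord0 i) <= e].
Proof.
move=> [hu hG [p [tp pu pG]]] e0.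
pose a k := n2 mu U (fun x => p k x - u x) +
  \sum_i n2 mu U (fun x => pderiv i (p k) x - G x ord0 i).
have a0 k : 0 <= a k by rewrite addr_ge0 ?n2_ge0// sumr_ge0// => i _; exact: n2_ge0.
have ca : a k @[k --> \oo] --> 0.
  by apply: cvg_add0 => // i; exact: pG.
have [K HK] := (cvg0_epsP a0).1 ca e e0; have := HK K (leqnn K) => aK.
exists (p K); split=> // [|i].
  by apply: le_trans aK; rewrite lerDl sumr_ge0// => i _; exact: n2_ge0.
apply: le_trans aK; rewrite ler_wpDl ?n2_ge0// (bigD1 i)//= lerDl sumr_ge0// => j _.
exact: n2_ge0.
Qed.

Lemma h10_of_approx u G : L2 mu U u -> (forall i, L2 mu U (fun x => G x ord0 i)) ->
  (forall e, 0 < e -> exists phi, [/\ test_function U phi,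
    n2 mu U (fun x => phi x - u x) <= e &
    forall i, n2 mu U (fun x => pderiv i phi x - G x ord0 i) <= e]) -> h10 U u G.
Proof.
move=> hu hG h; split=> //.
have {}h k : exists phi, [/\ test_function U phi,
    n2 mu U (fun x => phi x - u x) <= k.+1%:R^-1 &
    forall i, n2 mu U (fun x => pderiv i phi x - G x ord0 i) <= k.+1%:R^-1].
  by apply: h; rewrite invr_gt0.
have [p hp] := choice h; exists p; split.
- by move=> k; have [] := hp k.
- apply: (@cvg0_squeeze _ _ (fun k => k.+1%:R^-1)); last exact: cvg_harmonic.
  by move=> n; rewrite n2_ge0; have [] := hp n.
- move=> i; apply: (@cvg0_squeeze _ _ (fun k => k.+1%:R^-1)); last exact: cvg_harmonic.
  by move=> n; rewrite n2_ge0; have [_ _ /(_ i)] := hp n.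
Qed.

(** A diagonal choice of test functions. *)
Lemma h10_closed (u_ : nat -> 'rV[R]_N -> R) (G_ : nat -> 'rV[R]_N -> 'rV[R]_N) u G :
  (forall n, h10 U (u_ n) (G_ n)) -> L2 mu U u -> (forall i, L2 mu U (fun x => G x ord0 i)) ->
  cvg2 mu U u_ u -> (forall i, cvg2 mu U (fun n x => G_ n x ord0 i) (fun x => G x ord0 i)) ->
  h10 U u G.
Proof.
move=> hn hu hG cu cG; apply: h10_of_approx => // e e0.
have e4 : 0 < e / 4 by rewrite divr_gt0.
pose a k := n2 mu U (fun x => u_ k x - u x) +
  \sum_i n2 mu U (fun x => G_ k x ord0 i - G x ord0 i).
have a0 k : 0 <= a k by rewrite addr_ge0 ?n2_ge0// sumr_ge0// => i _; exact: n2_ge0.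
have ca : a k @[k --> \oo] --> 0.
  by apply: cvg_add0 => // i; exact: cG.
have [K HK] := (cvg0_epsP a0).1 ca _ e4; have aK := HK K (leqnn K).
have [huK hGK _] := hn K.
have [phi [tp pu pG]] := h10_approx (hn K) e4; exists phi; split=> // [|i].
- apply: le_trans (n2B_le mU (tL2 tp) hu huK) _.
  suff : n2 mu U (fun x => u_ K x - u x) <= e / 4 by lra.
  by apply: le_trans aK; rewrite lerDl sumr_ge0// => i _; exact: n2_ge0.
- apply: le_trans (n2B_le mU (tL2 (test_pderiv i tp)) (hG i) (hGK i)) _.
  suff : n2 mu U (fun x => G_ K x ord0 i - G x ord0 i) <= e / 4 by have := pG i; lra.
  apply: le_trans aK; rewrite ler_wpDl ?n2_ge0// (bigD1 i)//= lerDl sumr_ge0// => j _.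
  exact: n2_ge0.
Qed.

(** Compose the approximating test functions with [h]. The gradients contain
    [h' (phi)], which converges almost everywhere along a subsequence for which
    [phi] does; as [h'] is bounded, its product with the limit gradient converges
    by dominated convergence. *)
Lemma h10_comp u G (h h' : R -> R) C : smooth1 h -> h 0 = 0 ->
  (forall t : R, is_derive t 1 h (h' t)) -> continuous h' -> (forall t, `|h' t| <= C) ->
  h10 U u G -> h10 U (fun x => h (u x)) (fun x => h' (u x) *: G x).
Proof.
move=> sh h0 dh ch' hC [hu hG [p [tp pu pG]]].
have lip := lipschitz_of_derivative dh hC.
have mh' : measurable_fun setT h' by exact: continuous_measurable_fun.
have mh : measurable_fun setT h.
  by apply: continuous_measurable_fun => t; exact: is_derive1_continuous (dh t).
have mcomp (g : R -> R) v : measurable_fun setT g -> L2 mu U v ->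
  measurable_fun U (fun x => g (v x)).
  by move=> mg hv; exact: (measurableT_comp mg (L2_meas hv)).
have hhu : L2 mu U (fun x => h (u x)).
  apply: (L2_le mU _ _ (L2_scale mU C hu)); first exact: mcomp.
  apply: aeD_all => x _; have := lip (u x) 0; rewrite h0 !subr0 => /le_trans; apply.
  by rewrite normrM ler_wpM2r// ler_norm.
have hhG i : L2 mu U (fun x => (h' (u x) *: G x) ord0 i).
  under eq_fun do rewrite mxE.
  by apply: (@L2_mul_bounded _ _ C) => //; exact: mcomp.
split=> //.
have [s [ks cs]] := cvg2_ae_subseq mU (fun n => tL2 (tp n)) hu pu.
exists (fun k x => h (p (s k) x)); split.
- by move=> k; exact: test_comp.
- apply: (@cvg0_squeeze _ _ (fun k => C ^+ 2 * n2 mu U (fun x => p (s k) x - u x))).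
    move=> k; rewrite n2_ge0/= -n2Z//; last by apply: L2_sub => //; exact: tL2.
    apply: n2_le => //.
    - apply: measurable_funB; last exact: mcomp.
      by apply: mcomp => //; exact: tL2.
    - by apply: L2_scale => //; apply: L2_sub => //; exact: tL2.
    - apply: aeD_all => x _; apply: le_trans (lip _ _) _.
      by rewrite normrM ler_wpM2r// ler_norm.
  rewrite -(mulr0 (C ^+ 2)); apply: cvgM; first exact: cvg_cst.
  exact: (cvg2_sub ks pu).
move=> i; under [X in cvg2 _ _ _ X]eq_fun do rewrite mxE.
under eq_fun do rewrite (pderiv_comp i (test_smooth (tp _)) dh).
have Lq k := tL2 (tp (s k)); have Ldq k := tL2 (test_pderiv i (tp (s k))).
have mhq k : measurable_fun U (fun x => h' (p (s k) x)) by exact: mcomp.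
have mhu : measurable_fun U (fun x => h' (u x)) by exact: mcomp.
have LB k : L2 mu U (fun x => pderiv i (p (s k)) x - G x ord0 i) by exact: L2_sub.
pose d k x := (h' (p (s k) x) - h' (u x)) * G x ord0 i.
have md k : measurable_fun U (fun x => h' (p (s k) x) - h' (u x)) by exact: measurable_funB.
have bd k x : `|h' (p (s k) x) - h' (u x)| <= 2 * C.
  apply: le_trans (ler_normB _ _) _; rewrite mulrDl mul1r.
  by rewrite lerD.
have Ld k : L2 mu U (d k) by apply: (@L2_mul_bounded _ _ (2 * C)).
apply: (@cvg0_squeeze _ _ (fun k => 2 * (C ^+ 2 * n2 mu U (fun x => pderiv i (p (s k)) x - G x ord0 i))
    + 2 * n2 mu U (d k))).
  move=> k; rewrite n2_ge0/=.
  have L1 : L2 mu U (fun x => h' (p (s k) x) * (pderiv i (p (s k)) x - G x ord0 i)).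
    exact: (@L2_mul_bounded _ _ C).
  have := n2D_le mU L1 (Ld k); rewrite (_ : (fun x => _ + d k x) =
     fun x => h' (p (s k) x) * pderiv i (p (s k)) x - h' (u x) * G x ord0 i); last first.
    by apply/funext => x; rewrite /d; ring.
  move=> /le_trans; apply; rewrite lerD2r ler_wpM2l//.
  exact: n2_mul_bounded.
have c1 : n2 mu U (fun x => pderiv i (p (s k)) x - G x ord0 i) @[k --> \oo] --> 0.
  exact: (cvg2_sub ks (pG i)).
have c2 : n2 mu U (d k) @[k --> \oo] --> 0.
  have [] := @Rintegral_dominated _ _ _ mu U mU (fun k x => d k x ^+ 2) (cst 0)
    (fun x => (2 * C) ^+ 2 * G x ord0 i ^+ 2).
  - by move=> k; apply: measurable_funX; exact: L2_meas (Ld k).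
  - exact: measurable_cst.
  - apply: aeDW cs => x _ hx.
    have : h' (p (s k) x) @[k --> \oo] --> h' (u x) by exact: continuous_cvg (ch' _) hx.
    move=> hh; have e0 : (cst 0 x : R) = (h' (u x) - h' (u x)) * G x ord0 i *
        ((h' (u x) - h' (u x)) * G x ord0 i) by rewrite subrr !mul0r.
    rewrite e0; under eq_fun do rewrite expr2.
    have c : d k x @[k --> \oo] --> (h' (u x) - h' (u x)) * G x ord0 i.
      by apply: cvgM; [apply: cvgB => //|]; exact: cvg_cst.
    by apply: cvgM.
  - by apply: summableZ => //; exact: (hG i).2.
  - move=> k; apply: aeD_all => x _; rewrite /d exprMn normrM !normrX.
    rewrite -!(sqr_normr (G x ord0 i)) ler_wpM2r ?sqr_ge0//.
    by rewrite lerXn2r// nnegrE// (le_trans _ (bd k x)).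
  by move=> _; rewrite Rintegral_zero.
rewrite -[0 in X in _ --> X](_ : 2 * (C ^+ 2 * 0) + 2 * 0 = 0 :> R); last by rewrite !mulr0 addr0.
apply: cvgD; first by apply: cvgM; [exact: cvg_cst|apply: cvgM => //; exact: cvg_cst].
by apply: cvgM => //; exact: cvg_cst.
Qed.

Lemma h10_mul_test psi u G : test_function U psi -> h10 U u G ->
  h10 U (fun x => psi x * u x) (fun x => psi x *: G x + u x *: (\row_i pderiv i psi x)).
Proof.
move=> tq [hu hG [p [tp pu pG]]].
have [M [M0 hM]] := test_bounded tq.
have mq : measurable_fun U psi by exact: test_measurable tq.
have mdq i : measurable_fun U (pderiv i psi) by exact: test_measurable (test_pderiv i tq).
have e i x : (psi x *: G x + u x *: (\row_i pderiv i psi x)) ord0 i =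
    psi x * G x ord0 i + pderiv i psi x * u x by rewrite !mxE [u x * _]mulrC.
have cvg2_mulb (b : 'rV[R]_N -> R) B (f_ : nat -> 'rV[R]_N -> R) f : measurable_fun U b ->
    (forall x, `|b x| <= B) -> (forall n, L2 mu U (f_ n)) -> L2 mu U f -> cvg2 mu U f_ f ->
    cvg2 mu U (fun n x => b x * f_ n x) (fun x => b x * f x).
  move=> mb bB hf_ hf cf.
  apply: (@cvg0_squeeze _ _ (fun k => B ^+ 2 * n2 mu U (fun x => f_ k x - f x))).
    move=> n; rewrite n2_ge0/=.
    rewrite (_ : (fun x => _ - _) = fun x => b x * (f_ n x - f x)).
      by apply: n2_mul_bounded => //; exact: L2_sub.
    by apply/funext => x; rewrite mulrBr.
  by rewrite -(mulr0 (B ^+ 2)); apply: cvgM => //; exact: cvg_cst.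
have Lp k := tL2 (tp k); have Ldp i k := tL2 (test_pderiv i (tp k)).
split.
- exact: (L2_mul_bounded mq hM).
- move=> i; under eq_fun do rewrite e; have [B [_ hB]] := test_bounded (test_pderiv i tq).
  apply: L2_add => //; first exact: (L2_mul_bounded mq hM).
  exact: (L2_mul_bounded (mdq i) hB).
exists (fun k x => psi x * p k x); split.
- by move=> k; apply: test_mul => //; exact: test_smooth (tp k).
- exact: (cvg2_mulb _ M).
move=> i; under [X in cvg2 _ _ _ X]eq_fun do rewrite e.
have [B [_ hB]] := test_bounded (test_pderiv i tq).
have e2 k : pderiv i (fun x => psi x * p k x) =
    fun x => psi x * pderiv i (p k) x + pderiv i psi x * p k x.
  rewrite (pderivM i (test_smooth tq) (test_smooth (tp k))).
  by apply/funext => x; rewrite [p k x * _]mulrC.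
under eq_fun do rewrite e2.
apply: cvg2D => //.
- by move=> n; exact: (L2_mul_bounded mq hM).
- exact: (L2_mul_bounded mq hM).
- by move=> n; exact: (L2_mul_bounded (mdq i) hB).
- exact: (L2_mul_bounded (mdq i) hB).
- exact: (cvg2_mulb _ M).
- exact: (cvg2_mulb _ B).
Qed.

(** A translation by the width of a cube containing [U] moves a test function off
    its support, so the estimate of translations bounds the function itself. *)
Lemma poincare : (0 < N)%N -> exists C, 0 < C /\
  forall u G, h10 U u G -> n2 mu U u <= C * \sum_i n2 mu U (fun x => G x ord0 i).
Proof.
move=> N0; have [b [b0 Ub]] := bounded_sub_centered_cube bU.
exists (N%:R * (2 * b) ^+ 2); split; first by rewrite mulr_gt0 ?ltr0n// exprn_gt0// mulr_gt0.
have test phi : test_function U phi -> n2 mu U phi <= N%:R * (2 * b) ^+ 2 *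
    \sum_i n2 mu U (pderiv i phi).
  move=> tp; rewrite (n2_restrict (fun x => test_out tp)).
  rewrite (eq_bigr (fun i => n2 mu setT (pderiv i phi))); last first.
    by move=> i _; rewrite (n2_restrict (fun x => test_out (test_pderiv i tp))).
  pose z : 'rV[R]_N := const_mx (2 * b).
  have hz i : `|z ord0 i| <= 2 * b by rewrite mxE ger0_norm// mulr_ge0// ltW.
  apply: le_trans (n2_shift tp hz).
  have Lp := L2_test tp; apply: n2_le => //; first exact: L2_meas Lp.
    by apply: L2_sub => //; exact: L2_translate.
  apply: aeD_all => x _; have [Ux|nU] := pselect (U x); last first.
    by rewrite (test_out tp nU) normr0.
  rewrite (test_out tp (_ : ~ U (x + z))) ?sub0r ?normrN//.
  move=> /Ub /centered_cubeP/(_ (Ordinal N0)); have /centered_cubeP/(_ (Ordinal N0)) := Ub _ Ux.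
  by rewrite !mxE => /andP[h1 h2] /andP[h3 h4]; lra.
move=> u G [hu hG [p [tp pu pG]]].
have c1 := cvg2_n2 mU (fun n => tL2 (tp n)) hu pu.
have c2 i := cvg2_n2 mU (fun n => tL2 (test_pderiv i (tp n))) (hG i) (pG i).
have c3 : N%:R * (2 * b) ^+ 2 * \sum_i n2 mu U (pderiv i (p n)) @[n --> \oo] -->
    N%:R * (2 * b) ^+ 2 * \sum_i n2 mu U (fun x => G x ord0 i).
  by apply: cvgM; [exact: cvg_cst|apply: cvg_ord_sum => i; exact: c2].
rewrite -(cvg_lim _ c1)// -(cvg_lim _ c3)//; apply: ler_lim.
- by apply/cvg_ex; eexists; exact: c1.
- by apply/cvg_ex; eexists; exact: c3.
- by apply: nearW => n; exact: test.
Qed.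

End sobolev_calculus.

(** * Compactness *)

Section grid.
Context (R : realType) (N : nat) (b : R) (K : nat).
Hypotheses (b0 : 0 < b) (K0 : (0 < K)%N).
Local Notation mu := (@lebesgue_rV R N).
Implicit Types (f g : {ffun 'I_N -> 'I_K}) (x y z : 'rV[R]_N).

Definition mesh : R := 2 * b / K%:R.
Definition cell f : set 'rV[R]_N := cube (\row_i (- b + (f i)%:R * mesh)) mesh.
Definition chi f x : R := \1_(cell f) x.

Lemma mesh_gt0 : 0 < mesh.
Proof. by rewrite /mesh divr_gt0 ?mulr_gt0// ltr0n. Qed.

Lemma measurable_cell f : measurable (cell f).
Proof. exact: measurable_cube. Qed.

Lemma measurable_chi f : measurable_fun setT (chi f).
Proof. by apply: measurable_indic; exact: measurable_cell. Qed.

Lemma chi01 f x : chi f x = if x \in cell f then 1 else 0.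
Proof. by rewrite /chi indicE; case: (_ \in _). Qed.

Lemma cell_unique f g x : cell f x -> cell g x -> f = g.
Proof.
move=> hf hg; apply/ffunP => i; have := hf i; have := hg i; rewrite !mxE.
have m0 := mesh_gt0.
have le (j k : 'I_K) : - b + j%:R * mesh <= x ord0 i -> x ord0 i < - b + k%:R * mesh + mesh ->
    (j <= k)%N.
  move=> h1 h2; have : j%:R * mesh < (k%:R + 1) * mesh by rewrite mulrDl mul1r; lra.
  by rewrite ltr_pM2r// natr1 ltr_nat ltnS.
move=> /andP[h1 h2] /andP[h3 h4]; apply/val_inj/eqP.
by rewrite eqn_leq (le _ _ h3 h2) (le _ _ h1 h4).
Qed.

Lemma cell_cover x : centered_cube b x -> exists f, cell f x.
Proof.
move=> /centered_cubeP hx; have m0 := mesh_gt0.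
pose t i := Num.truncn ((x ord0 i + b) / mesh).
have tP i : (t i)%:R * mesh <= x ord0 i + b < (t i)%:R * mesh + mesh.
  have /andP[h1 h2] := hx i.
  have /truncn_itv/andP[h3 h4] : 0 <= (x ord0 i + b) / mesh.
    by apply: divr_ge0; [lra|exact: ltW].
  rewrite -ler_pdivlMr// h3/=.
  by move: h4; rewrite ltr_pdivrMr// -natr1 mulrDl mul1r.
have tK i : (t i < K)%N.
  have /andP[h1 _] := tP i; have /andP[_ h2] := hx i.
  have : (t i)%:R * mesh < K%:R * mesh.
    have -> : K%:R * mesh = 2 * b by rewrite /mesh mulrC divfK// pnatr_eq0 -lt0n.
    lra.
  by rewrite ltr_pM2r// ltr_nat.
exists [ffun i => Ordinal (tK i)] => i; rewrite !mxE ffunE /=.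
by have /andP[h1 h2] := tP i; apply/andP; split; lra.
Qed.

Lemma sum_chi x : centered_cube b x -> \sum_f chi f x = 1.
Proof.
move=> /cell_cover[g hg]; rewrite (bigD1 g)//= big1.
  by rewrite addr0 chi01 mem_set.
move=> f /eqP fg; rewrite chi01 memNset// => hf; apply: fg; exact: cell_unique hf hg.
Qed.

Lemma cell_diff f x y : cell f x -> cell f y -> centered_cube mesh (y - x).
Proof.
move=> hx hy; apply/centered_cubeP => i; have := hx i; have := hy i; rewrite !mxE.
by move=> /andP[h1 h2] /andP[h3 h4]; apply/andP; split; lra.
Qed.

Lemma summable_chi f : summable_fun mu setT (chi f).
Proof.
apply/integrableP; split; first by apply/measurable_EFinP; exact: measurable_chi.
rewrite (eq_integral (fun x => (\1_(cell f) x)%:E)); last first.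
  by move=> x _; rewrite /= /chi ger0_norm// indicE.
rewrite integral_indic ?setIT//; last exact: measurable_cell.
rewrite [X in (X < _)%E](_ : _ = (mesh ^+ N)%:E) ?ltry//.
by apply: lebesgue_rV_cube; rewrite ltW// mesh_gt0.
Qed.

Lemma Rintegral_chi f : Rintegral mu setT (chi f) = mesh ^+ N.
Proof.
rewrite /Rintegral /chi integral_indic ?setIT//; last exact: measurable_cell.
rewrite [X in fine X](_ : _ = (mesh ^+ N)%:E)//.
by apply: lebesgue_rV_cube; rewrite ltW// mesh_gt0.
Qed.

End grid.

Section rellich.
Context (R : realType) (N : nat) (U : set 'rV[R]_N).
Hypotheses (oU : open U) (bU : bounded_set U).
Local Notation mu := (@lebesgue_rV R N).
Implicit Types (u v w phi : 'rV[R]_N -> R) (G : 'rV[R]_N -> 'rV[R]_N) (i : 'I_N).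
Let mU := domain_measurable oU.
Let tL2 phi := @test_L2 R N U oU phi.
Let mT : measurable [set: 'rV[R]_N] := measurableT.

Lemma measurable_indic_cube (h : R) : measurable_fun setT (\1_(centered_cube h) : 'rV[R]_N -> R).
Proof. by apply: measurable_indic; exact: measurable_centered_cube. Qed.

(** Exchange the integrals and apply the estimate of translations to each shift
    [z]. *)
Lemma double_integral_bound (h : R) phi : 0 < h -> test_function U phi ->
  (\int[mu]_x \int[mu]_z (\1_(centered_cube h) z * (phi (x + z) - phi x) ^+ 2)%:E <=
   ((2 * h) ^+ N * (N%:R * h ^+ 2 * dir2 phi))%:E)%E.
Proof.
move=> h0 tp; have Lp := L2_test tp; have mp := L2_meas Lp.
pose F (p : 'rV[R]_N * 'rV[R]_N) : \bar R :=
  (\1_(centered_cube h) p.2 * (phi (p.1 + p.2) - phi p.1) ^+ 2)%:E.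
have F0 p : (0 <= F p)%E by rewrite lee_fin mulr_ge0 ?sqr_ge0// indicE.
have mF : measurable_fun setT F.
  apply/measurable_EFinP; apply: measurable_funM.
    exact: (measurableT_comp (measurable_indic_cube h) measurable_snd).
  apply: measurable_funX; apply: measurable_funB.
    exact: (measurableT_comp mp (@measurable_rV_add R N)).
  exact: (measurableT_comp mp measurable_fst).
have := @fubini_tonelli _ _ _ _ _ mu mu F mF F0; rewrite /F /= => ->.
have C0 : 0 <= N%:R * h ^+ 2 * dir2 phi.
  by rewrite mulr_ge0 ?dir2_ge0// mulr_ge0// sqr_ge0.
apply: (@le_trans _ _ (\int[mu]_z ((N%:R * h ^+ 2 * dir2 phi) * \1_(centered_cube h) z)%:E)%E).
  apply: ge0_le_integral => //.
  - by move=> z _; apply: integral_ge0 => x _; exact: (F0 (x, z)).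
  - exact: (measurable_fun_fubini_tonelli_G (m1 := mu) F mF F0).
  - apply/measurable_EFinP; apply: measurable_funM; first exact: measurable_cst.
    by apply: measurable_indic; exact: measurable_centered_cube.
  move=> z _; rewrite indicE; case: (boolP (z \in _)) => [/set_mem hz|_] /=; last first.
    by rewrite mulr0; under eq_integral do rewrite mul0r; rewrite integral0.
  rewrite mulr1; under eq_integral do rewrite mul1r.
  have Ld : L2 mu setT (fun x => phi (x + z) - phi x) by apply: L2_sub => //; exact: L2_translate.
  rewrite -(RintegralE mT Ld.2) lee_fin; apply: n2_shift tp _ => i.
  by have /centered_cubeP/(_ i)/andP[z1 z2] := hz; rewrite ler_norml z1 ltW.
have sb : summable_fun mu setT (\1_(centered_cube h) : 'rV[R]_N -> R).
  apply/integrableP; split.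
    by apply/measurable_EFinP; apply: measurable_indic; exact: measurable_centered_cube.
  rewrite (eq_integral (fun x => (\1_(centered_cube h) x)%:E)); last first.
    by move=> x _; rewrite /= ger0_norm// indicE.
  rewrite integral_indic//; last exact: measurable_centered_cube.
  by rewrite setIT; exact: centered_cube_fin (ltW h0).
rewrite -RintegralE//; last exact: summableZ.
rewrite Rintegral_scale// lee_fin mulrC ler_wpM2r//.
rewrite /Rintegral integral_indic ?setIT//; last exact: measurable_centered_cube.
rewrite [X in fine X](_ : _ = ((2 * h) ^+ N)%:E)//.
by apply: lebesgue_rV_cube; rewrite mulr_ge0// ltW.
Qed.

(** Expanding [(phi y - phi x) ^+ 2] over all pairs of points of the same cell of the
    grid gives the left-hand side; such points differ by at most the mesh. *)
Lemma grid_inequality (b : R) (K : nat) phi : 0 < b -> (0 < K)%N -> U `<=` centered_cube b ->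
  test_function U phi ->
  let h := mesh b K in
  2 * h ^+ N * n2 mu setT phi - 2 * \sum_(f : {ffun 'I_N -> 'I_K}) ip mu setT (chi b f) phi ^+ 2 <=
  (2 * h) ^+ N * (N%:R * h ^+ 2 * dir2 phi).
Proof.
move=> b0 K0 Ub tp /=; set h := mesh b K; have h0 : 0 < h by exact: mesh_gt0.
have Lp := L2_test tp; have mp := L2_meas Lp; have sp := summable_test tp.
have sc (f : {ffun 'I_N -> 'I_K}) := @summable_chi R N b K b0 K0 f.
have mc (f : {ffun 'I_N -> 'I_K}) := @measurable_chi R N b K f.
have bc (f : {ffun 'I_N -> 'I_K}) x : `|chi b f x| <= 1 by rewrite chi01; case: ifP => _; rewrite ?normr1 ?normr0.
have scm (f : {ffun 'I_N -> 'I_K}) (v : 'rV[R]_N -> R) : summable_fun mu setT v ->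
    summable_fun mu setT (fun x => chi b f x * v x).
  move=> sv; apply: (summable_le mT _ _ (summable_norm sv)).
    have mv : measurable_fun setT v := summable_meas sv.
    exact: (measurable_funM (mc f) mv).
  by apply: aeD_all => x _; rewrite normrM ler_piMl.
pose A (f : {ffun 'I_N -> 'I_K}) := Rintegral mu setT (fun x => chi b f x * phi x).
pose B (f : {ffun 'I_N -> 'I_K}) := Rintegral mu setT (fun x => chi b f x * phi x ^+ 2).
(* [E f x] is the integral of [(phi y - phi x) ^+ 2] over [y] in the cell [f]. *)
pose E (f : {ffun 'I_N -> 'I_K}) x := h ^+ N * phi x ^+ 2 - 2 * A f * phi x + B f.
have sA f := scm f _ sp; have sB f := scm f _ Lp.2.
have EE f x : E f x = Rintegral mu setT (fun y => chi b f y * (phi y - phi x) ^+ 2).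
  rewrite (_ : (fun y => _) = fun y => phi x ^+ 2 * chi b f y - 2 * phi x * (chi b f y * phi y) +
     chi b f y * phi y ^+ 2); last by apply/funext => y; ring.
  rewrite Rintegral_add//; last by apply: summableB => //; exact: summableZ.
  rewrite Rintegral_sub//; try exact: summableZ.
  by rewrite !Rintegral_scale// Rintegral_chi// /E -/(A f) -/(B f) -/h; ring.
have sE f : summable_fun mu setT (fun x => chi b f x * E f x).
  rewrite (_ : (fun x => _) = fun x => h ^+ N * (chi b f x * phi x ^+ 2) -
     2 * A f * (chi b f x * phi x) + B f * chi b f x); last by apply/funext => x; rewrite /E; ring.
  apply: summableD => //; last exact: summableZ.
  by apply: summableB => //; exact: summableZ.
have IE f : Rintegral mu setT (fun x => chi b f x * E f x) = 2 * h ^+ N * B f - 2 * A f ^+ 2.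
  rewrite (_ : (fun x => _) = fun x => h ^+ N * (chi b f x * phi x ^+ 2) -
     2 * A f * (chi b f x * phi x) + B f * chi b f x); last by apply/funext => x; rewrite /E; ring.
  rewrite Rintegral_add//; [|by apply: summableB => //; exact: summableZ|exact: summableZ].
  rewrite Rintegral_sub//; try exact: summableZ.
  by rewrite !Rintegral_scale// Rintegral_chi// -/(A f) -/(B f) -/h; ring.
have nB : n2 mu setT phi = \sum_f B f.
  rewrite /B -Rintegral_sum//; congr Rintegral; apply/funext => x.
  rewrite -mulr_suml; have [bx|nbx] := pselect (centered_cube b x).
    by rewrite sum_chi// mul1r.
  by rewrite (test_out tp) ?expr0n ?mulr0// => /Ub.
rewrite nB mulr_sumr mulr_sumr -sumrB.
rewrite (eq_bigr (fun f => Rintegral mu setT (fun x => chi b f x * E f x))); last first.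
  by move=> f _; rewrite IE.
rewrite -Rintegral_sum// -lee_fin.
apply: le_trans (double_integral_bound h0 tp).
have sS : summable_fun mu setT (fun x => \sum_f chi b f x * E f x) by exact: summable_sum.
have E0 f x : 0 <= chi b f x * E f x.
  rewrite EE; apply: mulr_ge0; first by rewrite chi01; case: ifP.
  by apply: Rintegral_ge0 => y _; rewrite mulr_ge0 ?sqr_ge0// chi01; case: ifP.
rewrite RintegralE//.
pose F (p : 'rV[R]_N * 'rV[R]_N) : \bar R :=
  (\1_(centered_cube h) p.2 * (phi (p.1 + p.2) - phi p.1) ^+ 2)%:E.
have F0 p : (0 <= F p)%E by rewrite lee_fin mulr_ge0 ?sqr_ge0// indicE.
have mF : measurable_fun setT F.
  apply/measurable_EFinP; apply: measurable_funM.
    exact: (measurableT_comp (measurable_indic_cube h) measurable_snd).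
  apply: measurable_funX; apply: measurable_funB.
    exact: (measurableT_comp mp (@measurable_rV_add R N)).
  exact: (measurableT_comp mp measurable_fst).
apply: ge0_le_integral => //.
- by move=> x _; rewrite lee_fin sumr_ge0.
- by apply/measurable_EFinP; exact: (summable_meas sS).
- exact: (measurable_fun_fubini_tonelli_F (m2 := mu) F mF F0).
move=> x _; have [[f hf]|nf] := pselect (exists f : {ffun 'I_N -> 'I_K}, cell b f x); last first.
  rewrite big1; first by apply: integral_ge0 => z _; exact: (F0 (x, z)).
  by move=> f _; rewrite chi01 memNset ?mul0r// => hf; apply: nf; exists f.
rewrite (bigD1 f)//= big1 ?addr0; last first.
  move=> g /eqP gf; rewrite chi01 memNset ?mul0r// => hg; apply: gf.
  by have := cell_unique b0 K0 hg hf.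
rewrite chi01 mem_set// mul1r EE RintegralE//; last first.
  rewrite (_ : (fun y => _) = fun y => phi x ^+ 2 * chi b f y - 2 * phi x * (chi b f y * phi y) +
     chi b f y * phi y ^+ 2); last by apply/funext => y; ring.
  by apply: summableD => //; apply: summableB => //; exact: summableZ.
pose Gx y : \bar R := (\1_(centered_cube h) (y - x) * (phi y - phi x) ^+ 2)%:E.
have mGx : measurable_fun setT Gx.
  apply/measurable_EFinP; apply: measurable_funM.
    exact: (measurableT_comp (measurable_indic_cube h) (measurable_rV_translation (- x))).
  by apply: measurable_funX; apply: measurable_funB => //; exact: measurable_cst.
have Gx0 y : (0 <= Gx y)%E by rewrite lee_fin mulr_ge0 ?sqr_ge0// indicE.
have -> : (\int[mu]_z (\1_(centered_cube h) z * (phi (x + z) - phi x) ^+ 2)%:E = \int[mu]_y Gx y)%E.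
  rewrite -(integral_rV_translation x mGx Gx0); apply: eq_integral => z _.
  by rewrite /Gx addrK [z + x]addrC.
apply: ge0_le_integral => //.
- by move=> y _; rewrite lee_fin mulr_ge0 ?sqr_ge0// chi01; case: ifP.
- apply/measurable_EFinP; apply: measurable_funM => //.
  by apply: measurable_funX; apply: measurable_funB => //; exact: measurable_cst.
move=> y _; rewrite lee_fin ler_wpM2r ?sqr_ge0// chi01 indicE.
case: (boolP (y \in cell b f)) => [/set_mem hy|_]; last by case: (_ \in _).
by rewrite mem_set//; exact: cell_diff hf hy.
Qed.

(** Up to a small multiple of the energy, the mean square of a function is controlled by
    its averages on the cells of a fine grid. *)
Lemma finite_rank_estimate e : 0 < e -> exists m (q : 'I_m -> 'rV[R]_N -> R),
  (forall j, L2 mu U (q j)) /\ forall u G, h10 U u G ->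
  n2 mu U u <= \sum_j ip mu U (q j) u ^+ 2 + e * \sum_i n2 mu U (fun x => G x ord0 i).
Proof.
move=> e0; have [b [b0 Ub]] := bounded_sub_centered_cube bU.
pose c : R := 2 ^+ N * N%:R * (2 * b) ^+ 2.
have c0 : 0 <= c by rewrite /c mulr_ge0 ?sqr_ge0// mulr_ge0// exprn_ge0.
have [|k hk] := @invS_le_eps R (e / (c + 1)); first by rewrite divr_gt0// ltr_wpDl.
pose K := k.+1; pose h := mesh b K; have h0 : 0 < h by exact: mesh_gt0.
have K1 : K%:R^-1 <= e / (c + 1) by exact: hk.
have hN0 : 0 < h ^+ N by rewrite exprn_gt0.
pose r := Num.sqrt (h ^+ N)^-1.
have r2 : r ^+ 2 = (h ^+ N)^-1 by rewrite sqr_sqrtr// invr_ge0 ltW.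
pose q (f : {ffun 'I_N -> 'I_K}) x := r * chi b f x.
have mchi (f : {ffun 'I_N -> 'I_K}) : measurable_fun U (chi b f).
  by apply: measurable_funTS; exact: measurable_chi.
have Lchi (f : {ffun 'I_N -> 'I_K}) : L2 mu U (chi b f).
  apply: (L2_le mU (mchi f) _ (L2_cst oU bU 1)); apply: aeD_all => x _.
  by rewrite chi01 normr1; case: ifP => _; rewrite ?normr1 ?normr0.
have Lq f : L2 mu U (q f) by exact: L2_scale.
have he : 2 ^+ N * (N%:R * h ^+ 2) <= e.
  have -> : 2 ^+ N * (N%:R * h ^+ 2) = c * K%:R^-1 ^+ 2 by rewrite /h /mesh /c; ring.
  have K01 : 0 <= K%:R^-1 :> R by rewrite invr_ge0.
  have K11 : K%:R^-1 <= 1 :> R by rewrite invf_le1 ?ltr0n// ler1n.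
  apply: (@le_trans _ _ ((c + 1) * K%:R^-1)).
    by apply: ler_pM; [exact: c0|exact: sqr_ge0|rewrite lerDl|rewrite expr2 ler_piMl].
  by rewrite mulrC -ler_pdivlMr// ltr_wpDl.
have test phi : test_function U phi -> n2 mu U phi <=
    \sum_f ip mu U (q f) phi ^+ 2 + e * \sum_i n2 mu U (pderiv i phi).
  move=> tp; have := grid_inequality b0 (isT : (0 < K)%N) Ub tp; rewrite -/h.
  rewrite (n2_restrict (fun x => test_out tp)).
  have -> : \sum_i n2 mu U (pderiv i phi) = dir2 phi.
    by apply: eq_bigr => i _; rewrite (n2_restrict (fun x => test_out (test_pderiv i tp))).
  have -> : \sum_f ip mu U (q f) phi ^+ 2 = (h ^+ N)^-1 *
      \sum_(f : {ffun 'I_N -> 'I_K}) ip mu setT (chi b f) phi ^+ 2.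
    rewrite mulr_sumr; apply: eq_bigr => f _; rewrite /q ipZl//; last exact: tL2.
    rewrite exprMn r2; congr (_ * _ ^+ 2); apply: Rintegral_restrict => x nx.
    by rewrite (test_out tp nx) mulr0.
  set S := \sum_f _; set n := n2 _ _ _; set d := dir2 phi => H.
  have d0 : 0 <= d by exact: dir2_ge0.
  have : n <= (h ^+ N)^-1 * S + 2 ^+ N * (N%:R * h ^+ 2 * d) / 2.
    rewrite -(ler_pM2l (_ : 0 < 2 * h ^+ N)) ?mulr_gt0//.
    have -> : 2 * h ^+ N * ((h ^+ N)^-1 * S + 2 ^+ N * (N%:R * h ^+ 2 * d) / 2) =
       2 * S + (2 * h) ^+ N * (N%:R * h ^+ 2 * d).
      have alg (a t s y : R) : a != 0 -> 2 * a * (a^-1 * s + t * y / 2) = 2 * s + t * a * y.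
        by move=> a0; field.
      by rewrite [(2 * h) ^+ N]exprMn; apply: alg; rewrite gt_eqF.
    by rewrite -lerBlDl; exact: H.
  move=> /le_trans; apply; rewrite lerD2l.
  apply: (@le_trans _ _ (2 ^+ N * (N%:R * h ^+ 2) * d)); last by rewrite ler_wpM2r.
  have -> : 2 ^+ N * (N%:R * h ^+ 2) * d = 2 ^+ N * (N%:R * h ^+ 2 * d) by rewrite -!mulrA.
  have : 0 <= 2 ^+ N * (N%:R * h ^+ 2 * d).
    by apply: mulr_ge0; [exact: exprn_ge0|rewrite mulr_ge0// mulr_ge0// sqr_ge0].
  by move: (2 ^+ N * _) => y y0; lra.
exists #|{ffun 'I_N -> 'I_K}|, (fun j => q (enum_val j)); split=> // u G [hu hG [p [tp pu pG]]].
have c1 := cvg2_n2 mU (fun n => tL2 (tp n)) hu pu.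
have c2 i := cvg2_n2 mU (fun n => tL2 (test_pderiv i (tp n))) (hG i) (pG i).
have c3 (j : 'I_#|{ffun 'I_N -> 'I_K}|) : ip mu U (q (enum_val j)) (p n) ^+ 2 @[n --> \oo] --> ip mu U (q (enum_val j)) u ^+ 2.
  have := cvg2_ip mU (fun=> Lq (enum_val j)) (Lq (enum_val j)) (fun n => tL2 (tp n)) hu (cvg2_cst _ _ _) pu.
  by move=> cc; rewrite expr2; under eq_fun do rewrite expr2; apply: cvgM.
have c4 : \sum_(j < #|{ffun 'I_N -> 'I_K}|) ip mu U (q (enum_val j)) (p n) ^+ 2 + e * \sum_i n2 mu U (pderiv i (p n))
    @[n --> \oo] --> \sum_(j < #|{ffun 'I_N -> 'I_K}|) ip mu U (q (enum_val j)) u ^+ 2 +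
    e * \sum_i n2 mu U (fun x => G x ord0 i).
  have d1 := cvg_ord_sum c3.
  have d2 : e * \sum_i n2 mu U (pderiv i (p n)) @[n --> \oo] -->
      e * \sum_i n2 mu U (fun x => G x ord0 i).
    by apply: cvgM; [exact: cvg_cst|exact: cvg_ord_sum].
  exact: cvgD d1 d2.
rewrite -(cvg_lim _ c1)// -(cvg_lim _ c4)//; apply: ler_lim.
- by apply/cvg_ex; eexists; exact: c1.
- by apply/cvg_ex; eexists; exact: c4.
- apply: nearW => n; apply: le_trans (test _ (tp n)) _; rewrite lerD2r.
  by rewrite (reindex (fun j : 'I_#|{ffun 'I_N -> 'I_K}| => enum_val j))//=; exists enum_rank => ? _;
    [exact: enum_valK|exact: enum_rankK].
Qed.

(** Along an ultrafilter all bounded scalar sequences converge, in particular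
    those of the finitely many averages of the previous estimate; the sequence
    is therefore Cauchy along the ultrafilter, and a subsequence can be picked
    from it. *)
Lemma rellich (u_ : nat -> 'rV[R]_N -> R) (G_ : nat -> 'rV[R]_N -> 'rV[R]_N) (M : R) :
  (forall n, h10 U (u_ n) (G_ n)) -> (forall n, n2 mu U (u_ n) <= M) ->
  (forall n, \sum_i n2 mu U (fun x => G_ n x ord0 i) <= M) ->
  exists s : nat -> nat, (forall k, (k <= s k)%N) /\
  forall e, 0 < e -> exists K, forall k l, (K <= k)%N -> (K <= l)%N ->
    n2 mu U (fun x => u_ (s k) x - u_ (s l) x) <= e.
Proof.
move=> hu nM GM.
have M0 : 0 <= M by apply: le_trans (nM 0%N); exact: n2_ge0.
have [F [UF sF]] : exists F, UltraFilter F /\ (\oo : set_system nat) `<=` F.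
  exact: ultraFilterLemma.
have FF : ProperFilter F by exact: ultra_proper.
have Lu n : L2 mu U (u_ n) by have [] := hu n.
have LG n i : L2 mu U (fun x => G_ n x ord0 i) by have [_ /(_ i)] := hu n.
have coef (q : 'rV[R]_N -> R) e : L2 mu U q -> 0 < e ->
    exists A, F A /\ forall k l, A k -> A l -> `|ip mu U q (u_ k) - ip mu U q (u_ l)| <= e.
  move=> Lq e0; pose a n := ip mu U q (u_ n); pose B := n2 mu U q * M + 1.
  have B0 : 0 <= B by rewrite addr_ge0// mulr_ge0// n2_ge0.
  have aB n : a n \in `[- B, B].
    rewrite in_itv/= -ler_norml; apply: norm_le_of_sqr.
      by rewrite ltr_wpDl// mulr_ge0// n2_ge0.
    apply: (le_trans (cauchy_schwarz mU Lq (Lu n))).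
    apply: (@le_trans _ _ (n2 mu U q * M)); first by rewrite ler_wpM2l// n2_ge0.
    have : 0 <= n2 mu U q * M by rewrite mulr_ge0// n2_ge0.
    by rewrite /B; nra.
  have cB : compact (`[- B, B]%classic : set R) by exact: segment_compact.
  have [l [_ hl]] : `[- B, B]%classic `&` cluster (a @ F) !=set0.
    by apply: cB; rewrite /fmap /=; apply: filterE => n; exact: aB.
  have e2 : 0 < e / 2 by rewrite divr_gt0.
  exists [set n | `|l - a n| <= e / 2]; split.
    have [//|nA] := in_ultra_setVsetC [set n | `|l - a n| <= e / 2] UF.
    have [//|y [/= h1 h2]] := hl [set y | ~ (`|l - y| <= e / 2)] (ball l (e / 2)) _ (nbhsx_ballx l (e / 2) e2).
    by exfalso; apply: h1; apply: ltW; move: h2; rewrite -ball_normE.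
  move=> k m hk hm; rewrite (_ : _ - _ = (l - a m) - (l - a k)); last by rewrite /a; ring.
  by apply: le_trans (ler_normB _ _) _; rewrite (splitr e) lerD.
have small e : 0 < e -> exists A, F A /\ forall k l, A k -> A l ->
    n2 mu U (fun x => u_ k x - u_ l x) <= e.
  move=> e0; have e' : 0 < e / (2 * (4 * M + 1)).
    by rewrite divr_gt0// mulr_gt0// ltr_wpDl// mulr_ge0.
  have [m [q [Lq Hq]]] := finite_rank_estimate e'.
  have d0 : 0 < e / 2 / (m%:R + 1) by rewrite !divr_gt0// ltr_wpDl.
  pose d := Num.sqrt (e / 2 / (m%:R + 1)).
  have dpos : 0 < d by rewrite sqrtr_gt0.
  have [A HA] := choice (fun j => coef _ _ (Lq j) dpos).
  exists [set n | forall j, A j n]; split.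
    by apply: filter_forall => j; exact: (HA j).1.
  move=> k l hk hl.
  have hkl : h10 U (fun x => u_ k x - u_ l x) (fun x => G_ k x + (-1) *: G_ l x).
    have := h10_add oU (hu k) (h10_scale oU (-1) (hu l)).
    by rewrite (_ : (fun x => u_ k x + -1 * u_ l x) = fun x => u_ k x - u_ l x)//;
      apply/funext => x; rewrite mulN1r.
  apply: le_trans (Hq _ _ hkl) _.
  rewrite [leRHS](splitr e).
  apply: lerD.
    apply: (@le_trans _ _ (\sum_(j < m) d ^+ 2)).
      apply: ler_sum => j _; rewrite ipBr// -sqr_normr.
      by rewrite lerXn2r ?nnegrE//; [exact: ltW|exact: (HA j).2 (hk j) (hl j)].
    have d2 : d ^+ 2 = e / 2 / (m%:R + 1) by rewrite sqr_sqrtr// ltW.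
    rewrite sumr_const card_ord -[_ *+ m]mulr_natl d2 mulrCA ler_piMr ?ltW ?divr_gt0//.
    by rewrite ltr_pdivrMr ?ltr_wpDl// mul1r ltrDl.
  apply: (@le_trans _ _ (e / (2 * (4 * M + 1)) * (4 * M + 1))).
    apply: ler_wpM2l; first exact: ltW.
    apply: (@le_trans _ _ (4 * M)); last by rewrite lerDl.
    apply: (@le_trans _ _ (\sum_i (2 * n2 mu U (fun x => G_ k x ord0 i) +
                                   2 * n2 mu U (fun x => G_ l x ord0 i)))).
      apply: ler_sum => i _; have LN := L2_scale mU (-1) (LG l i).
      have := n2D_le mU (LG k i) LN; rewrite (n2Z mU (-1) (LG l i)) sqrrN expr1n mul1r.
      have eN : (fun x => G_ k x ord0 i + -1 * G_ l x ord0 i) =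
        (fun x => (G_ k x + -1 *: G_ l x) ord0 i) by apply/funext => x; rewrite !mxE.
      by rewrite eN.
    by rewrite big_split/= -!mulr_sumr; have := GM k; have := GM l; lra.
  by rewrite invfM mulrA divfK// gt_eqF// ltr_wpDl// mulr_ge0.
have small' (k : nat) : exists A, F A /\ forall k' l, A k' -> A l ->
    n2 mu U (fun x => u_ k' x - u_ l x) <= k.+1%:R^-1 by apply: small; rewrite invr_gt0.
have [A HA] := choice small'.
have pick k : exists n, (k <= n)%N /\ forall j, (j <= k)%N -> A j n.
  have FA : F [set n | (k <= n)%N /\ forall j : 'I_k.+1, A j n].
    apply: filterI; first by apply: sF; exists k.
    by apply: filter_forall => j; exact: (HA j).1.
  have [n [kn hn]] := filter_ex FA; exists n; split=> // j jk.
  exact: (hn (Ordinal (jk : (j < k.+1)%N))).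
have [s Hs] := choice pick; exists s; split=> [k|e e0]; first exact: (Hs k).1.
have [K HK] := invS_le_eps e0; exists K => k l Kk Kl.
apply: le_trans (HK K (leqnn K)).
by apply: (HA K).2; [exact: (Hs k).2 K Kk|exact: (Hs l).2 K Kl].
Qed.

End rellich.

(** * The energy form *)

Section energy.
Context (R : realType) (N : nat) (U : set 'rV[R]_N).
Hypotheses (oU : open U) (bU : bounded_set U).
Local Notation mu := (@lebesgue_rV R N).
Implicit Types (u v w : 'rV[R]_N -> R) (G : 'rV[R]_N -> 'rV[R]_N) (i : 'I_N).
Let mU := domain_measurable oU.

Lemma H10_meas u : H10 U u -> measurable_fun U u.
Proof. by move=> hu; exact: L2_meas (H10_L2 oU hu). Qed.

Lemma H10_add u v : H10 U u -> H10 U v -> H10 U (fun x => u x + v x) /\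
  forall i, aeD mu U (fun x => gr U (fun x => u x + v x) i x = gr U u i x + gr U v i x).
Proof.
move=> hu hv; have [h g] := h10_H10 oU bU (h10_add oU (H10_h10 oU hu) (H10_h10 oU hv)).
by split=> // i; apply: aeDW (g i) => x _ ->; rewrite mxE.
Qed.

Lemma H10_scale c u : H10 U u -> H10 U (fun x => c * u x) /\
  forall i, aeD mu U (fun x => gr U (fun x => c * u x) i x = c * gr U u i x).
Proof.
move=> hu; have [h g] := h10_H10 oU bU (h10_scale oU c (H10_h10 oU hu)).
by split=> // i; apply: aeDW (g i) => x _ ->; rewrite mxE.
Qed.

Lemma H10_sub u v : H10 U u -> H10 U v -> H10 U (fun x => u x - v x).
Proof.
move=> hu hv; have [h _] := H10_add hu (H10_scale (-1) hv).1.
by move: h; rewrite (_ : (fun x => _ + -1 * _) = fun x => u x - v x)//;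
  apply/funext => x; rewrite mulN1r.
Qed.

Lemma H10_opp u : H10 U u -> H10 U (fun x => - u x).
Proof.
move=> hu; have [h _] := H10_scale (-1) hu.
by move: h; rewrite (_ : (fun x => -1 * _) = fun x => - u x)//;
  apply/funext => x; rewrite mulN1r.
Qed.

Lemma H10_test phi : test_function U phi -> H10 U phi /\
  forall i, aeD mu U (fun x => gr U phi i x = pderiv i phi x).
Proof.
move=> tp; have [h g] := h10_H10 oU bU (h10_test oU tp).
by split=> // i; apply: aeDW (g i) => x _ ->; rewrite mxE.
Qed.

Lemma H10_comp u (h h' : R -> R) C : smooth1 h -> h 0 = 0 ->
  (forall t : R, is_derive t 1 h (h' t)) -> continuous h' -> (forall t, `|h' t| <= C) ->
  H10 U u -> H10 U (fun x => h (u x)) /\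
  forall i, aeD mu U (fun x => gr U (fun x => h (u x)) i x = h' (u x) * gr U u i x).
Proof.
move=> sh h0 dh ch hC hu.
have [H g] := h10_H10 oU bU (h10_comp oU sh h0 dh ch hC (H10_h10 oU hu)).
by split=> // i; apply: aeDW (g i) => x _ ->; rewrite mxE.
Qed.

Lemma H10_mul_test psi u : test_function U psi -> H10 U u ->
  H10 U (fun x => psi x * u x) /\
  forall i, aeD mu U (fun x => gr U (fun x => psi x * u x) i x =
    psi x * gr U u i x + pderiv i psi x * u x).
Proof.
move=> tp hu; have [H g] := h10_H10 oU bU (h10_mul_test oU tp (H10_h10 oU hu)).
by split=> // i; apply: aeDW (g i) => x _ ->; rewrite !mxE [u x * _]mulrC.
Qed.

Definition en u v : R := \sum_i ip mu U (gr U u i) (gr U v i).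

Lemma enE u v : en u v = \sum_i ip mu U (gr U u i) (gr U v i).
Proof. by []. Qed.

Lemma dirichletE u v : H10 U u -> H10 U v -> dirichlet U u v = (en u v)%:E.
Proof.
move=> hu hv; have sg i : summable_fun mu U (fun x => gr U u i x * gr U v i x).
  by apply: L2_mul => //; exact: gr_L2.
rewrite /dirichlet /en -Rintegral_sum// RintegralE//.
exact: summable_sum.
Qed.

Lemma en_ae u v (g g' : 'I_N -> 'rV[R]_N -> R) : H10 U u -> H10 U v ->
  (forall i, measurable_fun U (g i)) -> (forall i, measurable_fun U (g' i)) ->
  (forall i, aeD mu U (fun x => gr U u i x = g i x)) ->
  (forall i, aeD mu U (fun x => gr U v i x = g' i x)) ->
  en u v = \sum_i ip mu U (g i) (g' i).
Proof.
move=> hu hv mg mg' ug vg; apply: eq_bigr => i _; apply: Rintegral_ae_eq => //.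
- by apply: measurable_funM; [exact: L2_meas (gr_L2 oU i hu)|exact: L2_meas (gr_L2 oU i hv)].
- exact: measurable_funM.
- by apply: aeD2 (ug i) (vg i) => x _ -> ->.
Qed.

Lemma en_sym u v : en u v = en v u.
Proof. by apply: eq_bigr => i _; rewrite ipC. Qed.

Lemma en_ge0 u : 0 <= en u u.
Proof. by apply: sumr_ge0 => i _; rewrite -n2E n2_ge0. Qed.

Lemma en_addl u v w : H10 U u -> H10 U v -> H10 U w ->
  en (fun x => u x + v x) w = en u w + en v w.
Proof.
move=> hu hv hw; have [h g] := H10_add hu hv.
have Lu i := gr_L2 oU i hu; have Lv i := gr_L2 oU i hv; have Lw i := gr_L2 oU i hw.
rewrite (en_ae (g := fun i x => gr U u i x + gr U v i x) (g' := gr U w) h hw)//.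
- by rewrite -big_split; apply: eq_bigr => i _; exact: ipDl.
- by move=> i; apply: measurable_funD; apply: L2_meas.
- by move=> i; exact: L2_meas (Lw i).
- by move=> i; apply: aeD_all.
Qed.

Lemma en_scalel c u w : H10 U u -> H10 U w -> en (fun x => c * u x) w = c * en u w.
Proof.
move=> hu hw; have [h g] := H10_scale c hu.
have Lu i := gr_L2 oU i hu; have Lw i := gr_L2 oU i hw.
rewrite (en_ae (g := fun i x => c * gr U u i x) (g' := gr U w) h hw)//.
- by rewrite /en mulr_sumr; apply: eq_bigr => i _; exact: ipZl.
- by move=> i; apply: measurable_funM => //; exact: L2_meas (Lu i).
- by move=> i; exact: L2_meas (Lw i).
- by move=> i; apply: aeD_all.
Qed.

Lemma en_subl u v w : H10 U u -> H10 U v -> H10 U w ->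
  en (fun x => u x - v x) w = en u w - en v w.
Proof.
move=> hu hv hw; have := en_addl hu (H10_scale (-1) hv).1 hw.
rewrite en_scalel// mulN1r (_ : (fun x => u x + -1 * v x) = fun x => u x - v x)//.
by apply/funext => x; rewrite mulN1r.
Qed.

Lemma en_oppl u w : H10 U u -> H10 U w -> en (fun x => - u x) w = - en u w.
Proof.
move=> hu hw; have := en_scalel (-1) hu hw.
rewrite mulN1r (_ : (fun x => -1 * u x) = fun x => - u x)//.
by apply/funext => x; rewrite mulN1r.
Qed.

Lemma en_quad t u v : H10 U u -> H10 U v ->
  en (fun x => u x + t * v x) (fun x => u x + t * v x) =
  en u u + 2 * t * en u v + t ^+ 2 * en v v.
Proof.
move=> hu hv; have htv := (H10_scale t hv).1; have hs := (H10_add hu htv).1.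
set w := fun x => u x + t * v x.
rewrite (en_addl hu htv hs) (en_scalel t hv hs) (en_sym u w) (en_sym v w).
rewrite (en_addl hu htv hu) (en_addl hu htv hv) (en_scalel t hv hu) (en_scalel t hv hv).
rewrite (en_sym v u); move: (en u u) (en u v) (en v v) => a b c; ring.
Qed.

Lemma en_cs u v : H10 U u -> H10 U v -> en u v ^+ 2 <= en u u * en v v.
Proof.
move=> hu hv; apply: quadratic_ge0_le; first exact: en_ge0.
by move=> t; rewrite -(en_quad t hu hv) en_ge0.
Qed.

Lemma en_sub_quad u v : H10 U u -> H10 U v ->
  en (fun x => u x - v x) (fun x => u x - v x) = en u u - 2 * en u v + en v v.
Proof.
move=> hu hv; have := en_quad (-1) hu hv.
rewrite (_ : (fun x => u x + -1 * v x) = fun x => u x - v x).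
  move=> ->; move: (en u u) (en u v) (en v v) => a b c; ring.
by apply/funext => x; rewrite mulN1r.
Qed.

(** The parallelogram law, the source of all Cauchy estimates for minimizing
    sequences. *)
Lemma en_mid u v : H10 U u -> H10 U v ->
  en (fun x => 2^-1 * (u x + v x)) (fun x => 2^-1 * (u x + v x)) =
  2^-1 * en u u + 2^-1 * en v v -
  4^-1 * en (fun x => u x - v x) (fun x => u x - v x).
Proof.
move=> hu hv; rewrite en_sub_quad//.
have hs := (H10_add hu hv).1; have hm := (H10_scale 2^-1 hs).1.
set w := fun x => 2^-1 * (u x + v x); set s := fun x => u x + v x.
rewrite (en_scalel 2^-1 hs hm) (en_sym s w) (en_scalel 2^-1 hs hs) /s.
have e : (fun x => u x + 1 * v x) = fun x => u x + v x by apply/funext => x; rewrite mul1r.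
have := en_quad 1 hu hv; rewrite e => ->.
move: (en u u) (en u v) (en v v) => a b c; lra.
Qed.

Lemma H10_poincare : (0 < N)%N -> exists C, 0 < C /\
  forall u, H10 U u -> n2 mu U u <= C * en u u.
Proof.
move=> N0; have [C [C0 hC]] := poincare oU bU N0; exists C; split=> // u hu.
have := hC _ _ (H10_h10 oU hu); rewrite /en.
by under [X in _ <= _ * X -> _]eq_bigr do rewrite n2E.
Qed.

(** Cauchy in energy implies Cauchy in the mean by the Poincare inequality; the limits
    of the functions and of the gradients fit together because the graph of the
    gradient is closed. *)
Lemma H10_complete (u_ : nat -> 'rV[R]_N -> R) : (0 < N)%N -> (forall n, H10 U (u_ n)) ->
  (forall e, 0 < e -> exists K, forall m n, (K <= m)%N -> (K <= n)%N ->
    en (fun x => u_ m x - u_ n x) (fun x => u_ m x - u_ n x) <= e) ->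
  exists u, H10 U u /\ (en (fun x => u_ n x - u x) (fun x => u_ n x - u x) @[n --> \oo] --> 0).
Proof.
move=> N0 hu cau; have [C [C0 hC]] := H10_poincare N0.
have Lu n := H10_L2 oU (hu n); have Lg n i := gr_L2 oU i (hu n).
have hd m n : H10 U (fun x => u_ m x - u_ n x) by exact: H10_sub.
have enE u v : H10 U u -> H10 U v -> en (fun x => u x - v x) (fun x => u x - v x) =
    \sum_i n2 mu U (fun x => gr U u i x - gr U v i x).
  move=> hu' hv; have huv := H10_sub hu' hv.
  have Lu' i := gr_L2 oU i hu'; have Lv i := gr_L2 oU i hv.
  have ga i : aeD mu U (fun x => gr U (fun x => u x - v x) i x = gr U u i x - gr U v i x).
    have [_ g1] := H10_add hu' (H10_scale (-1) hv).1; have [_ g2] := H10_scale (-1) hv.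
    have e : (fun x => u x + -1 * v x) = fun x => u x - v x by apply/funext => x; rewrite mulN1r.
    rewrite e in g1; apply: aeD2 (g1 i) (g2 i) => x _ -> ->; by rewrite mulN1r.
  have mg i : measurable_fun U (fun x => gr U u i x - gr U v i x).
    exact: L2_meas (L2_sub mU (Lu' i) (Lv i)).
  by rewrite (en_ae huv huv mg mg ga ga); apply: eq_bigr => i _; rewrite n2E.
have [u [Lu' cu]] : exists u, L2 mu U u /\ cvg2 mu U u_ u.
  apply: L2_complete => // e e0; have [|K HK] := cau (e / C); first by rewrite divr_gt0.
  exists K => m n Km Kn; apply: le_trans (hC _ (hd m n)) _.
  by rewrite mulrC -ler_pdivlMr//; exact: HK.
have Gx i : exists g, L2 mu U g /\ cvg2 mu U (fun n => gr U (u_ n) i) g.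
  apply: L2_complete => // e e0; have [K HK] := cau e e0.
  exists K => m n Km Kn; apply: le_trans (HK m n Km Kn); rewrite enE//.
  by rewrite (bigD1 i)//= lerDl sumr_ge0// => j _; exact: n2_ge0.
have [g hg] := choice Gx.
have hh : h10 U u (fun x => \row_i g i x).
  apply: (h10_closed oU (fun n => H10_h10 oU (hu n))) => //.
  - by move=> i; under eq_fun do rewrite mxE; exact: (hg i).1.
  - by move=> i; under [X in cvg2 _ _ _ X]eq_fun do rewrite mxE; exact: (hg i).2.
have [Hu gu] := h10_H10 oU bU hh; exists u; split=> //.
rewrite (_ : (fun n => en _ _) = fun n => 0 + \sum_i n2 mu U (fun x => gr U (u_ n) i x - g i x)).
  apply: cvg_add0; first exact: cvg_cst.
  by move=> i; exact: (hg i).2.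
apply/funext => n; rewrite add0r enE//; apply: eq_bigr => i _; apply: n2_ae_eq => //.
- exact: L2_meas (L2_sub mU (Lg n i) (gr_L2 oU i Hu)).
- exact: L2_meas (L2_sub mU (Lg n i) (hg i).1).
- by apply: aeDW (gu i) => x _ ->; rewrite mxE.
Qed.

End energy.

#[global] Opaque en.

(** * Smooth substitutes for positive parts, absolute values and inverses *)

Section auxiliary_functions.
Context (R : realType).
Implicit Types (s t : R) (k : nat).

Lemma smooth1_deriv_continuous (h h' : R -> R) : smooth1 h ->
  (forall t : R, is_derive t 1 h (h' t)) -> continuous h'.
Proof.
move=> sh dh; have [h1 [dh1 [h2 [dh2 _]]]] := sh 2%N.
have -> : h' = h1 by apply/funext => t; have [_ <-] := dh t; have [_ <-] := dh1 t.
by move=> t; exact: is_derive1_continuous (dh2 t).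
Qed.

Lemma Dk_linear k (c d : R) : Dk k (fun t => c * t + d).
Proof.
apply: Dk_add; last exact: Dk_cst.
by apply: Dk_mul; [exact: Dk_cst|exact: Dk_id].
Qed.

Lemma is_derive_linear (c d t : R) : is_derive t 1 (fun t => c * t + d) c.
Proof.
have d1 : is_derive t 1 (fun s : R => c * s) c.
  apply: is_derive_eq (is_deriveM (is_derive_cst c t 1) (is_derive_id t 1)) _.
  by rewrite scaler0 addr0 /GRing.scale/= mulr1.
apply: is_derive_eq (is_deriveD d1 (is_derive_cst d t 1)) _.
by rewrite addr0.
Qed.

(** A smooth substitute for the positive part. *)
Definition eta t : R := t * flat0 t.
Definition eta' t : R := if 0 < t then (1 + t^-1) * expR (- t^-1) else 0.

Lemma is_derive_eta t : is_derive t 1 eta (eta' t).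
Proof.
apply: is_derive_eq (is_deriveM (is_derive_id t 1) (is_derive_flat 1 t)) _.
rewrite /eta' /flat /GRing.scale/=; case: ifPn => t0; last by rewrite !mulr0 mul0r addr0.
rewrite -(polyC1 R) derivC sub0r !hornerM hornerN !hornerX !hornerC.
by field; rewrite gt_eqF.
Qed.

Lemma smooth1_eta : smooth1 eta.
Proof. by move=> k; apply: Dk_mul; [exact: Dk_id|exact: smooth1_flat0]. Qed.

Lemma eta0 : eta 0 = 0. Proof. by rewrite /eta mul0r. Qed.

Lemma eta_le0 t : t <= 0 -> eta t = 0.
Proof. by move=> t0; rewrite /eta flat0_le0// mulr0. Qed.

Lemma eta_gt0 t : 0 < t -> 0 < eta t.
Proof. by move=> t0; rewrite /eta mulr_gt0// flat0_gt0. Qed.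

Lemma eta_ge0 t : 0 <= eta t.
Proof. by have [/eta_gt0/ltW//|/eta_le0 ->] := ltP 0 t. Qed.

Lemma eta'_ge0 t : 0 <= eta' t.
Proof.
rewrite /eta'; case: ifP => // t0; rewrite mulr_ge0 ?expR_ge0// addr_ge0// invr_ge0.
exact: ltW.
Qed.

Lemma eta'_le1 t : eta' t <= 1.
Proof.
rewrite /eta'; case: ifP => // t0; rewrite expRN ler_pdivrMr ?expR_gt0// mul1r.
exact: expR_ge1Dx.
Qed.

(** A smooth substitute for the absolute value. *)
Definition abs_k k t : R := k.+1%:R^-1 * (eta (k.+1%:R * t) + eta (- k.+1%:R * t)).
Definition abs_k' k t : R := eta' (k.+1%:R * t) - eta' (- k.+1%:R * t).

Lemma smooth1_abs_k k : smooth1 (abs_k k).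
Proof.
move=> j; apply: Dk_mul; first exact: Dk_cst.
have h (c : R) : Dk j (fun t => eta (c * t)).
  rewrite (_ : (fun t => _) = fun t => eta (c * t + 0)).
    by apply: (Dk_comp (Dk_linear j c 0)); exact: smooth1_eta.
  by apply/funext => t; rewrite addr0.
by apply: Dk_add; exact: h.
Qed.

Lemma is_derive_abs_k k t : is_derive t 1 (abs_k k) (abs_k' k t).
Proof.
have h (c : R) : is_derive t 1 (fun t => eta (c * t)) (eta' (c * t) * c).
  rewrite (_ : (fun t => _) = fun t => eta (c * t + 0)); last first.
    by apply/funext => s; rewrite addr0.
  apply: is_derive_eq (@is_derive1_comp _ eta (fun t => c * t + 0) t _ _
    (is_derive_eta _) (is_derive_linear c 0 t)) _.
  by rewrite addr0.
have h2 := is_deriveD (h k.+1%:R) (h (- k.+1%:R)).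
apply: is_derive_eq (is_deriveM (is_derive_cst (k.+1%:R^-1 : R) t 1) h2) _.
rewrite scaler0 addr0 /GRing.scale/= /abs_k'.
have k0 : k.+1%:R != 0 :> R by rewrite pnatr_eq0.
by move: (k.+1%:R : R) k0 => K K0; field.
Qed.

Lemma abs_k0 k : abs_k k 0 = 0.
Proof. by rewrite /abs_k !mulr0 eta0 addr0 mulr0. Qed.

Lemma abs_k_ge0 k t : 0 <= abs_k k t.
Proof. by rewrite /abs_k mulr_ge0// ?invr_ge0// addr_ge0// eta_ge0. Qed.

Lemma abs_k'_le1 k t : `|abs_k' k t| <= 1.
Proof.
rewrite /abs_k' ler_norml.
have := eta'_ge0 (k.+1%:R * t); have := eta'_ge0 (- k.+1%:R * t).
have := eta'_le1 (k.+1%:R * t); have := eta'_le1 (- k.+1%:R * t).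
move: (eta' _) (eta' _) => a b ha hb hc hd; apply/andP; split; lra.
Qed.

(** For positive [t], [t - eta (k t) / k = t (1 - flat0 (k t))], which is at most
    [1 / k]. *)
Lemma abs_k_close k t : `| `|t| - abs_k k t| <= k.+1%:R^-1.
Proof.
have k0 : 0 < k.+1%:R :> R by [].
have pos s : 0 < s -> `|s - k.+1%:R^-1 * eta (k.+1%:R * s)| <= k.+1%:R^-1.
  move=> s0; rewrite /eta mulrA mulKf ?gt_eqF//.
  have ks : 0 < k.+1%:R * s by rewrite mulr_gt0.
  have f1 := flat0_le1 (k.+1%:R * s); have f2 := flat0_ge ks.
  rewrite ger0_norm; last by rewrite subr_ge0 ler_piMr// ltW.
  have : s * (1 - (k.+1%:R * s)^-1) <= s * flat0 (k.+1%:R * s) by rewrite ler_wpM2l// ltW.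
  have -> : s * (1 - (k.+1%:R * s)^-1) = s - k.+1%:R^-1.
    by field; rewrite !gt_eqF.
  by move: (k.+1%:R^-1 : R) (s * flat0 _) => a b; lra.
have [t0|t0|->] := ltrgtP t 0.
- rewrite /abs_k (eta_le0 (_ : k.+1%:R * t <= 0)); last by rewrite mulr_ge0_le0// ltW.
  have e : - k.+1%:R * t = k.+1%:R * - t by rewrite mulNr mulrN.
  by rewrite add0r e (ltr0_norm t0); apply: pos; rewrite oppr_gt0.
- rewrite /abs_k (eta_le0 (_ : - k.+1%:R * t <= 0)); last by rewrite mulNr oppr_le0 mulr_ge0// ltW.
  by rewrite addr0 (gtr0_norm t0); exact: pos.
- by rewrite abs_k0 normr0 subr0 normr0 invr_ge0.
Qed.

Lemma abs_k_cvg t : abs_k k t @[k --> \oo] --> `|t|.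
Proof.
apply/cvgrPdist_le => e e0; have [K HK] := invS_le_eps e0.
by exists K => // k /HK h /=; apply: le_trans h; exact: abs_k_close.
Qed.

(** A bounded substitute for [1 / t]: its rescalings [rho_k] tend to [1 / t] and
    satisfy [rho_k ^+ 2 <= - (4 / 3) * rho_k'] on the half-line, as [1 / t] does
    with the constant [1]. *)
Definition rho t : R := (t + 2) / ((t + 2) ^+ 2 + 1).
Definition rho' t : R := (1 - (t + 2) ^+ 2) / ((t + 2) ^+ 2 + 1) ^+ 2.

Lemma rho_den t : (t + 2) ^+ 2 + 1 != 0 :> R.
Proof. by rewrite gt_eqF// ltr_wpDl// sqr_ge0. Qed.

Lemma smooth1_rho : smooth1 rho.
Proof.
have l k : Dk k (fun t : R => t + 2) by apply: Dk_add; [exact: Dk_id|exact: Dk_cst].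
move=> k; apply: Dk_mul => //; apply: Dk_inv; first exact: rho_den.
by apply: Dk_add; [exact: Dk_mul|exact: Dk_cst].
Qed.

Lemma is_derive_rho t : is_derive t 1 rho (rho' t).
Proof.
have d1 : is_derive t 1 (fun s : R => s + 2) 1.
  by apply: is_derive_eq (is_deriveD (is_derive_id t 1) (is_derive_cst (2 : R) t 1)) _; rewrite addr0.
have d2 : is_derive t 1 (fun s : R => (s + 2) ^+ 2 + 1) (2 * (t + 2)).
  apply: is_derive_eq (is_deriveD (is_deriveM d1 d1) (is_derive_cst (1 : R) t 1)) _.
  by rewrite addr0 /GRing.scale/=; ring.
pose q s := (s + 2) ^+ 2 + 1; have d3 := is_deriveV (rho_den t : q t != 0) d2.
apply: is_derive_eq (is_deriveM d1 d3) _.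
rewrite /rho' /GRing.scale/= /q; have := rho_den t; set s := t + 2 => h0.
by field.
Qed.

Definition rho_k k t : R := k.+1%:R * rho (k.+1%:R * t).
Definition rho_k' k t : R := k.+1%:R ^+ 2 * rho' (k.+1%:R * t).

Lemma smooth1_rho_k k (c : R) : smooth1 (fun t => rho_k k t - c).
Proof.
move=> j; apply: Dk_add; last exact: Dk_cst.
apply: Dk_mul; first exact: Dk_cst.
rewrite (_ : (fun t => _) = fun t => rho (k.+1%:R * t + 0)).
  by apply: (Dk_comp (Dk_linear j _ 0)); exact: smooth1_rho.
by apply/funext => t; rewrite addr0.
Qed.

Lemma is_derive_rho_k k c t : is_derive t 1 (fun t => rho_k k t - c) (rho_k' k t).
Proof.
have h : is_derive t 1 (fun t => rho (k.+1%:R * t)) (rho' (k.+1%:R * t) * k.+1%:R).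
  rewrite (_ : (fun t => _) = fun t => rho (k.+1%:R * t + 0)); last first.
    by apply/funext => s; rewrite addr0.
  apply: is_derive_eq (@is_derive1_comp _ rho (fun t => k.+1%:R * t + 0) t _ _
    (is_derive_rho _) (is_derive_linear k.+1%:R 0 t)) _.
  by rewrite addr0.
have h2 := is_deriveM (is_derive_cst (k.+1%:R : R) t 1) h.
apply: is_derive_eq (is_deriveD h2 (is_derive_cst (- c) t 1)) _.
by rewrite addr0 scaler0 addr0 /GRing.scale/= /rho_k'; ring.
Qed.

Lemma rho_k'_bound k t : `|rho_k' k t| <= k.+1%:R ^+ 2.
Proof.
rewrite /rho_k' normrM ger0_norm ?sqr_ge0// ler_piMr ?sqr_ge0// /rho'.
set s := _ + 2; have s0 : 0 <= s ^+ 2 by exact: sqr_ge0.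
have d0 : 0 < (s ^+ 2 + 1) ^+ 2 by rewrite exprn_gt0// ltr_wpDl.
rewrite normrM normfV (gtr0_norm d0) ler_pdivrMr// mul1r ler_norml.
by apply/andP; split; nra.
Qed.

Lemma rho_k_sqr k t : 0 <= t -> rho_k k t ^+ 2 <= - (4 / 3) * rho_k' k t.
Proof.
move=> t0; rewrite /rho_k /rho_k' exprMn [leRHS]mulrCA ler_wpM2l ?sqr_ge0//.
have : 2 <= k.+1%:R * t + 2 by rewrite lerDr mulr_ge0.
rewrite /rho /rho'; set s := _ + 2 => s2.
have d0 : 0 < (s ^+ 2 + 1) ^+ 2 by rewrite exprn_gt0// ltr_wpDl// sqr_ge0.
rewrite expr_div_n mulrA ler_pM2r ?invr_gt0//; nra.
Qed.

Lemma rho_k_bounds k t : 0 < t -> (t + 3 / k.+1%:R)^-1 <= rho_k k t <= t^-1.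
Proof.
move=> t0; rewrite /rho_k /rho; have k0 : 0 < k.+1%:R :> R by [].
set K : R := k.+1%:R in k0 *; have Kt : 0 < K * t by rewrite mulr_gt0.
have d0 : 0 < (K * t + 2) ^+ 2 + 1 by rewrite ltr_wpDl// sqr_ge0.
have Kt3 : 0 < K * t + 3 by rewrite addr_gt0.
have -> : (t + 3 / K)^-1 = K / (K * t + 3).
  by rewrite -[K / _]invrK invf_div; congr (_^-1); field; rewrite gt_eqF.
apply/andP; split.
  rewrite ler_pdivrMr ?addr_gt0// mulrA mulrAC ler_pdivlMr//.
  by rewrite -mulrA ler_pM2l//; nra.
by rewrite mulrA ler_pdivrMr// [leRHS]mulrC ler_pdivlMr//; nra.
Qed.

Lemma rho_k_ge0 k t : 0 <= t -> 0 <= rho_k k t.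
Proof.
move=> t0; rewrite /rho_k /rho mulr_ge0// divr_ge0//.
  by rewrite addr_ge0// mulr_ge0.
by rewrite addr_ge0// sqr_ge0.
Qed.

Lemma rho_k_cvg t : 0 < t -> rho_k k t @[k --> \oo] --> t^-1.
Proof.
move=> t0; apply/cvgrPdist_le => e e0.
have [|K HK] := @invS_le_eps R (e * t ^+ 2 / 3).
  by rewrite divr_gt0// mulr_gt0// exprn_gt0.
exists K => // k /HK h /=; have /andP[h1 h2] := rho_k_bounds k t0.
rewrite ger0_norm ?subr_ge0//.
have k0 : 0 < k.+1%:R :> R by [].
set d := 3 / k.+1%:R in h1; have d0 : 0 < d by rewrite divr_gt0.
apply: (@le_trans _ _ (t^-1 - (t + d)^-1)); first by rewrite lerD2l lerN2.
have td : 0 < t + d by rewrite addr_gt0.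
have -> : t^-1 - (t + d)^-1 = d / (t * (t + d)) by field; rewrite !gt_eqF.
rewrite ler_pdivrMr ?mulr_gt0//.
have hd : d <= e * t ^+ 2.
  by move: h; rewrite ler_pdivlMr// /d mulrC.
apply: le_trans hd _; rewrite ler_pM2l// expr2 ler_pM2l//.
by rewrite lerDl ltW.
Qed.

End auxiliary_functions.

(** * The nonlinearity and its truncation *)

Section nonlinearity.
Context (R : realType).
Variable al : R.
Hypotheses (al0 : 0 < al) (al1 : al < 1).
Implicit Types (a m n s t : R).

Lemma ge0_powR_le (r m n : R) : 0 <= r -> 0 <= m -> m <= n -> m `^ r <= n `^ r.
Proof. by move=> r0 m0 mn; apply: ge0_ler_powR; rewrite // nnegrE// (le_trans m0). Qed.

Lemma powRN_le m n : 0 < m -> m <= n -> n `^ (- al) <= m `^ (- al).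
Proof.
move=> m0 mn; have n0 := lt_le_trans m0 mn.
by rewrite !powRN lef_pV2 ?posrE ?powR_gt0// ge0_powR_le// ltW.
Qed.

(** Young, from two tangent lines of the exponential at [(1 - al) * ln s]. *)
Lemma powR_le_linear (s : R) : 0 < s -> s `^ (1 - al) <= al + (1 - al) * s.
Proof.
move=> s0; set y := ln s; have sE : s = expR y by rewrite lnK// posrE.
have -> : s `^ (1 - al) = expR ((1 - al) * y) by rewrite /powR gt_eqF.
rewrite {1}sE; set e := expR _.
have e0 : 0 < e by exact: expR_gt0.
have h1 : e * (1 + al * y) <= expR y.
  have -> : expR y = e * expR (al * y) by rewrite /e -expRD; congr expR; ring.
  by rewrite ler_pM2l// expR_ge1Dx.
have h2 : e * (1 - (1 - al) * y) <= 1.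
  have e1 : e * expR (- ((1 - al) * y)) = 1 by rewrite /e -expRD subrr expR0.
  by rewrite -[leRHS]e1 ler_pM2l// expR_ge1Dx.
have h3 : (1 - al) * (e * (1 + al * y)) <= (1 - al) * expR y by rewrite ler_wpM2l// subr_ge0 ltW.
have h4 : al * (e * (1 - (1 - al) * y)) <= al * 1 by rewrite ler_wpM2l// ltW.
have -> : e = (1 - al) * (e * (1 + al * y)) + al * (e * (1 - (1 - al) * y)) by ring.
by rewrite addrC; apply: lerD => //; rewrite -[leRHS]mulr1.
Qed.

Lemma powR_concave m n : 0 < m -> 0 < n ->
  m `^ (1 - al) / (1 - al) <= n `^ (1 - al) / (1 - al) + n `^ (- al) * (m - n).
Proof.
move=> m0 n0; have b0 : 0 < 1 - al by rewrite subr_gt0.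
have nE : n `^ (1 - al) = n * n `^ (- al).
  by rewrite powRD ?powRr1 ?ltW// gt_eqF// implybT.
have mE : m `^ (1 - al) = n `^ (1 - al) * (m / n) `^ (1 - al).
  by rewrite -powRM ?divr_ge0 ?ltW// mulrC divfK// gt_eqF.
rewrite mE nE; have p0 : 0 < n `^ (- al) by exact: powR_gt0.
have h := powR_le_linear (divr_gt0 m0 n0).
move: (n `^ (- al)) ((m / n) `^ (1 - al)) p0 h => p q p0 h.
rewrite ler_pdivrMr// mulrDl divfK ?gt_eqF//.
have -> : n * p + p * (m - n) * (1 - al) = n * p * (al + (1 - al) * (m / n)).
  by field; rewrite gt_eqF.
by rewrite ler_pM2l// mulr_gt0.
Qed.

(** The nonlinearity frozen below the level [a], and its primitive, extended
    below [a] by its tangent line. *)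
Definition fcut a t : R := Num.max a t `^ (- al).
Definition Fcut a t : R :=
  Num.max a t `^ (1 - al) / (1 - al) + fcut a t * (t - Num.max a t).

Lemma max_gt0 a t : 0 < a -> 0 < Num.max a t.
Proof. by move=> a0; rewrite lt_max a0. Qed.

Lemma fcut_ge0 a t : 0 <= fcut a t. Proof. exact: powR_ge0. Qed.

Lemma fcut_le a t : 0 < a -> fcut a t <= a `^ (- al).
Proof. by move=> a0; apply: powRN_le; rewrite ?le_max ?lexx. Qed.

Lemma fcut_above a t : a <= t -> fcut a t = t `^ (- al).
Proof. by move=> at_; rewrite /fcut max_r. Qed.

Lemma fcut_below a t : t <= a -> fcut a t = a `^ (- al).
Proof. by move=> ta; rewrite /fcut max_l. Qed.

(** Concavity of the primitive, in the form of its tangent lines. *)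
Lemma Fcut_tangent a s t : 0 < a -> Fcut a t <= Fcut a s + fcut a s * (t - s).
Proof.
move=> a0; have h := powR_concave (max_gt0 t a0) (max_gt0 s a0).
rewrite -/(fcut a s) in h; rewrite /Fcut.
have k : 0 <= (fcut a t - fcut a s) * (Num.max a t - t).
  case: (leP a t) => ta; first by rewrite subrr mulr0.
  rewrite mulr_ge0 ?subr_ge0 ?(ltW ta)// (fcut_below (ltW ta)); exact: fcut_le.
move: h k; move: (fcut a s) (fcut a t) => fs ft.
move: (Num.max a t `^ _ / _) (Num.max a s `^ _ / _) => A B.
by move: (Num.max a s) (Num.max a t) => ms mt h k; lra.
Qed.

Lemma Fcut_lipschitz a s t : 0 < a ->
  `|Fcut a t - Fcut a s| <= a `^ (- al) * `|t - s|.
Proof.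
move=> a0.
have h p q : Fcut a p - Fcut a q <= a `^ (- al) * `|p - q|.
  have := Fcut_tangent q p a0; rewrite addrC -lerBlDr => h; apply: le_trans h _.
  apply: (@le_trans _ _ (fcut a q * `|p - q|)).
    by rewrite ler_wpM2l ?fcut_ge0// ler_norm.
  by rewrite ler_wpM2r// fcut_le.
by rewrite ler_norml h andbT lerNl opprB distrC h.
Qed.

Lemma Fcut_mid a s t : 0 < a ->
  2^-1 * Fcut a s + 2^-1 * Fcut a t <= Fcut a (2^-1 * (s + t)).
Proof.
move=> a0; set m := 2^-1 * (s + t).
have h1 := Fcut_tangent m s a0; have h2 := Fcut_tangent m t a0.
have e : s - m = - (t - m) by rewrite /m; lra.
rewrite e mulrN in h1; move: (fcut a m * _) (Fcut a m) h1 h2 => p q h1 h2; lra.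
Qed.

Lemma fcut_cvg a t (t_ : nat -> R) : 0 < a -> t_ n @[n --> \oo] --> t ->
  fcut a (t_ n) @[n --> \oo] --> fcut a t.
Proof.
move=> a0 ct; have m0 := max_gt0 t a0.
have cm : Num.max a (t_ n) @[n --> \oo] --> Num.max a t.
  apply/cvgrPdist_le => e e0; have /cvgrPdist_le /(_ e e0) := ct.
  apply: filterS => n; apply: le_trans.
  have h3 := ler_norm (t - t_ n); have := ler_norm (t_ n - t); rewrite distrC => h4.
  by case: (leP a t) => h1; case: (leP a (t_ n)) => h2; rewrite ler_norml; apply/andP; split; lra.
have d := is_derive1_powR (- al) m0.
have := @is_derive1_continuous R _ _ _ d.
by move=> /(continuous_cvg _)/(_ cm).
Qed.

End nonlinearity.

(** * Truncated problem: existence of a solution *)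

Section minimizing_sequences.
Context (R : realType) (T : Type).

Lemma minimizing_sequence (P : set T) (J : T -> R) (m : R) :
  P !=set0 -> (forall x, P x -> m <= J x) ->
  exists (j : R) (x_ : nat -> T), (forall x, P x -> j <= J x) /\
    forall n, P (x_ n) /\ J (x_ n) <= j + n.+1%:R^-1.
Proof.
move=> [x0 Px0] lb; pose A := [set J x | x in P].
have A0 : A !=set0 by exists (J x0); exists x0.
have lA : has_lbound A by exists m => _ [x Px <-]; exact: lb.
have h n : exists x, P x /\ J x <= inf A + n.+1%:R^-1.
  have [|_ [x Px <-] xe] := @inf_adherent _ A n.+1%:R^-1 _ (conj A0 lA).
    by rewrite invr_gt0.
  by exists x; split=> //; exact: ltW.
have [x_ hx] := choice h; exists (inf A), x_; split=> // x Px.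
by apply: ge_inf => //; exists x.
Qed.

Lemma norm_le_sqrt_mul (a b c : R) : 0 <= b -> a ^+ 2 <= b * c ->
  `|a| <= Num.sqrt b * Num.sqrt c.
Proof. by move=> b0 h; rewrite -sqrtrM// -sqrtr_sqr ler_wsqrtr. Qed.

End minimizing_sequences.

Section singular_problem.
Context (R : realType) (N : nat) (U : set 'rV[R]_N) (al : R).
Hypotheses (N0 : (0 < N)%N) (oU : open U) (bU : bounded_set U).
Hypotheses (al0 : 0 < al) (al1 : al < 1).
Local Notation mu := (@lebesgue_rV R N).
Local Notation summ := (summable_fun mu U).
Local Notation I f := (Rintegral mu U f).
Implicit Types (a b g u v w z : 'rV[R]_N -> R).
Let mU := domain_measurable oU.

Lemma ge0_integral_le_summable (f : 'rV[R]_N -> R) (c : R) : measurable_fun U f ->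
  (forall x, 0 <= f x) -> (\int[mu]_(x in U) (f x)%:E <= c%:E)%E ->
  summ f /\ I f <= c.
Proof.
move=> mf f0 fc; have sf : summ f.
  apply/integrableP; split; first exact/measurable_EFinP.
  rewrite (@le_lt_trans _ _ c%:E)// ?ltry//; apply: le_trans fc.
  rewrite (_ : (fun x => `|_|%E) = fun x => (f x)%:E)//.
  by apply/funext => x /=; rewrite ger0_norm.
by split=> //; rewrite -lee_fin RintegralE.
Qed.

Lemma en_cs_sqrt u v : H10 U u -> H10 U v ->
  `|en U u v| <= Num.sqrt (en U u u) * Num.sqrt (en U v v).
Proof.
by move=> hu hv; apply: norm_le_sqrt_mul; [exact: en_ge0|exact: (en_cs oU bU hu hv)].
Qed.

Lemma measurable_powR_comp (p : R) u : measurable_fun U u ->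
  measurable_fun U (fun x => u x `^ p).
Proof. by move=> mu_; apply: (measurableT_comp (measurable_powR p)). Qed.

(** The weights that, as functionals, belong to the dual of [H10]. *)
Definition hardy_weight g := exists C : R, 0 <= C /\ forall v, H10 U v ->
  summ (fun x => g x * `|v x|) /\ I (fun x => g x * `|v x|) <= C * Num.sqrt (en U v v).

(** Test the inequality of the supersolution with smooth approximations of [|v|],
    whose energy is at most that of [v], and pass to the limit by Fatou. *)
Lemma hardy_weight_supersolution z : supersolution U al z ->
  hardy_weight (fun x => z x `^ (- al)).
Proof.
move=> [hz _ sz]; exists (Num.sqrt (en U z z)); split; first exact: sqrtr_ge0.
move=> v hv; pose w k x := abs_k k (v x).
have mz : measurable_fun U z := L2_meas (H10_L2 oU hz).
have mv : measurable_fun U v := L2_meas (H10_L2 oU hv).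
have hw k := H10_comp oU bU (@smooth1_abs_k R k) (abs_k0 R k) (is_derive_abs_k k)
  (smooth1_deriv_continuous (@smooth1_abs_k R k) (is_derive_abs_k k)) (abs_k'_le1 k) hv.
have enw k : en U (w k) (w k) <= en U v v.
  apply: ler_sum => i _; rewrite -!n2E.
  apply: n2_le => //; [exact: L2_meas (gr_L2 oU i (hw k).1)|exact: gr_L2|].
  by apply: aeDW ((hw k).2 i) => x _ ->; rewrite normrM ler_piMl// abs_k'_le1.
have mw k : measurable_fun U (w k) := L2_meas (H10_L2 oU (hw k).1).
have key k : summ (fun x => z x `^ (- al) * w k x) /\
    I (fun x => z x `^ (- al) * w k x) <= Num.sqrt (en U z z) * Num.sqrt (en U v v).
  apply: ge0_integral_le_summable.
  - by apply: measurable_funM => //; exact: measurable_powR_comp.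
  - by move=> x; rewrite mulr_ge0 ?powR_ge0// abs_k_ge0.
  have := sz (w k) (hw k).1 (aeD_all mu (fun x _ => abs_k_ge0 k (v x))).
  rewrite (dirichletE oU hz (hw k).1) -/(singular U al z (w k)) => h.
  apply: (@le_trans _ _ (en U z (w k))%:E).
    by move: h; case: (singular _ _ _ _) => [r| |]//=; rewrite ?leNye// !lee_fin subr_ge0.
  rewrite lee_fin; apply: le_trans (ler_norm _) _; apply: le_trans (en_cs_sqrt hz (hw k).1) _.
  by apply: ler_wpM2l; [exact: sqrtr_ge0|apply: ler_wsqrtr; exact: enw].
have [] // := @Rintegral_fatou _ _ _ mu U mU (fun k x => z x `^ (- al) * w k x)
  (fun x => z x `^ (- al) * `|v x|) _ (fun k => (key k).1) _ _ _ (fun k => (key k).2).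
- by move=> k; apply: aeD_all => x _; rewrite mulr_ge0 ?powR_ge0// abs_k_ge0.
- by apply: measurable_funM; [exact: measurable_powR_comp|exact: measurableT_comp].
- by apply: aeD_all => x _; apply: cvgMr; exact: abs_k_cvg.
Qed.

Lemma hardy_weight_le g g' (K : R) : measurable_fun U g' -> 0 <= K -> hardy_weight g ->
  aeD mu U (fun x => 0 <= g' x <= K * g x) -> hardy_weight g'.
Proof.
move=> mg' K0 [C [C0 hC]] gg'; exists (K * C); split; first exact: mulr_ge0.
move=> v hv; have [sv Iv] := hC v hv.
have sKv := summableZ mU K sv.
have mv : measurable_fun U v := L2_meas (H10_L2 oU hv).
have le : aeD mu U (fun x => g' x * `|v x| <= K * (g x * `|v x|)).
  by apply: aeDW gg' => x _ /andP[g0 gK]; rewrite mulrA ler_wpM2r.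
have s' : summ (fun x => g' x * `|v x|).
  apply: (summable_le mU _ _ sKv).
    by apply: measurable_funM => //; exact: measurableT_comp.
  by apply: aeD2 gg' le => x _ /andP[g0 _]; rewrite normrM normr_id (ger0_norm g0).
split=> //; apply: (le_trans (Rintegral_ae_le mU s' sKv le)).
by rewrite Rintegral_scale// -mulrA ler_wpM2l.
Qed.

Lemma summable_hardy g b v : hardy_weight g -> H10 U v -> measurable_fun U b ->
  aeD mu U (fun x => 0 <= b x <= g x) -> summ (fun x => b x * v x).
Proof.
move=> [C [C0 hC]] hv mb bg; have [sv _] := hC v hv.
apply: (summable_le mU _ _ sv).
  by apply: measurable_funM => //; exact: L2_meas (H10_L2 oU hv).
by apply: aeDW bg => x _ /andP[b0 bg]; rewrite normrM (ger0_norm b0) ler_wpM2r.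
Qed.

Section truncated.
Variable a : 'rV[R]_N -> R.
Hypotheses (ha : H10 U a) (a_gt0 : aeD mu U (fun x => 0 < a x)).
Hypothesis hardy_a : hardy_weight (fun x => a x `^ (- al)).
Let ma : measurable_fun U a := L2_meas (H10_L2 oU ha).

Lemma measurable_fcut u : measurable_fun U u ->
  measurable_fun U (fun x => fcut al (a x) (u x)).
Proof. by move=> mu_; apply: measurable_powR_comp; exact: measurable_maxr. Qed.

Lemma summable_fcut u v : measurable_fun U u -> H10 U v ->
  summ (fun x => fcut al (a x) (u x) * v x).
Proof.
move=> mu_ hv; apply: (summable_hardy hardy_a hv); first exact: measurable_fcut.
by apply: aeDW a_gt0 => x _ a0; rewrite fcut_ge0 fcut_le.
Qed.

Let D u x := Fcut al (a x) (u x) - Fcut al (a x) 0.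
Let J u := 2^-1 * en U u u - I (D u).

Let mD u : measurable_fun U u -> measurable_fun U (D u).
Proof.
have h w : measurable_fun U w -> measurable_fun U (fun x => Fcut al (a x) (w x)).
  move=> mw; have mm : measurable_fun U (fun x => Num.max (a x) (w x)) by exact: measurable_maxr.
  apply: measurable_funD; first by apply: measurable_funM => //; exact: measurable_powR_comp.
  by apply: measurable_funM; [exact: measurable_fcut|exact: measurable_funB].
by move=> mu_; apply: measurable_funB; apply: h.
Qed.

Let sD u : H10 U u -> summ (D u).
Proof.
move=> hu; have [C [_ hC]] := hardy_a; apply: (summable_le mU _ _ (hC u hu).1).
  by apply: mD; exact: (H10_meas oU).
by apply: aeDW a_gt0 => x _ a0; rewrite -[u x in leRHS]subr0; exact: Fcut_lipschitz.
Qed.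

Let D_le C u v : (forall v, H10 U v -> summ (fun x => a x `^ (- al) * `|v x|) /\
    I (fun x => a x `^ (- al) * `|v x|) <= C * Num.sqrt (en U v v)) ->
  H10 U u -> H10 U v ->
  I (D u) <= I (D v) + C * Num.sqrt (en U (fun x => u x - v x) (fun x => u x - v x)).
Proof.
move=> hC hu hv; have hd := H10_sub oU bU hu hv; have [sd Id] := hC _ hd.
apply: (@le_trans _ _ (I (fun x => D v x + a x `^ (- al) * `|u x - v x|))).
  apply: Rintegral_ae_le => //; [exact: sD|by apply: summableD => //; exact: sD|].
  apply: aeDW a_gt0 => x _ a0; rewrite /D -lerBlDl.
  rewrite (_ : _ - _ = Fcut al (a x) (u x) - Fcut al (a x) (v x)); last by ring.
  by apply: le_trans (ler_norm _) _; exact: Fcut_lipschitz.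
by rewrite Rintegral_add// ?lerD2l//; exact: sD.
Qed.

(** By the parallelogram law and the concavity of the primitive, minimizing
    sequences are Cauchy in the Dirichlet norm. *)
Lemma truncated_minimizer : exists u, H10 U u /\ forall v, H10 U v -> J u <= J v.
Proof.
have [C [C0 hC]] := hardy_a.
have D0 : I (D (cst 0)) = 0.
  rewrite (_ : D (cst 0) = cst 0) ?Rintegral_zero//.
  by apply/funext => x; rewrite /D subrr.
have h0 : H10 U (cst 0).
  have := (H10_scale oU bU 0 ha).1; rewrite (_ : (fun x => _) = cst 0)//.
  by apply/funext => x; rewrite mul0r.
have lb u : H10 U u -> - (2^-1 * C ^+ 2) <= J u.
  move=> hu; have := D_le hC hu h0; rewrite D0 add0r.
  rewrite (_ : (fun x => u x - cst 0 x) = u); last by apply/funext => x; rewrite subr0.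
  move=> h; have : Num.sqrt (en U u u) ^+ 2 = en U u u by rewrite sqr_sqrtr// en_ge0.
  move: h; rewrite /J; move: (Num.sqrt _) => s; move: (en U u u) (I _) => E i h <-.
  by have := sqr_ge0 (s - C); nra.
have [j [u_ [hj hu_]]] := @minimizing_sequence _ _ (H10 U) J _ (ex_intro _ a ha) lb.
have hu n := (hu_ n).1.
have cau e : 0 < e -> exists K, forall m n, (K <= m)%N -> (K <= n)%N ->
    en U (fun x => u_ m x - u_ n x) (fun x => u_ m x - u_ n x) <= e.
  move=> e0; have [|K HK] := @invS_le_eps R (e / 8); first by rewrite divr_gt0.
  exists K => m n Km Kn.
  have hs := (H10_add oU bU (hu m) (hu n)).1; have hm := (H10_scale oU bU 2^-1 hs).1.
  have := hj _ hm; rewrite /J (en_mid oU bU (hu m) (hu n)).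
  have DD : 2^-1 * I (D (u_ m)) + 2^-1 * I (D (u_ n)) <=
      I (D (fun x => 2^-1 * (u_ m x + u_ n x))).
    have sm := sD (hu m); have sn := sD (hu n).
    have sm2 := summableZ mU 2^-1 sm; have sn2 := summableZ mU 2^-1 sn.
    rewrite -!(Rintegral_scale mU)// -(Rintegral_add mU)//.
    apply: Rintegral_ae_le => //; [exact: summableD|exact: sD|].
    apply: aeDW a_gt0 => x _ a0; have := Fcut_mid al0 al1 (u_ m x) (u_ n x) a0.
    by rewrite /D; lra.
  have := HK m Km; have := HK n Kn; have := (hu_ m).2; have := (hu_ n).2; rewrite /J.
  move: (m.+1%:R^-1) (n.+1%:R^-1) DD => r s.
  move: (I _) (I _) (I _) => p q t.
  move: (en U _ _) (en U _ _) (en U _ _) => f g h *; lra.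
have [u [Hu cu]] := H10_complete oU bU N0 hu cau; exists u; split=> // v hv.
apply/ler_addgt0Pr => e e0.
pose C' := Num.sqrt (en U u u) + C.
have C'0 : 0 <= C' by rewrite addr_ge0// sqrtr_ge0.
pose dl := e / (2 * (C' + 1)).
have dl0 : 0 < dl by rewrite divr_gt0// mulr_gt0// ltr_wpDl.
have [K1 HK1] := (cvg0_epsP (fun n => en_ge0 U _)).1 cu (dl ^+ 2) (exprn_gt0 2 dl0).
have [|K2 HK2] := @invS_le_eps R (e / 2); first by rewrite divr_gt0.
pose n := maxn K1 K2.
have h1 := HK1 n (leq_maxl _ _); have h2 := HK2 n (leq_maxr _ _).
have hd := H10_sub oU bU (hu n) Hu.
(* Only the linear terms in the difference [d] matter: its square helps. *)
pose d x := u_ n x - u x; pose ed := en U d d; pose sd := Num.sqrt ed.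
pose enn := en U (u_ n) (u_ n); pose enu := en U (u_ n) u; pose eu := en U u u.
pose su := Num.sqrt eu.
have sq : sd <= dl by rewrite -(ger0_norm (ltW dl0)) -sqrtr_sqr ler_wsqrtr.
have i1 : I (D (u_ n)) <= I (D u) + C * sd := D_le hC (hu n) Hu.
have i2 : ed = enn - 2 * enu + eu := en_sub_quad oU bU (hu n) Hu.
have i3 : - (sd * su) <= enu - eu.
  rewrite -(en_subl oU bU (hu n) Hu Hu : _ = enu - eu).
  by have := en_cs_sqrt hd Hu; rewrite ler_norml => /andP[].
have i4 := hj v hv; have i5 : 2^-1 * enn - I (D (u_ n)) <= j + n.+1%:R^-1 := (hu_ n).2.
have i6 : 0 <= ed := en_ge0 U d.
have i7 : C' * dl <= e / 2.
  have -> : e / 2 = (C' + 1) * dl by rewrite /dl; field; rewrite gt_eqF// ltr_wpDl.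
  by apply: ler_wpM2r; [exact: ltW|rewrite lerDl].
have i8 : su * sd <= su * dl by rewrite ler_wpM2l ?sqrtr_ge0.
have i9 : C * sd <= C * dl by rewrite ler_wpM2l.
rewrite -[J u]/(2^-1 * eu - I (D u)).
move: i1 i2 i3 i4 i5 i6 i7 i8 i9 h2; rewrite /C'.
rewrite -[Num.sqrt _]/su; move: (n.+1%:R^-1 : R) (J v) (I (D u)) (I (D (u_ n))).
move: ed sd enn enu eu su dl {dl0 h1 HK1 sq}; clear => *; lra.
Qed.

(** The Euler-Lagrange equation of the minimizer, by difference quotients and
    dominated convergence. *)
Lemma truncated_solution : exists u, H10 U u /\ forall v, H10 U v ->
  en U u v = I (fun x => fcut al (a x) (u x) * v x).
Proof.
have [u [hu min]] := truncated_minimizer; exists u; split=> //.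
suff half v : H10 U v -> I (fun x => fcut al (a x) (u x) * v x) <= en U u v.
  move=> v hv; apply/eqP; rewrite eq_le half// andbT.
  have := half _ (H10_opp oU bU hv); rewrite en_sym (en_oppl oU bU hv hu) (en_sym U v u).
  have s := summable_fcut (H10_meas oU hu) hv.
  rewrite (_ : (fun x => _ * - v x) = fun x => - (fcut al (a x) (u x) * v x)).
    by rewrite Rintegral_opp// lerN2.
  by apply/funext => x; rewrite mulrN.
move=> hv; pose t n : R := n.+1%:R^-1.
have t0 n : 0 < t n by rewrite invr_gt0.
pose ut n x := u x + t n * v x.
have hut n : H10 U (ut n) := (H10_add oU bU hu (H10_scale oU bU (t n) hv).1).1.
have st n := summable_fcut (H10_meas oU (hut n)) hv.
have step n : I (fun x => fcut al (a x) (ut n x) * v x) <= en U u v + t n * (2^-1 * en U v v).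
  have := min _ (hut n); rewrite /J (en_quad oU bU (t n) hu hv).
  have k : t n * I (fun x => fcut al (a x) (ut n x) * v x) <= I (D (ut n)) - I (D u).
    have s1 := sD (hut n); have s2 := sD hu.
    rewrite -(Rintegral_sub mU)// -(Rintegral_scale mU)//.
    apply: Rintegral_ae_le => //; [exact: summableZ|exact: summableB|].
    apply: aeDW a_gt0 => x _ a0; have := Fcut_tangent al0 al1 (ut n x) (u x) a0.
    rewrite /D (_ : u x - ut n x = - (t n * v x)); last by rewrite /ut; ring.
    by move: (fcut _ _ _) (Fcut _ _ _) (Fcut _ _ _) (Fcut _ _ _) => *; lra.
  move: k (t0 n); move: (I (D _)) (I (D _)) (t n) => p q r k r0 h.
  rewrite -(ler_pM2l r0); apply: le_trans k _.
  move: (en U u u) (en U u v) (en U v v) h => A B E h.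
  have -> : r * (B + r * (2^-1 * E)) = 2^-1 * (A + 2 * r * B + r ^+ 2 * E) - 2^-1 * A by field.
  lra.
have tc : t n @[n --> \oo] --> (0 : R) by exact: cvg_harmonic.
have [C [C0 hC]] := hardy_a.
have [||_ lim] := @Rintegral_dominated _ _ _ mu U mU (fun n x => fcut al (a x) (ut n x) * v x)
  (fun x => fcut al (a x) (u x) * v x) _ (fun n => summable_meas (st n))
  (summable_meas (summable_fcut (H10_meas oU hu) hv)) _ (hC v hv).1.
- apply: aeDW a_gt0 => x _ a0.
  have c : fcut al (a x) (ut n x) @[n --> \oo] --> fcut al (a x) (u x).
    apply: fcut_cvg => //; rewrite -[u x]addr0 -[X in _ + X](mul0r (v x)).
    by apply: cvgD; [exact: cvg_cst|exact: cvgMl].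
  exact: cvgMl.
- move=> n; apply: aeDW a_gt0 => x _ a0.
  by rewrite normrM ger0_norm ?fcut_ge0// ler_wpM2r// fcut_le.
have lim2 : en U u v + t n * (2^-1 * en U v v) @[n --> \oo] --> en U u v.
  rewrite -[X in _ --> X]addr0 -[X in _ + X](mul0r (2^-1 * en U v v)).
  by apply: cvgD; [exact: cvg_cst|exact: cvgMl].
by apply: (ler_cvg_to lim lim2); apply: nearW.
Qed.

End truncated.

End singular_problem.

(** * Comparison, existence and uniqueness *)

Section comparison.
Context (R : realType) (N : nat) (U : set 'rV[R]_N) (al : R).
Hypotheses (N0 : (0 < N)%N) (oU : open U) (bU : bounded_set U).
Hypotheses (al0 : 0 < al) (al1 : al < 1).
Local Notation mu := (@lebesgue_rV R N).
Local Notation summ := (summable_fun mu U).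
Local Notation I f := (Rintegral mu U f).
Implicit Types (a b g u v w z : 'rV[R]_N -> R).
Let mU := domain_measurable oU.

Lemma eta'_norm (t : R) : `|eta' t| <= 1.
Proof. by rewrite ger0_norm ?eta'_ge0// eta'_le1. Qed.

Lemma H10_eta w : H10 U w -> H10 U (fun x => eta (w x)) /\
  forall i, aeD mu U (fun x => gr U (fun x => eta (w x)) i x = eta' (w x) * gr U w i x).
Proof.
exact: (H10_comp oU bU (@smooth1_eta R) (eta0 R) (@is_derive_eta R)
  (smooth1_deriv_continuous (@smooth1_eta R) (@is_derive_eta R)) eta'_norm).
Qed.

(** Since [0 <= eta' <= 1], the energy of [eta (w)] is at most the pairing of
    [w] with [eta (w)], so that [eta (w)] vanishes. *)
Lemma weak_maximum_principle w : H10 U w -> en U w (fun x => eta (w x)) <= 0 ->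
  aeD mu U (fun x => w x <= 0).
Proof.
move=> hw ew; have [hphi gphi] := H10_eta hw; set phi := fun x => eta (w x) in hphi gphi ew.
have [C [C0 hC]] := H10_poincare oU bU N0.
have le : en U phi phi <= 0.
  apply: le_trans ew; apply: ler_sum => i _; apply: Rintegral_ae_le => //.
  - by apply: L2_mul => //; exact: gr_L2.
  - by apply: L2_mul => //; exact: gr_L2.
  apply: aeDW (gphi i) => x _ ->; rewrite mulrCA [leRHS]mulrCA.
  apply: ler_wpM2l; first exact: eta'_ge0.
  by rewrite -mulrA -expr2 ler_piMl ?sqr_ge0// eta'_le1.
have n0 : n2 mu U phi <= 0 by apply: le_trans (hC _ hphi) _; rewrite pmulr_rle0.
apply: aeDW (n2_eq0 mU (H10_L2 oU hphi) n0) => x _ e.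
by rewrite leNgt; apply/negP => /eta_gt0; rewrite -/(phi x) e ltxx.
Qed.

Lemma subsolution_le a v : subsolution U al a -> hardy_weight U (fun x => a x `^ (- al)) ->
  H10 U v -> aeD mu U (fun x => 0 <= v x) ->
  summ (fun x => a x `^ (- al) * v x) /\ en U a v <= I (fun x => a x `^ (- al) * v x).
Proof.
move=> [ha _ sa] hg hv v0.
have s : summ (fun x => a x `^ (- al) * v x).
  apply: (summable_hardy oU hg hv); first by apply: measurable_powR_comp; exact: (H10_meas oU).
  by apply: aeD_all => x _; rewrite powR_ge0 lexx.
split=> //; have := sa v hv v0; rewrite (dirichletE oU ha hv) /singular -RintegralE//.
by rewrite lee_fin subr_le0.
Qed.

Lemma supersolution_ge b v : supersolution U al b ->
  H10 U v -> aeD mu U (fun x => 0 <= v x) ->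
  summ (fun x => b x `^ (- al) * v x) /\ I (fun x => b x `^ (- al) * v x) <= en U b v.
Proof.
move=> sb hv v0; have hg := hardy_weight_supersolution oU bU sb.
have [hb _ s_] := sb.
have s : summ (fun x => b x `^ (- al) * v x).
  apply: (summable_hardy oU hg hv); first by apply: measurable_powR_comp; exact: (H10_meas oU).
  by apply: aeD_all => x _; rewrite powR_ge0 lexx.
split=> //; have := s_ v hv v0; rewrite (dirichletE oU hb hv) /singular -RintegralE//.
by rewrite lee_fin subr_ge0.
Qed.

(** The supersolution transfers its integrability property to the weight of the
    subsolution, because the two are comparable. *)
Lemma hardy_weight_subsolution a b (K : R) : H10 U a -> supersolution U al b -> 0 < K ->
  aeD mu U (fun x => 0 < a x) -> aeD mu U (fun x => a x <= b x) ->
  aeD mu U (fun x => b x <= K * a x) -> hardy_weight U (fun x => a x `^ (- al)).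
Proof.
move=> ha sb K0 a0 ab bK.
apply: (hardy_weight_le oU (K := K `^ al)) (hardy_weight_supersolution oU bU sb) _.
- by apply: measurable_powR_comp; exact: (H10_meas oU).
- exact: powR_ge0.
apply: aeD3 a0 ab bK => x _ ax abx bx; rewrite powR_ge0/=.
have -> : a x `^ (- al) = K `^ al * (K * a x) `^ (- al).
  by rewrite powRM ?ltW// mulrA (powRN K) mulfV ?mul1r// gt_eqF// powR_gt0.
by rewrite ler_wpM2l ?powR_ge0// powRN_le// (lt_le_trans ax).
Qed.

Lemma solution_between a b : subsolution U al a -> supersolution U al b ->
  aeD mu U (fun x => 0 < a x) -> aeD mu U (fun x => a x <= b x) ->
  hardy_weight U (fun x => a x `^ (- al)) ->
  exists u, [/\ H10 U u, aeD mu U (fun x => a x <= u x), aeD mu U (fun x => u x <= b x)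
    & forall v, H10 U v -> summ (fun x => u x `^ (- al) * v x) /\
        en U u v = I (fun x => u x `^ (- al) * v x)].
Proof.
move=> sa sb a0 ab hg; have [ha _ _] := sa; have [hb _ _] := sb.
have [u [hu eu]] := truncated_solution N0 oU bU al0 al1 ha a0 hg.
have sf v (hv : H10 U v) := summable_fcut oU al0 ha a0 hg (H10_meas oU hu) hv.
have eta_pos w : aeD mu U (fun x => 0 <= eta (w x)) by apply: aeD_all => x _; exact: eta_ge0.
have au : aeD mu U (fun x => a x <= u x).
  have hw := H10_sub oU bU ha hu; have [hphi _] := H10_eta hw.
  have [s1 i1] := subsolution_le sa hg hphi (eta_pos _).
  have s2 := sf _ hphi; have i2 := eu _ hphi.
  apply: aeDW (weak_maximum_principle hw _) => [x _|]; first by rewrite subr_le0.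
  rewrite (en_subl oU bU ha hu hphi) i2 subr_le0; apply: le_trans i1 _.
  apply: Rintegral_ae_le => //; apply: aeD_all => x _.
  have [axu|axu] := lerP (a x) (u x); first by rewrite eta_le0 ?subr_le0// !mulr0.
  by rewrite fcut_below// ltW.
have ub : aeD mu U (fun x => u x <= b x).
  have hw := H10_sub oU bU hu hb; have [hphi _] := H10_eta hw.
  have [s1 i1] := supersolution_ge sb hphi (eta_pos _).
  have s2 := sf _ hphi; have i2 := eu _ hphi.
  apply: aeDW (weak_maximum_principle hw _) => [x _|]; first by rewrite subr_le0.
  rewrite (en_subl oU bU hu hb hphi) i2 subr_le0; apply: le_trans _ i1.
  apply: Rintegral_ae_le => //; apply: aeD2 a0 ab => x _ ax abx.
  have [uxb|uxb] := lerP (u x) (b x); first by rewrite eta_le0 ?subr_le0// !mulr0.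
  rewrite fcut_above ?(le_trans abx (ltW uxb))// ler_wpM2r ?eta_ge0// powRN_le// ?(ltW uxb)//.
  exact: lt_le_trans abx.
exists u; split=> // v hv.
have e : aeD mu U (fun x => u x `^ (- al) * v x = fcut al (a x) (u x) * v x).
  by apply: aeDW au => x _ h; rewrite fcut_above.
have m : measurable_fun U (fun x => u x `^ (- al) * v x).
  by apply: measurable_funM; [apply: measurable_powR_comp|]; exact: (H10_meas oU).
split; first exact: summable_ae_eq m e (sf v hv).
rewrite (eu v hv); apply: Rintegral_ae_eq => //; first exact: summable_meas (sf v hv).
by apply: aeDW e => x _ ->.
Qed.

Lemma weak_solutionE u : H10 U u ->
  (forall v, H10 U v -> summ (fun x => u x `^ (- al) * v x)) ->
  (weak_solution U al u <->
   forall v, H10 U v -> en U u v = I (fun x => u x `^ (- al) * v x)).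
Proof.
move=> hu s; split=> [[_ h] v hv|h].
  by have := h v hv; rewrite (dirichletE oU hu hv) /singular -(RintegralE mU (s v hv)) => -[].
split=> // v hv; rewrite (dirichletE oU hu hv) /singular -(RintegralE mU (s v hv)).
by rewrite (h v hv).
Qed.

(** The singular term is decreasing, so two solutions have a difference of
    nonpositive energy. *)
Lemma solution_unique a u v : aeD mu U (fun x => 0 < a x) ->
  hardy_weight U (fun x => a x `^ (- al)) ->
  weak_solution U al u -> weak_solution U al v ->
  aeD mu U (fun x => a x <= u x) -> aeD mu U (fun x => a x <= v x) ->
  aeD mu U (fun x => v x = u x).
Proof.
move=> a0 hg su sv au av; have [hu _] := su; have [hv _] := sv.
have summ_above z w : H10 U z -> aeD mu U (fun x => a x <= z x) -> H10 U w ->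
    summ (fun x => z x `^ (- al) * w x).
  move=> hz az hw; apply: (summable_hardy oU hg hw).
    by apply: measurable_powR_comp; exact: (H10_meas oU).
  by apply: aeD2 a0 az => x _ ax axz; rewrite powR_ge0 powRN_le.
have eu := (weak_solutionE hu (fun w => summ_above _ _ hu au)).1 su.
have ev := (weak_solutionE hv (fun w => summ_above _ _ hv av)).1 sv.
have hd := H10_sub oU bU hv hu; have [C [C0 hC]] := H10_poincare oU bU N0.
have le : en U (fun x => v x - u x) (fun x => v x - u x) <= 0.
  rewrite (en_subl oU bU hv hu hd) (eu _ hd) (ev _ hd) subr_le0.
  apply: Rintegral_ae_le => //; [exact: summ_above|exact: summ_above|].
  apply: aeD3 a0 au av => x _ ax axu axv.
  have [vu|uv] := lerP (v x) (u x).
    by rewrite ler_wnM2r ?subr_le0// powRN_le// (lt_le_trans ax).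
  by rewrite ler_wpM2r ?subr_ge0 ?(ltW uv)// powRN_le ?(ltW uv)// (lt_le_trans ax).
have n0 : n2 mu U (fun x => v x - u x) <= 0.
  by apply: le_trans (hC _ hd) _; rewrite pmulr_rle0.
by apply: aeDW (n2_eq0 mU (H10_L2 oU hd) n0) => x _ /eqP; rewrite subr_eq0 => /eqP.
Qed.

End comparison.

(** * The Hardy-type inequality of a positive solution *)

Section picone.
Context (R : realType) (N : nat) (U : set 'rV[R]_N) (al : R).
Hypotheses (oU : open U) (bU : bounded_set U) (al0 : 0 < al).
Local Notation mu := (@lebesgue_rV R N).
Local Notation summ := (summable_fun mu U).
Local Notation I f := (Rintegral mu U f).
Implicit Types (v w psi : 'rV[R]_N -> R).
Let mU := domain_measurable oU.

Variable u : 'rV[R]_N -> R.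
Hypotheses (hu : H10 U u) (u0 : aeD mu U (fun x => 0 < u x)).
Hypothesis su : forall v, H10 U v -> summ (fun x => u x `^ (- al) * v x) /\
  en U u v = I (fun x => u x `^ (- al) * v x).

(** Young's inequality behind Picone's: here [p] and [d] stand for [psi] and its
    derivative, [g] for the derivative of [u], [r] and [r'] for the values of
    [rho_k] and its derivative. *)
Lemma picone_pointwise (p d g r r' : R) : r ^+ 2 <= - (4 / 3) * r' ->
  g * (p * p * (r' * g) + 2 * (p * d) * r) <= 4 / 3 * (d * d).
Proof.
move=> h.
have h1 : 0 <= (g * p) ^+ 2 * (- (4 / 3) * r' - r ^+ 2) by rewrite mulr_ge0 ?sqr_ge0 ?subr_ge0.
have h2 := sqr_ge0 (4 * d - 3 * (g * p * r)).
have -> : 4 / 3 * (d * d) = g * (p * p * (r' * g) + 2 * (p * d) * r) +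
    ((4 * d - 3 * (g * p * r)) ^+ 2 / 12 + 3 / 4 * ((g * p) ^+ 2 * (- (4 / 3) * r' - r ^+ 2))).
  by field.
by rewrite lerDl addr_ge0// ?divr_ge0// mulr_ge0.
Qed.

(** Test the equation with [psi ^+ 2 / u], regularized. *)
Lemma picone k psi : test_function U psi ->
  summ (fun x => u x `^ (- al) * (psi x * psi x * rho_k k (u x))) /\
  I (fun x => u x `^ (- al) * (psi x * psi x * rho_k k (u x))) <= 4 / 3 * en U psi psi.
Proof.
move=> tp; have sp := test_smooth tp; pose p2 x := psi x * psi x.
have t2 : test_function U p2 by exact: test_mul.
have dp2 i : pderiv i p2 = fun x => 2 * (psi x * pderiv i psi x).
  by rewrite /p2 pderivM//; apply/funext => x; ring.
pose c := rho_k k (0 : R).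
have [h0 g0] := H10_comp oU bU (smooth1_rho_k k c) (subrr c) (is_derive_rho_k k c)
  (smooth1_deriv_continuous (smooth1_rho_k k c) (is_derive_rho_k k c)) (rho_k'_bound k) hu.
have [h1 g1] := H10_mul_test oU bU t2 h0.
have [h2 g2] := H10_test oU bU t2.
have [h3 g3] := H10_scale oU bU c h2.
have [h4 g4] := H10_add oU bU h1 h3.
have [hp gp] := H10_test oU bU tp.
have e : (fun x => p2 x * (rho_k k (u x) - c) + c * p2 x) = fun x => p2 x * rho_k k (u x).
  by apply/funext => x; ring.
rewrite e in h4 g4; have [s eq] := su h4; split=> //; rewrite -eq !enE mulr_sumr.
apply: ler_sum => i _; rewrite -(ipZl mU _ (gr_L2 oU i hp) (gr_L2 oU i hp)).
apply: Rintegral_ae_le => //.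
- exact: (L2_mul mU (gr_L2 oU i hu) (gr_L2 oU i h4)).
- exact: (L2_mul mU (L2_scale mU _ (gr_L2 oU i hp)) (gr_L2 oU i hp)).
have ge : aeD mu U (fun x => gr U (fun x => p2 x * rho_k k (u x)) i x =
    p2 x * (rho_k' k (u x) * gr U u i x) + pderiv i p2 x * rho_k k (u x)).
  have g10 := aeD2 (fun x _ e1 e0 => etrans e1 (congr1 (fun t => _ * t + _) e0)) (g1 i) (g0 i).
  have g32 := aeD2 (fun x _ e3 e2 => etrans e3 (congr1 (fun t => _ * t) e2)) (g3 i) (g2 i).
  by apply: aeD3 (g4 i) g10 g32 => x _ -> -> ->; rewrite -/c; ring.
apply: aeD3 u0 ge (gp i) => x _ ux -> ->; rewrite dp2 -[leRHS]mulrA.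
by apply: picone_pointwise; apply: rho_k_sqr; exact: ltW.
Qed.

(** The square root of the potential of the linearized operator, up to the
    factor [al]. *)
Definition weight x : R := u x `^ (- ((1 + al) / 2)).

Lemma weight_sqr x : weight x * weight x = (u x `^ (1 + al))^-1.
Proof.
rewrite /weight -powRN -powRD; last by apply/implyP => /eqP; rewrite -opprD -splitr; move: al0; lra.
by rewrite -opprD -splitr.
Qed.

(** Let the regularization tend to [1 / u], by Fatou. *)
Lemma hardy_test psi : test_function U psi ->
  L2 mu U (fun x => weight x * psi x) /\ n2 mu U (fun x => weight x * psi x) <= 4 / 3 * en U psi psi.
Proof.
move=> tp; have mw : measurable_fun U weight by apply: measurable_powR_comp; exact: (H10_meas oU).
have mp := L2_meas (test_L2 oU tp).
have mwp : measurable_fun U (fun x => weight x * psi x) by exact: measurable_funM.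
have [|||s _ i] := @Rintegral_fatou _ _ _ mu U mU
  (fun k x => u x `^ (- al) * (psi x * psi x * rho_k k (u x)))
  (fun x => (weight x * psi x) ^+ 2) _ (fun k => (picone k tp).1) _ _ _ (fun k => (picone k tp).2).
- move=> k; apply: aeDW u0 => x _ ux.
  apply: mulr_ge0; first exact: powR_ge0.
  apply: mulr_ge0; first by rewrite -expr2 sqr_ge0.
  by apply: rho_k_ge0; exact: ltW.
- exact: measurable_funX.
- apply: aeDW u0 => x _ ux.
  have -> : (weight x * psi x) ^+ 2 = u x `^ (- al) * (psi x * psi x * (u x)^-1).
    rewrite expr2 mulrACA weight_sqr powRD ?powRr1 ?(ltW ux)//; last by apply/implyP => _; rewrite gt_eqF.
    by rewrite invfM powRN; ring.
  by apply: cvgMr; apply: cvgMr; exact: rho_k_cvg.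
by split; [split|].
Qed.

(** Test functions are dense, and an almost everywhere convergent subsequence
    passes the bound to the limit by Fatou. *)
Lemma hardy v : H10 U v ->
  L2 mu U (fun x => weight x * v x) /\ n2 mu U (fun x => weight x * v x) <= 4 / 3 * en U v v.
Proof.
move=> hv; have mw : measurable_fun U weight by apply: measurable_powR_comp; exact: (H10_meas oU).
have mwv : measurable_fun U (fun x => weight x * v x).
  by apply: measurable_funM => //; exact: (H10_meas oU).
have [Lv Lg [phi [tp cv cg]]] := H10_h10 oU hv.
have [s [ks cs]] := cvg2_ae_subseq mU (fun n => test_L2 oU (tp n)) Lv cv.
have hphi n := H10_test oU bU (tp n).
have enphi n : en U (phi n) (phi n) = \sum_i n2 mu U (pderiv i (phi n)).
  rewrite (en_ae oU (hphi n).1 (hphi n).1 _ _ (hphi n).2 (hphi n).2).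
  - by apply: eq_bigr => i _; rewrite n2E.
  - by move=> i; exact: L2_meas (test_L2 oU (test_pderiv i (tp n))).
  - by move=> i; exact: L2_meas (test_L2 oU (test_pderiv i (tp n))).
have cen : en U (phi n) (phi n) @[n --> \oo] --> en U v v.
  rewrite (_ : (fun n => _) = fun n => \sum_i n2 mu U (pderiv i (phi n))); last exact/funext.
  rewrite (_ : en U v v = \sum_i n2 mu U (gr U v i)); last by apply: eq_bigr => i _; rewrite n2E.
  apply: cvg_ord_sum => i; apply: cvg2_n2 (cg i) => // n.
  exact: (test_L2 oU (test_pderiv i (tp n))).
have key e : 0 < e -> L2 mu U (fun x => weight x * v x) /\
    n2 mu U (fun x => weight x * v x) <= 4 / 3 * (en U v v + e).
  move=> e0; have /cvgrPdist_le /(_ e e0) [K _ HK] := cen.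
  pose psi n := phi (s (n + K)%N).
  have tpsi n : test_function U (psi n) by exact: tp.
  have bound n : n2 mu U (fun x => weight x * psi n x) <= 4 / 3 * (en U v v + e).
    apply: le_trans (hardy_test (tpsi n)).2 _; apply: ler_wpM2l; first by lra.
    have := HK (s (n + K)%N) (leq_trans (leq_addl n K) (ks _)).
    by rewrite ler_norml => /andP[+ _]; rewrite -/(psi n); move: (en _ _ _) (en _ _ _) => *; lra.
  have [|||S _ i] := @Rintegral_fatou _ _ _ mu U mU (fun n x => (weight x * psi n x) ^+ 2)
    (fun x => (weight x * v x) ^+ 2) _ (fun n => (hardy_test (tpsi n)).1.2) _ _ _ bound.
  - by move=> n; apply: aeD_all => x _; exact: sqr_ge0.
  - exact: measurable_funX.
  - apply: aeDW cs => x _ c.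
    have c2 : weight x * psi n x @[n --> \oo] --> weight x * v x.
      by apply: cvgMr; move: c; rewrite -(cvg_shiftn K).
    by rewrite expr2; under eq_fun do rewrite expr2; apply: cvgM; exact: c2.
  by split; [split|].
split; first exact: (key 1 ltr01).1.
apply/ler_addgt0Pr => e e0; have /key[_ +] : 0 < e * (3 / 4) by rewrite mulr_gt0.
by move: (n2 _ _ _) (en _ _ _) => *; lra.
Qed.

End picone.

(** * The first eigenvalue *)

Section first_eigenvalue.
Context (R : realType) (N : nat) (U : set 'rV[R]_N) (al : R).
Hypotheses (N0 : (0 < N)%N) (oU : open U) (bU : bounded_set U) (al0 : 0 < al).
Local Notation mu := (@lebesgue_rV R N).
Implicit Types (u v w z f g : 'rV[R]_N -> R).
Let mU := domain_measurable oU.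

Variables (s : 'rV[R]_N -> R) (C : R).
Hypothesis C0 : 0 <= C.
Hypothesis hs : forall v, H10 U v ->
  L2 mu U (fun x => s x * v x) /\ n2 mu U (fun x => s x * v x) <= C * en U v v.

(** The quadratic form of the operator with potential [al * s ^+ 2]. *)
Definition form u v : R := en U u v + al * ip mu U (fun x => s x * u x) (fun x => s x * v x).

Lemma n2_quad t f g : L2 mu U f -> L2 mu U g ->
  n2 mu U (fun x => f x + t * g x) = n2 mu U f + 2 * t * ip mu U f g + t ^+ 2 * n2 mu U g.
Proof.
move=> hf hg; have htg := L2_scale mU t hg.
by rewrite (n2D mU hf htg) (ipZr mU t hg hf) (n2Z mU t hg) mulrA.
Qed.

Lemma form_quad t u v : H10 U u -> H10 U v ->
  form (fun x => u x + t * v x) (fun x => u x + t * v x) =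
  form u u + 2 * t * form u v + t ^+ 2 * form v v.
Proof.
move=> hu hv; rewrite /form (en_quad oU bU t hu hv) -!n2E.
have e : (fun x => s x * (u x + t * v x)) = fun x => s x * u x + t * (s x * v x).
  by apply/funext => x; ring.
rewrite e (n2_quad t (hs hu).1 (hs hv).1).
move: (en U u u) (en U u v) (en U v v) => a b c; move: (n2 _ _ _) (n2 _ _ _) => p q.
move: (ip _ _ _ _) => r; ring.
Qed.

Lemma en_le_form u : en U u u <= form u u.
Proof. by rewrite /form lerDl mulr_ge0 ?(ltW al0)// -n2E n2_ge0. Qed.

Lemma form_ge0 u : 0 <= form u u.
Proof. by apply: le_trans (en_le_form u); exact: en_ge0. Qed.

Lemma form_le u : H10 U u -> form u u <= (1 + al * C) * en U u u.
Proof.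
move=> hu; rewrite /form mulrDl mul1r lerD2l -mulrA; apply: ler_wpM2l; first exact: ltW.
by rewrite -n2E; exact: (hs hu).2.
Qed.

Lemma form_cs u v : H10 U u -> H10 U v -> form u v ^+ 2 <= form u u * form v v.
Proof.
move=> hu hv; apply: quadratic_ge0_le; first exact: form_ge0.
by move=> t; rewrite -(form_quad t hu hv); exact: form_ge0.
Qed.

Lemma form_scale c u : H10 U u -> form (fun x => c * u x) (fun x => c * u x) = c ^+ 2 * form u u.
Proof.
move=> hu; have hcu := (H10_scale oU bU c hu).1; rewrite /form.
rewrite (en_scalel oU bU c hu hcu) (en_sym U u) (en_scalel oU bU c hu hu) -!n2E.
have e : (fun x => s x * (c * u x)) = fun x => c * (s x * u x) by apply/funext => x; ring.
rewrite e (n2Z mU c (hs hu).1); move: (en _ _ _) (n2 _ _ _) => a b; ring.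
Qed.

Lemma form_min_homogeneous (j : R) :
  (forall w, H10 U w /\ n2 mu U w = 1 -> j <= form w w) ->
  forall z, H10 U z -> j * n2 mu U z <= form z z.
Proof.
move=> hj z hz; have [z0|z0] := leP (n2 mu U z) 0.
  have -> : n2 mu U z = 0 by apply/eqP; rewrite eq_le z0 n2_ge0.
  by rewrite mulr0 form_ge0.
pose c := (Num.sqrt (n2 mu U z))^-1.
have c2 : c ^+ 2 * n2 mu U z = 1 by rewrite /c exprVn sqr_sqrtr ?ltW// mulVf// gt_eqF.
have := hj _ (conj (H10_scale oU bU c hz).1 (etrans (n2Z mU c (H10_L2 oU hz)) c2)).
rewrite (form_scale c hz) => h.
have : n2 mu U z * j <= n2 mu U z * (c ^+ 2 * form z z) by rewrite ler_pM2l.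
by rewrite mulrA (mulrC (n2 _ _ _) (c ^+ 2)) c2 mul1r mulrC.
Qed.

(** Minimize the form on the unit sphere of [L2]; a minimizing sequence has an
    [L2]-Cauchy subsequence by compactness, which the parallelogram law turns
    into a Cauchy sequence for the form. *)
Lemma form_minimizer : (exists w, H10 U w /\ 0 < n2 mu U w) ->
  exists w, [/\ H10 U w, n2 mu U w = 1
    & forall z, H10 U z -> form w w * n2 mu U z <= form z z].
Proof.
move=> [w0 [hw0 w00]].
pose P w := H10 U w /\ n2 mu U w = 1.
have P0 : [set w | P w] !=set0.
  pose c := (Num.sqrt (n2 mu U w0))^-1; exists (fun x => c * w0 x); split.
    exact: (H10_scale oU bU c hw0).1.
  rewrite (n2Z mU c (H10_L2 oU hw0)) /c exprVn sqr_sqrtr ?(ltW w00)//.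
  by rewrite mulVf// gt_eqF.
have [j [w_ [hj hw_]]] := @minimizing_sequence R _ _ (fun w => form w w) 0 P0 (fun w _ => form_ge0 w).
have hw n := (hw_ n).1.1; have nw n := (hw_ n).1.2; have Jw n := (hw_ n).2.
have hom := form_min_homogeneous hj.
have hsub k l := H10_sub oU bU (hw k) (hw l).
pose M := Num.max 1 (j + 1).
have M1 : 1 <= M by rewrite le_max lexx.
have jM : j + 1 <= M by rewrite le_max lexx orbT.
have jM' : j <= M by apply: le_trans jM; rewrite lerDl.
have inv1 n : n.+1%:R^-1 <= 1 :> R by rewrite invf_le1// ler1n.
have [t [kt ct]] : exists t : nat -> nat, (forall k, (k <= t k)%N) /\
    forall e, 0 < e -> exists K, forall k l, (K <= k)%N -> (K <= l)%N ->
      n2 mu U (fun x => w_ (t k) x - w_ (t l) x) <= e.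
  apply: (rellich oU bU (fun n => H10_h10 oU (hw n)) (M := M)) => n; first by rewrite nw.
  have -> : \sum_i n2 mu U (fun x => wgrad U (w_ n) x ord0 i) = en U (w_ n) (w_ n).
    by rewrite enE; apply: eq_bigr => i _; rewrite n2E.
  apply: le_trans (en_le_form _) _; apply: le_trans (Jw n) _.
  by apply: le_trans jM; rewrite lerD2l.
have cau e : 0 < e -> exists K, forall k l, (K <= k)%N -> (K <= l)%N ->
    en U (fun x => w_ (t k) x - w_ (t l) x) (fun x => w_ (t k) x - w_ (t l) x) <= e.
  move=> e0; have M0 : 0 < M by apply: lt_le_trans M1.
  have [|K1 HK1] := ct (e / (2 * M)); first by rewrite divr_gt0// mulr_gt0.
  have [|K2 HK2] := @invS_le_eps R (e / 8); first by rewrite divr_gt0.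
  exists (maxn K1 K2) => k l; rewrite !geq_max => /andP[k1 k2] /andP[l1 l2].
  apply: le_trans (en_le_form _) _.
  have hk := hw (t k); have hl := hw (t l).
  have J1 := le_trans (Jw (t k)) (lerD (lexx j) (HK2 _ (leq_trans k2 (kt k)))).
  have J2 := le_trans (Jw (t l)) (lerD (lexx j) (HK2 _ (leq_trans l2 (kt l)))).
  have d := HK1 _ _ k1 l1.
  have q1 := form_quad 1 hk hl; have q2 := form_quad (-1) hk hl.
  have n1 := n2_quad 1 (H10_L2 oU hk) (H10_L2 oU hl).
  have n2_ := n2_quad (-1) (H10_L2 oU hk) (H10_L2 oU hl).
  have hp := hom _ (H10_add oU bU hk (H10_scale oU bU 1 hl).1).1.
  have e1 : (fun x => w_ (t k) x + -1 * w_ (t l) x) = fun x => w_ (t k) x - w_ (t l) x.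
    by apply/funext => x; rewrite mulN1r.
  rewrite e1 in q2 n2_; rewrite nw nw in n1 n2_.
  have dM : M * n2 mu U (fun x => w_ (t k) x - w_ (t l) x) <= e / 2.
    have -> : e / 2 = M * (e / (2 * M)) by field; rewrite gt_eqF.
    by rewrite ler_pM2l.
  have dj : j * n2 mu U (fun x => w_ (t k) x - w_ (t l) x) <=
      M * n2 mu U (fun x => w_ (t k) x - w_ (t l) x) by apply: ler_wpM2r => //; exact: n2_ge0.
  rewrite q1 n1 in hp; rewrite q2.
  move: n2_ dM dj hp J1 J2.
  move: (n2 mu U (fun x => w_ (t k) x - w_ (t l) x)) (ip _ _ _ _) => D p.
  move: (form (w_ (t k)) (w_ (t k))) (form (w_ (t k)) (w_ (t l))) (form (w_ (t l)) (w_ (t l))).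
  move=> a b c n2_ dM dj hp J1 J2.
  (* Both functions have norm one, so their inner product is determined by the
     distance between them. *)
  have pE : p = 1 - D / 2 by rewrite n2_; field.
  by rewrite pE in hp; lra.
have [w [Hw cw]] := H10_complete oU bU N0 (fun k => hw (t k)) cau.
have [Cp [Cp0 hCp]] := H10_poincare oU bU N0.
have hd k := H10_sub oU bU (hw (t k)) Hw.
have small e : 0 < e -> exists K, forall k, (K <= k)%N ->
    en U (fun x => w_ (t k) x - w x) (fun x => w_ (t k) x - w x) <= e.
  exact: ((cvg0_epsP (fun n => en_ge0 U _)).1 cw).
have nw1 : n2 mu U w = 1.
  have c2 : cvg2 mu U (fun k => w_ (t k)) w.
    apply/cvg2_epsP => // e e0; have [|K HK] := small (e / Cp); first by rewrite divr_gt0.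
    exists K => k Kk; apply: le_trans (hCp _ (hd k)) _.
    by rewrite mulrC -ler_pdivlMr//; exact: HK.
  have := cvg2_n2 mU (fun k => H10_L2 oU (hw (t k))) (H10_L2 oU Hw) c2.
  rewrite (_ : (fun n => _) = cst 1); last by apply/funext => k; exact: nw.
  by move=> h; apply: (cvg_unique _ h (cvg_cst _)).
exists w; split=> // z hz; apply: le_trans (hom z hz).
apply: ler_wpM2r; first exact: n2_ge0.
apply/ler_addgt0Pr => e e0.
have W1 : 0 < form w w + 1 by apply: ltr_wpDl => //; exact: form_ge0.
have A0 : 0 < 1 + al * C by rewrite ltr_pwDl// mulr_ge0// ltW.
(* Chosen so that the cross term is at most [e / 4] by Cauchy-Schwarz. *)
pose dl := (e / 4) ^+ 2 / (form w w + 1).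
have dl0 : 0 < dl by rewrite divr_gt0// exprn_gt0// divr_gt0.
have [|K1 HK1] := small (dl / (1 + al * C)); first by rewrite divr_gt0.
have [|K2 HK2] := @invS_le_eps R (e / 2); first by rewrite divr_gt0.
pose k := maxn K1 K2; pose d x := w_ (t k) x - w x.
have dk : form d d <= dl.
  apply: le_trans (form_le (hd k)) _.
  by rewrite mulrC -ler_pdivlMr//; exact: HK1 (leq_maxl _ _).
have Jk : form (w_ (t k)) (w_ (t k)) <= j + e / 2.
  by apply: le_trans (Jw _) _; rewrite lerD2l; apply: HK2; exact: leq_trans (leq_maxr _ _) (kt k).
have wE : (fun x => w x + 1 * d x) = w_ (t k) by apply/funext => x; rewrite /d; ring.
have q := form_quad 1 Hw (hd k : H10 U d); rewrite wE in q.
have bs : `|form w d| <= e / 4.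
  apply: norm_le_of_sqr; first by rewrite divr_gt0.
  apply: le_trans (form_cs Hw (hd k)) _; rewrite -/d.
  apply: (@le_trans _ _ ((form w w + 1) * dl)).
    by apply: ler_pM; [exact: form_ge0|exact: form_ge0|rewrite lerDl|].
  by rewrite /dl mulrC divfK// gt_eqF.
move: bs; rewrite ler_norml => /andP[bs _]; have d0 := form_ge0 d.
by move: (form _ _) (form _ _) (form _ _) (form _ _) q bs Jk d0 => *; lra.
Qed.

(** The Euler-Lagrange equation: the form minus its minimum is nonnegative and
    vanishes at the minimizer, hence pairs to zero with it. *)
Lemma first_eigenfunction : (exists w, H10 U w /\ 0 < n2 mu U w) ->
  exists (m1 : R) w, [/\ 0 < m1, H10 U w, n2 mu U w = 1,
    forall v, H10 U v -> form w v = m1 * ip mu U w v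
    & forall z, H10 U z -> m1 * n2 mu U z <= form z z].
Proof.
move=> /form_minimizer[w [hw nw min]]; exists (form w w), w; split=> //.
- have [Cp [Cp0 hCp]] := H10_poincare oU bU N0.
  have : 0 < Cp * en U w w by apply: lt_le_trans (hCp w hw); rewrite nw.
  by rewrite pmulr_rgt0// => h; apply: lt_le_trans (en_le_form w).
move=> v hv; apply/eqP; rewrite -subr_eq0 -sqrf_eq0 eq_le sqr_ge0 andbT.
have -> : 0 = 0 * (form v v - form w w * n2 mu U v) by rewrite mul0r.
apply: quadratic_ge0_le; first by rewrite subr_ge0; exact: min.
move=> r; have := min _ (H10_add oU bU hw (H10_scale oU bU r hv).1).1.
rewrite (form_quad r hw hv) (n2_quad r (H10_L2 oU hw) (H10_L2 oU hv)) nw.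
move: (form w w) (form w v) (form v v) (ip _ _ _ _) (n2 _ _ _) => a b c p q h.
by rewrite -subr_ge0 in h; apply: le_trans h _; rewrite le_eqVlt; apply/orP; left; apply/eqP; ring.
Qed.

End first_eigenvalue.

(** * The distance to the boundary *)

Section domains.
Context (R : realType) (N : nat) (U : set 'rV[R]_N).
Hypotheses (N0 : (0 < N)%N) (oU : open U) (bU : bounded_set U).
Local Notation mu := (@lebesgue_rV R N).
Implicit Types (x y : 'rV[R]_N).

Lemma coord_le_enorm x i : `|x ord0 i| <= enorm x.
Proof.
rewrite /enorm -sqrtr_sqr ler_wsqrtr// /dot (bigD1 i)//= -expr2 lerDl.
by apply: sumr_ge0 => j _; rewrite -expr2 sqr_ge0.
Qed.

Lemma openE_notin_boundary x : U x -> ~ boundary U x.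
Proof. by move=> Ux [_]; apply; rewrite ((interior_id U).1 oU). Qed.

(** Otherwise the set would be closed, and as lines are connected it would
    contain every line through one of its points. *)
Lemma boundary_nonempty : U !=set0 -> boundary U !=set0.
Proof.
move=> [x Ux]; apply/set0P/negP => /eqP b0.
have clU : closed U.
  move=> y cy; apply: contrapT => nUy; have : boundary U y by split=> // /interior_subset.
  by rewrite b0.
pose i : 'I_N := Ordinal N0; pose v : 'rV[R]_N := delta_mx ord0 i.
pose line (t : R) := x + t *: v.
have cline : continuous line.
  by move=> t; apply: cvgD; [exact: cvg_cst|exact: scalel_continuous].
have all : line @^-1` U = setT.
  apply: ((connected_intervalP (setT : set R)).2 _ (line @^-1` U)) => //.
  - by exists 0; rewrite /line /preimage/= scale0r addr0.
  - by exists (line @^-1` U); [exact: open_comp|rewrite setTI].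
  - by exists (line @^-1` U); [exact: preimage_closed|rewrite setTI].
have [b [b0' Ub]] := bounded_sub_centered_cube bU.
pose t := b + 1 - x ord0 i.
have /Ub/centered_cubeP/(_ i) : U (line t) by have : (line @^-1` U) t by rewrite all.
by rewrite !mxE !eqxx/= mulr1 /t addrC subrK => /andP[_]; rewrite gtrDl ltr10.
Qed.

(** The Euclidean norm dominates the coordinates, hence the sup norm whose balls
    define the topology. *)
Lemma bdist_gt0 x : U x -> 0 < bdist U x.
Proof.
move=> Ux; have [y0 by0] := boundary_nonempty (ex_intro _ x Ux).
have /nbhs_ballP[e e0 xe] : nbhs x U by exact: open_nbhs_nbhs.
apply: (lt_le_trans e0); apply: lb_le_inf; first by exists (enorm (x - y0)); exists y0.
move=> _ [y By <-]; rewrite leNgt; apply/negP => xy.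
apply: openE_notin_boundary By; apply: xe; apply/coord_ball => // i.
by apply: le_lt_trans xy; have := coord_le_enorm (x - y) i; rewrite !mxE.
Qed.

Lemma lebesgue_open_gt0 : U !=set0 -> (0 < mu U)%E.
Proof.
move=> [x Ux]; have /nbhs_ballP[e e0 xe] : nbhs x U by exact: open_nbhs_nbhs.
apply: (@lt_le_trans _ _ (mu (cube x e))).
  by rewrite lebesgue_rV_cube ?(ltW e0)// lte_fin exprn_gt0.
apply: le_measure; rewrite ?inE.
- exact: measurable_cube.
- exact: domain_measurable.
move=> y xy; apply: xe; apply/coord_ball => // i; have /andP[h1 h2] := xy i.
by rewrite distrC ger0_norm ?subr_ge0// ltrBlDl.
Qed.

Lemma aeD_contradiction : U !=set0 -> aeD mu U (fun=> False) -> False.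
Proof.
move=> /lebesgue_open_gt0 + h; rewrite lt_def => /andP[/eqP + _]; apply.
apply/(negligibleP mu (domain_measurable oU)); apply: negligibleS h.
by move=> x Ux; exact.
Qed.

End domains.

(** * The linearized problem *)

Section linearization.
Context (R : realType) (N : nat) (U : set 'rV[R]_N) (al : R).
Hypotheses (N0 : (0 < N)%N) (oU : open U) (bU : bounded_set U) (al0 : 0 < al).
Local Notation mu := (@lebesgue_rV R N).
Implicit Types (v w : 'rV[R]_N -> R).
Variable u : 'rV[R]_N -> R.
Let mU := domain_measurable oU.
Hypothesis hs : forall v, H10 U v -> L2 mu U (fun x => weight al u x * v x) /\
  n2 mu U (fun x => weight al u x * v x) <= 4 / 3 * en U v v.

Lemma linearized_formE v w : H10 U v -> H10 U w ->
  (dirichlet U w v + al%:E * \int[mu]_(x in U) (w x * v x / u x `^ (1 + al))%:E)%E =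
  (form U al (weight al u) w v)%:E.
Proof.
move=> hv hw; rewrite (dirichletE oU hw hv) /form EFinD EFinM /ip.
rewrite RintegralE//; last exact: (L2_mul mU (hs hw).1 (hs hv).1).
congr (_ + _ * _)%E; apply: eq_integral => x _; congr EFin.
by rewrite mulrACA (weight_sqr al0 u) mulrC.
Qed.

Lemma linearized_eigenvalueP (m : R) : linearized_eigenvalue U al u m <->
  exists w, [/\ H10 U w, 0 < n2 mu U w &
    forall v, H10 U v -> form U al (weight al u) w v = m * ip mu U w v].
Proof.
have ipE w v : H10 U w -> H10 U v -> (\int[mu]_(x in U) (w x * v x)%:E)%E = (ip mu U w v)%:E.
  by move=> hw hv; rewrite /ip RintegralE//; exact: (L2_mul mU (H10_L2 oU hw) (H10_L2 oU hv)).
split=> -[w [hw nw ew]]; exists w; split=> //.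
- rewrite lt_def n2_ge0 andbT; apply/eqP => n0; apply: nw.
  have := n2_eq0 mU (H10_L2 oU hw); rewrite n0 => /(_ (lexx _)).
  exact.
- move=> v hv; have := ew v hv; rewrite (linearized_formE hv hw) (ipE _ _ hw hv).
  by rewrite -EFinM => -[].
- move=> w0; move: nw; rewrite (n2_ae_eq mU (L2_meas (H10_L2 oU hw)) (measurable_cst (0 : R)) w0).
  rewrite /n2 (_ : (fun x => _) = cst 0) ?Rintegral_zero ?ltxx//.
  by apply/funext => x; rewrite expr0n.
- by move=> v hv; rewrite (linearized_formE hv hw) (ipE _ _ hw hv) -EFinM ew.
Qed.

Lemma linearly_stable_of_hardy : (exists w, H10 U w /\ 0 < n2 mu U w) -> linearly_stable U al u.
Proof.
have C0 : 0 <= 4 / 3 :> R by lra.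
move=> /(first_eigenfunction N0 oU bU al0 C0 hs)[m1 [w [m10 hw nw ew min]]].
exists m1; split=> //.
  by apply/linearized_eigenvalueP; exists w; split=> //; rewrite nw.
move=> m /linearized_eigenvalueP[z [hz nz ez]].
by have := min z hz; rewrite (ez z hz) -n2E ler_pM2r.
Qed.

End linearization.

Theorem theorem2p8 (R : realType) (N : nat) (N_gt0 : (0 < N)%N)
  (Omega : set 'rV[R]_N) (alpha : R) (usub usup : 'rV[R]_N -> R) (c1 c2 : R) :
  smooth_bounded_domain Omega ->
  0 < alpha < 1 ->
  subsolution Omega alpha usub ->
  supersolution Omega alpha usup ->
  0 < c1 ->
  ae_le Omega (fun x => c1 * bdist Omega x) usub ->
  ae_le Omega usub usup ->
  ae_le Omega usup (fun x => c2 * bdist Omega x) ->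
  exists u : 'rV[R]_N -> R,
    [/\ [/\ weak_solution Omega alpha u, ae_pos Omega u,
             ae_le Omega usub u & ae_le Omega u usup],
        (forall v : 'rV[R]_N -> R,
           weak_solution Omega alpha v -> ae_pos Omega v ->
           ae_le Omega usub v -> ae_le Omega v usup ->
           v = u %[ae lebesgue_rV N in Omega])
      & linearly_stable Omega alpha u].
Proof.
move=> [ne oU _ bU _] /andP[al0 al1] ssub ssup c10 cd_sub sub_sup sup_cd.
have [hsub _ _] := ssub; have mO := domain_measurable oU.
have sub0 : aeD (lebesgue_rV N) Omega (fun x => 0 < usub x).
  by apply: aeDW cd_sub => x Ox; apply: lt_le_trans; rewrite mulr_gt0// bdist_gt0.
(* The upper bound by [c2] times the distance is only relaxed by the absolute
   value and the added [1], which make [K] positive. *)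
pose K := (`|c2| + 1) / c1.
have K0 : 0 < K by rewrite divr_gt0// ltr_wpDl.
have sup_K : aeD (lebesgue_rV N) Omega (fun x => usup x <= K * usub x).
  apply: aeD2 cd_sub sup_cd => x Ox h1 h2; apply: le_trans h2 _.
  apply: (@le_trans _ _ (K * (c1 * bdist Omega x))); last by rewrite ler_pM2l.
  rewrite mulrA divfK ?gt_eqF// ler_wpM2r//; first exact/ltW/bdist_gt0.
  by apply: le_trans (ler_norm _) _; rewrite lerDl.
have hsg := hardy_weight_subsolution oU bU al0 hsub ssup K0 sub0 sub_sup sup_K.
have [u [hu sub_u u_sup eu]] := solution_between N_gt0 oU bU al0 al1 ssub ssup sub0 sub_sup hsg.
have u0 : aeD (lebesgue_rV N) Omega (fun x => 0 < u x).
  by apply: aeD2 sub0 sub_u => x _; exact: lt_le_trans.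
have su : weak_solution Omega alpha u.
  by apply/(weak_solutionE oU hu (fun v hv => (eu v hv).1)) => v hv; exact: (eu v hv).2.
exists u; split=> //.
  move=> v sv _ sub_v _.
  exact: (solution_unique N_gt0 oU bU al0 sub0 hsg su sv sub_u sub_v).
apply: (linearly_stable_of_hardy N_gt0 oU bU al0 (hardy oU bU al0 hu u0 eu)).
exists u; split=> //; rewrite lt_def n2_ge0 andbT; apply/eqP => n0.
apply: (aeD_contradiction oU ne).
have := n2_eq0 mO (H10_L2 oU hu); rewrite n0 => /(_ (lexx _)) ue.
by apply: aeD2 u0 ue => x _ + e; rewrite e ltxx.
Qed.
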